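(* Let $\alpha>0$ and let $\bar\mu_\alpha$ be the probability measure on $\mathbb R$ with density $$\bar\mu_\alpha(E)=\frac{e^{-E^2/2}}{\sqrt{2\pi}}\frac1{|\hat f_\alpha(E)|^2},\qquad \hat f_\alpha(E)=\sqrt{\frac{\alpha}{\Gamma(\alpha)}}\int_0^\infty t^{\alpha-1}e^{-\frac{t^2}2+iEt}\,dt .$$ Then for every $E\in\mathbb R$, $$\bar\mu_\alpha(E)=\frac1{\sqrt{2\pi}\,\Gamma(\alpha+1)}\exp\left(-\frac{E^2}2+2\alpha\int_{\mathbb R}\log|E-y|\,\bar\mu_\alpha(dy)\right).$$
   Context: $\bar\mu_\alpha$ denotes both the probability measure and its density with respect to Lebesgue measure. It is known (and may be taken as background) that the formula $E\mapsto\frac{e^{-E^2/2}}{\sqrt{2\pi}}\frac1{|\hat f_\alpha(E)|^2}$, with $\hat f_\alpha(E)=\sqrt{\frac{\alpha}{\Gamma(\alpha)}}\int_0^\infty t^{\alpha-1}e^{-\frac{t^2}2+iEt}\,dt$, defines a probability density on $\mathbb R$, and that $\bar\mu_\alpha$ is the spectral measure, at the first basis vector, of the infinite Jacobi matrix with zero diagonal and off-diagonal entries $\sqrt{\alpha+1},\sqrt{\alpha+2},\dots$ (the probability measure of associated Hermite polynomials). *)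

(* Defs.v *)
From HB Require Import structures.
From mathcomp Require Import all_boot all_order all_algebra.
From mathcomp Require Import complex.
From mathcomp Require Import all_classical all_reals all_analysis.

Set Implicit Arguments.
Unset Strict Implicit.
Unset Printing Implicit Defensive.

Import Order.TTheory GRing.Theory Num.Theory.
Import numFieldNormedType.Exports.

Local Open Scope classical_set_scope.
Local Open Scope ring_scope.

Definition Gamma {R : realType} (a : R) : R :=
  \int[lebesgue_measure]_(t in `]0, +oo[) (t `^ (a - 1) * expR (- t)).

Definition cexp {R : realType} (z : R[i]) : R[i] :=
  Complex (expR (complex.Re z) * cos (complex.Im z))
          (expR (complex.Re z) * sin (complex.Im z)).

Definition Cintegral {d : measure_display} {T : measurableType d}
    {R : realType} (mu : {measure set T -> \bar R}) (D : set T)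
    (g : T -> R[i]) : R[i] :=
  Complex (\int[mu]_(x in D) complex.Re (g x))
          (\int[mu]_(x in D) complex.Im (g x)).

Definition f_hat {R : realType} (alpha E : R) : R[i] :=
  real_complex R (Num.sqrt (alpha / Gamma alpha)) *
  Cintegral lebesgue_measure `]0, +oo[
    (fun t : R => real_complex R (t `^ (alpha - 1)) *
                  cexp (Complex (- t ^+ 2 / 2) (E * t))).

Definition mu_density {R : realType} (alpha E : R) : R :=
  expR (- E ^+ 2 / 2) / Num.sqrt (2 * pi) * (1 / ComplexField.Normc.normc (f_hat alpha E) ^+ 2).

Definition has_density {R : realType}
    (mu : {measure set (measurableTypeR R) -> \bar R}) (p : R -> R) : Prop :=
  forall A : set (measurableTypeR R), measurable A ->
    mu A = (\int[lebesgue_measure]_(x in A) (p x)%:E)%E.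

(* [ln 0 = 0] in the library, whereas log 0 is -oo in the usual convention: the
   two functions of y differ only at y = E, which is a null set for every mu
   having a density. *)
Definition log_kernel {R : realType} (E y : R) : R := ln `|E - y|.

(* Main.v *)
Require Import Defs.
From HB Require Import structures.
From mathcomp Require Import all_boot all_order all_algebra.
From mathcomp Require Import complex ring lra.
From mathcomp Require Import all_classical all_reals all_analysis.
From mathcomp Require Import measurable_realfun gauss_integral.

Set Implicit Arguments.
Unset Strict Implicit.
Unset Printing Implicit Defensive.

Import Order.TTheory GRing.Theory Num.Theory.
Import numFieldNormedType.Exports.

Local Open Scope classical_set_scope.
Local Open Scope ring_scope.

(** Write F_a(z) for the integral of t^(a-1) exp(-t^2/2 + izt) over t > 0, an
    entire function (FT), so that the density is a multiple of
    exp(-x^2/2) / |F_a(x)|^2, and Lam(z) for the integral of log(-i(z - s)) against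
    the measure, whose real part is the logarithmic potential. The identity
    says that G = F_a exp(a Lam) has modulus Gamma(a) on the real line, and it
    holds because G is constant on the closed upper half-plane.

    On the real line G has constant argument. Indeed F_a' = i F_(a+1), and F_a
    and its conjugate solve y'' + x y' + a y = 0; their Wronskian shows that the
    argument of F_a increases at the rate pi a times the density
    (FT_wronskian, mu_density_wronskian). The value of the Wronskian at 0 is
    found from FT_duplication, a form of Legendre's duplication formula. The
    imaginary part of Lam on the real line is pi/2 minus pi times the
    distribution function of the measure (is_derive_ImLam), so that a Im(Lam)
    compensates the argument of F_a (GG_phase). Hence the harmonic function
    Im(conj(G(0)) G) vanishes on the real line.

    It vanishes in the upper half-plane as well, by the Phragmen-Lindelof
    principle: F_a is O(|z|^(-n)) there for every integer n <= a (FT_decay),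
    while |exp(a Lam)| is O(|z|^a) (Lam_le), so that G is of growth exponent
    a - n, which is less than 1 for n the integer part of a. By the
    Cauchy-Riemann equations G is then constant on vertical lines.

    Finally |F_a(x + iy)| y^a tends to Gamma(a) as y tends to infinity
    (FT_asymptotic), and Re(Lam(x + iy)) - log y tends to 0 (Lam_asymptotic),
    so the modulus of G is Gamma(a).

    That Lam is finite and continuous up to the real line, and in particular
    that the logarithm is integrable, requires a decay of the density. Its reciprocal N satisfies N'' >= N for large x, and cannot
    decrease for ever since the total mass is 1; hence it grows at least
    quadratically (mu_density_le). *)
(** * Derivation rules and integrals over the half-line *)

(** Pointwise derivation rules, in the form in which the tactic [der] below
    composes them: the value of the derivative is built by unification and
    compared to the expected one afterwards. *)
Section derive_rules.
Context {R : realType}.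
Implicit Types (f g : R -> R) (x a b : R).

Lemma drv_eq f x a b : is_derive x 1 f a -> a = b -> is_derive x 1 f b.
Proof. by move=> h <-. Qed.

Lemma drv_ext f g x a : (forall t, f t = g t) ->
  is_derive x 1 g a -> is_derive x 1 f a.
Proof. by move=> /funext ->. Qed.

Lemma drv_cst x b : is_derive x 1 (fun _ => b) 0.
Proof. exact: is_derive_cst. Qed.

Lemma drv_id x : is_derive x 1 (fun t => t) 1.
Proof. exact: is_derive_id. Qed.

Lemma drv_add f g x a b : is_derive x 1 f a -> is_derive x 1 g b ->
  is_derive x 1 (fun t => f t + g t) (a + b).
Proof. by move=> hf hg; exact: is_deriveD. Qed.

Lemma drv_opp f x a : is_derive x 1 f a -> is_derive x 1 (fun t => - f t) (- a).
Proof. by move=> hf; exact: is_deriveN. Qed.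

Lemma drv_mul f g x a b : is_derive x 1 f a -> is_derive x 1 g b ->
  is_derive x 1 (fun t => f t * g t) (f x * b + a * g x).
Proof.
by move=> hf hg; apply: drv_eq (is_deriveM hf hg) _; rewrite /GRing.scale /= (mulrC a).
Qed.

Lemma drv_exp f x a n : is_derive x 1 f a ->
  is_derive x 1 (fun t => f t ^+ n) (n%:R * f x ^+ n.-1 * a).
Proof.
move=> hf; have := is_deriveX n hf; rewrite /GRing.scale /=.
by congr is_derive; apply/funext => t; rewrite exprfctE.
Qed.

Lemma drv_comp (h : R -> R) f x a b : is_derive (f x) 1 h b ->
  is_derive x 1 f a -> is_derive x 1 (fun t => h (f t)) (b * a).
Proof. by move=> hh hf; exact: is_derive1_comp. Qed.

Lemma drv_inv f x a : f x != 0 -> is_derive x 1 f a ->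
  is_derive x 1 (fun t => (f t)^-1) (- f x ^- 2 * a).
Proof. by move=> h hf; apply: drv_eq (is_deriveV h hf) _. Qed.

Lemma drv_mull x c : is_derive x 1 ( *%R c) c.
Proof. by apply: drv_eq (drv_mul (drv_cst x c) (drv_id x)) _; rewrite mulr1 mul0r addr0. Qed.

Lemma drv_addl x c : is_derive x 1 ( +%R c) 1.
Proof. by apply: drv_eq (drv_add (drv_cst x c) (drv_id x)) _; rewrite add0r. Qed.

Lemma drv_oppid x : is_derive x 1 -%R (- 1 : R).
Proof. exact: (drv_opp (drv_id x)). Qed.

Lemma drv_invid x : x != 0 -> is_derive x 1 GRing.inv (- x ^- 2).
Proof. by move=> x0; apply: drv_eq (drv_inv x0 (drv_id x)) _; rewrite mulr1. Qed.

Lemma drv_continuous f x a : is_derive x 1 f a -> {for x, continuous f}.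
Proof. by move=> [h _]; exact/differentiable_continuous/derivable1_diffP. Qed.

End derive_rules.

Ltac der1 := lazymatch goal with
  | |- is_derive _ _ (fun t => t) _ => exact: drv_id
  | |- is_derive _ _ (fun _ => ?c) _ => exact: drv_cst
  | |- is_derive _ _ (fun t => _ + _) _ => notypeclasses refine (@drv_add _ _ _ _ _ _ _ _); der1
  | |- is_derive _ _ (fun t => - _) _ => notypeclasses refine (@drv_opp _ _ _ _ _); der1
  | |- is_derive _ _ (fun t => _ * _) _ => notypeclasses refine (@drv_mul _ _ _ _ _ _ _ _); der1
  | |- is_derive _ _ (fun t => _ ^+ _) _ => notypeclasses refine (@drv_exp _ _ _ _ _ _); der1
  | |- is_derive _ _ (fun t => _^-1) _ => notypeclasses refine (@drv_inv _ _ _ _ _ _); [|der1]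
  | |- is_derive _ _ (fun t => expR _) _ =>
      notypeclasses refine (@drv_comp _ _ _ _ _ _ (is_derive_expR _) _); der1
  | |- is_derive _ _ (fun t => cos _) _ =>
      notypeclasses refine (@drv_comp _ _ _ _ _ _ (is_derive_cos _) _); der1
  | |- is_derive _ _ (fun t => sin _) _ =>
      notypeclasses refine (@drv_comp _ _ _ _ _ _ (is_derive_sin _) _); der1
  | |- is_derive _ _ (fun t => atan _) _ =>
      notypeclasses refine (@drv_comp _ _ _ _ _ _ (is_derive1_atan _) _); der1
  | |- is_derive _ _ (fun t => ln _) _ =>
      notypeclasses refine (@drv_comp _ _ _ _ _ _ (is_derive1_ln _) _); [|der1]
  | |- is_derive _ _ (fun t => Num.sqrt _) _ =>
      notypeclasses refine (@drv_comp _ _ _ _ _ _ (is_derive1_sqrt _) _); [|der1]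
  | |- is_derive _ _ (fun t => _ `^ _) _ =>
      notypeclasses refine (@drv_comp _ _ _ _ _ _ (is_derive1_powR _ _) _); [|der1]
  | |- is_derive _ _ ( *%R ?c) _ => exact: drv_mull
  | |- is_derive _ _ ( +%R ?c) _ => exact: drv_addl
  | |- is_derive _ _ -%R _ => exact: drv_oppid
  | |- is_derive _ _ expR _ => exact: is_derive_expR
  | |- is_derive _ _ cos _ => exact: is_derive_cos
  | |- is_derive _ _ sin _ => exact: is_derive_sin
  | |- is_derive _ _ GRing.inv _ => apply: drv_invid
  | |- _ => try eassumption
  end.
Ltac der := notypeclasses refine (@drv_eq _ _ _ _ _ _ _); [der1|cbv beta].

Lemma cvgn_unique (R : realType) (u : nat -> R) (a b : R) :
  u n @[n --> \oo] --> a -> u n @[n --> \oo] --> b -> a = b.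
Proof.
by move=> ua ub; rewrite -(cvg_lim (@Rhausdorff R) ua) (cvg_lim (@Rhausdorff R) ub).
Qed.

Lemma cvg_Rintegral_dominated d (T : measurableType d) (R : realType)
    (m : {measure set T -> \bar R}) (D : set T) (f_ : nat -> T -> R)
    (f g : T -> R) :
  measurable D -> (forall n, measurable_fun D (f_ n)) -> measurable_fun D f ->
  (\forall t \ae m, D t -> f_ n t @[n --> \oo] --> f t) ->
  m.-integrable D (EFin \o g) ->
  (\forall t \ae m, forall n, D t -> `|f_ n t| <= g t) ->
  m.-integrable D (EFin \o f) /\
  \int[m]_(t in D) f_ n t @[n --> \oo] --> \int[m]_(t in D) f t.
Proof.
move=> mD mf_ mf cf ig fg.
have mf_' n : measurable_fun D (fun t => (f_ n t)%:E) by exact/measurable_EFinP.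
have mf' : measurable_fun D (fun t => (f t)%:E) by exact/measurable_EFinP.
have [] := @dominated_convergence _ _ _ m _ mD (fun n t => (f_ n t)%:E)
  (fun t => (f t)%:E) (EFin \o g) mf_' mf'.
- by apply: filterS cf => t h Dt; apply: cvg_EFin; [exact: nearW|exact: h].
- by [].
- by apply: filterS fg => t h n Dt; rewrite lee_fin; exact: h.
move=> intf _ c; split => //.
by apply: fine_cvg; rewrite fineK //; exact: integrable_fin_num.
Qed.

Lemma le_integrableR d (T : measurableType d) (R : realType)
    (m : {measure set T -> \bar R}) (D : set T) (f g : T -> R) :
  measurable D -> measurable_fun D f -> (forall t, D t -> `|f t| <= g t) ->
  m.-integrable D (EFin \o g) -> m.-integrable D (EFin \o f).
Proof.
move=> mD mf fg; apply: le_integrable => //; first exact/measurable_EFinP.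
by move=> t Dt; rewrite /= lee_fin (le_trans (fg _ Dt)) ?ler_norm.
Qed.

Section integrable_real.
Context d (T : measurableType d) (R : realType).
Variables (m : {measure set T -> \bar R}) (D : set T).
Hypothesis mD : measurable D.
Implicit Types f g : T -> R.

Lemma integrableZR c f : m.-integrable D (EFin \o f) ->
  m.-integrable D (EFin \o (fun t => c * f t)).
Proof. by move=> h; exact: (integrableZl mD c h). Qed.

Lemma integrableDR f g : m.-integrable D (EFin \o f) ->
  m.-integrable D (EFin \o g) -> m.-integrable D (EFin \o (fun t => f t + g t)).
Proof. by move=> hf hg; exact: (integrableD mD hf hg). Qed.

Lemma integrableBR f g : m.-integrable D (EFin \o f) ->
  m.-integrable D (EFin \o g) -> m.-integrable D (EFin \o (fun t => f t - g t)).
Proof. by move=> hf hg; exact: (integrableB mD hf hg). Qed.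

End integrable_real.

Section half_line.
Context {R : realType}.
Local Notation mu := (@lebesgue_measure R).
Local Notation D := (`]0%R, +oo[%classic : set R).

Let I (n : nat) : set R := `[n.+1%:R^-1, n.+2%:R]%classic.

Let I_bigcup : \bigcup_n I n = D.
Proof.
apply/seteqP; split => t /=.
  by move=> [n _]; rewrite /I /= !in_itv /= andbT => /andP[h _]; apply: lt_le_trans h; rewrite invr_gt0.
rewrite in_itv /= andbT => t0.
have [n hn] : exists n : nat, t^-1 + t < n.+1%:R.
  by exists (Num.Def.trunc (t^-1 + t)); exact: truncnS_gt.
exists n => //; rewrite /I /= in_itv /=; apply/andP; split.
  rewrite -[leRHS]invrK lef_pV2 ?posrE ?invr_gt0 //.
  by apply/ltW/(le_lt_trans _ hn); rewrite lerDl ltW.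
have : t < n.+1%:R by apply: le_lt_trans hn; rewrite lerDr invr_ge0 ltW.
by move=> /ltW /le_trans; apply; rewrite ler_nat.
Qed.

Let subset_I n m : (n <= m)%N -> I n `<=` I m.
Proof.
move=> nm t; rewrite /I /= !in_itv /= => /andP[h1 h2]; apply/andP; split.
  by apply: le_trans h1; rewrite lef_pV2 ?posrE ?ltr0n // ler_nat ltnS.
by apply: le_trans h2 _; rewrite ler_nat !ltnS.
Qed.

Let FTC_I (f F : R -> R) (n : nat) : {in D, continuous f} ->
  (forall t : R, 0 < t -> is_derive t 1 F (f t)) ->
  (\int[mu]_(t in I n) (f t)%:E = (F n.+2%:R - F n.+1%:R^-1)%:E)%E.
Proof.
move=> cf dF.
have n0 : (0 : R) < n.+1%:R^-1 by rewrite invr_gt0.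
have lt : (n.+1%:R^-1 : R) < n.+2%:R.
  by rewrite (@le_lt_trans _ _ 1) // ?ltr1n // invf_le1 ?ler1n.
have cF t : 0 < t -> {for t, continuous F}.
  by move=> t0; apply/differentiable_continuous/derivable1_diffP; have [] := dF _ t0.
rewrite /I (@continuous_FTC2 _ f F) //.
- apply: continuous_in_subspaceT => t; rewrite inE /= in_itv /= => /andP[h _].
  by apply: cf; rewrite inE /= in_itv /= andbT (lt_le_trans n0).
- split.
  + move=> t; rewrite in_itv /= => /andP[h _].
    by have [] := dF _ (lt_trans n0 h).
  + by apply: cvg_at_right_filter; exact: cF.
  + by apply: cvg_at_left_filter; apply: cF.
- move=> t; rewrite in_itv /= => /andP[h _].
  by rewrite derive1E; have /@derive_val := dF _ (lt_trans n0 h).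
Qed.

(** By monotone convergence along the compact intervals [1/(n+1), n+2], whose
    integrals are differences of values of F. *)
Lemma integrable_bounded_primitive (f F : R -> R) (M : R) :
  (forall t : R, 0 < t -> 0 <= f t) -> {in D, continuous f} ->
  (forall t : R, 0 < t -> is_derive t 1 F (f t)) ->
  (forall t : R, 0 < t -> `|F t| <= M) ->
  mu.-integrable D (EFin \o f).
Proof.
move=> f0 cf dF FM.
have mf : measurable_fun D f.
  by apply: open_continuous_measurable_fun => //; exact: interval_open.
apply/integrableP; split; first exact/measurable_EFinP.
have -> : (\int[mu]_(t in D) `|(EFin \o f) t| = \int[mu]_(t in D) (f t)%:E)%E.
  apply: eq_integral => t; rewrite inE /= in_itv /= andbT => t0.
  by rewrite /= ger0_norm // f0.
rewrite -I_bigcup.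
have c := @ge0_nondecreasing_set_cvg_integral _ (measurableTypeR R) R I (EFin \o f) mu.
apply: (@le_lt_trans _ _ (M + M)%:E); last exact: ltry.
have subI n : I n `<=` D by move=> t It; rewrite -I_bigcup; exists n.
apply: (cvge_le _ (c _ _ _ _)).
- apply: nearW => n; rewrite (FTC_I n cf dF) lee_fin.
  apply: le_trans (ler_norm _) _; apply: le_trans (ler_normB _ _) _.
  by apply: lerD; apply: FM; rewrite ?invr_gt0.
- by move=> n m nm; rewrite subsetEset; exact: subset_I.
- by move=> n; exact: measurable_itv.
- by move=> n; apply/measurable_EFinP; apply: measurable_funS mf.
- by move=> n t /subI; rewrite /= in_itv /= andbT lee_fin => /f0.
Qed.

Lemma Rintegral_primitive (f F : R -> R) (l0 l1 : R) :
  {in D, continuous f} -> mu.-integrable D (EFin \o f) ->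
  (forall t : R, 0 < t -> is_derive t 1 F (f t)) ->
  F t @[t --> 0^'+] --> l0 -> F t @[t --> +oo] --> l1 ->
  \int[mu]_(t in D) f t = l1 - l0.
Proof.
move=> cf fi dF F0 F1.
have mf : measurable_fun D f by move/integrableP : fi => -[/measurable_EFinP].
have subI n : I n `<=` D by move=> t It; rewrite -I_bigcup; exists n.
have [||||||_] := @cvg_Rintegral_dominated _ (measurableTypeR R) _ mu D (fun n => f \_ (I n)) f (fun t => `|f t|).
- exact: measurable_itv.
- move=> n; apply/measurable_restrict; [exact: measurable_itv..|].
  by apply: measurable_funS mf => //; apply: subIsetl.
- exact: mf.
- apply: aeW => t; rewrite -I_bigcup => -[n _ Int].
  apply: cvg_near_cst; exists n => // m /= nm.
  by rewrite patchE mem_set //; apply: subset_I Int.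
- exact: integrable_norm.
- by apply: aeW => t n _; rewrite patchE; case: ifP => // _; rewrite normr0.
under eq_fun => n.
  rewrite -Rintegral_mkcondr setIidr // /Rintegral (FTC_I n cf dF) /=.
  over.
move/cvgn_unique; apply.
apply: cvgB.
  move/cvg_pinftyP : F1; apply.
  rewrite (_ : (fun n => _) = (fun n => (n + 2)%N%:R)); last by apply/funext => n; rewrite addn2.
  by rewrite (@cvg_shiftn 2 R (fun n => n%:R : R)); exact: cvgr_idn.
move/cvg_at_rightP : F0; apply; split; last exact: cvg_harmonic.
by move=> n; rewrite invr_gt0.
Qed.

(** The bounded function -1/(a(1 + t^a)) is a primitive. *)
Lemma integrable_powR_rational (a : R) : 0 < a ->
  mu.-integrable D (fun t => (t `^ (a - 1) / (1 + t `^ a) ^+ 2)%:E).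
Proof.
move=> a0.
have p0 t : 0 < 1 + t `^ a by rewrite ltr_pwDl ?powR_ge0.
have cp b (t : R) : 0 < t -> {for t, continuous (fun t : R => t `^ b)}.
  move=> t0; apply/differentiable_continuous/derivable1_diffP.
  by have [] := is_derive1_powR b t0.
apply: (@integrable_bounded_primitive (fun t => t `^ (a - 1) / (1 + t `^ a) ^+ 2)
  (fun t => - a^-1 * (1 + t `^ a)^-1) a^-1).
- by move=> t t0; rewrite divr_ge0 ?powR_ge0 // exprn_ge0 // ltW.
- move=> t; rewrite inE /= in_itv /= andbT => t0.
  apply: cvgM; first exact: cp.
  apply: cvgV; first by rewrite expf_neq0 // gt_eqF.
  apply: (@cvgM _ _ _ _ (fun t => 1 + t `^ a) (fun t => 1 + t `^ a)); apply: cvgD; try exact: cvg_cst; exact: cp.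
- move=> t t0.
  have n0 : 1 + t `^ a != 0 by rewrite gt_eqF.
  der => //; rewrite /= mulr1 mul0r addr0 add0r.
  by field; rewrite n0 gt_eqF.
- move=> t t0; have ai : 0 <= a^-1 by rewrite invr_ge0 ltW.
  have ti : 0 <= (1 + t `^ a)^-1 by rewrite invr_ge0 ltW.
  rewrite normrM normrN !ger0_norm // ler_piMr //.
  by rewrite invf_le1 // lerDl powR_ge0.
Qed.

Lemma powR_le_expR (a t : R) : 0 < a -> 0 < t ->
  t `^ a <= (4 * a) `^ a * expR (t / 4).
Proof.
move=> a0 t0.
have a40 : 0 < 4 * a by rewrite mulr_gt0.
have u0 : 0 < t / (4 * a) by rewrite divr_gt0.
have -> : t `^ a = (4 * a) `^ a * (t / (4 * a)) `^ a.
  by rewrite -powRM ?(ltW a40) ?(ltW u0) // mulrC divfK // gt_eqF.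
rewrite ler_wpM2l ?powR_ge0 //.
have -> : expR (t / 4) = expR (t / (4 * a)) `^ a.
  by rewrite -expRM; congr expR; field; rewrite gt_eqF.
apply: ge0_ler_powR; rewrite ?nnegrE ?expR_ge0 ?(ltW a0) ?(ltW u0) //.
by apply: le_trans (expR_ge1Dx _); rewrite lerDr.
Qed.

(** exp(-t/2) is at most a multiple of (1 + t^a)^(-2). All integrands with a
    Gaussian or exponential factor are compared with this one. *)
Lemma integrable_powR_expR (a : R) : 0 < a ->
  mu.-integrable D (fun t => (t `^ (a - 1) * expR (- t / 2))%:E).
Proof.
move=> a0.
pose C := (1 + (4 * a) `^ a) ^+ 2.
apply: (@le_integrableR _ (measurableTypeR R) _ mu D (fun t => t `^ (a - 1) * expR (- t / 2))
  (fun t => C * (t `^ (a - 1) / (1 + t `^ a) ^+ 2))).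
- exact: measurable_itv.
- apply: measurable_funTS.
  apply: measurable_funM; first exact: measurable_powR.
  by apply: measurableT_comp => //; apply: measurable_funM.
- move=> /= t; rewrite in_itv /= andbT => t0.
  rewrite ger0_norm ?mulr_ge0 ?powR_ge0 ?expR_ge0 //.
  rewrite mulrCA ler_wpM2l ?powR_ge0 //.
  have p0 : 0 < 1 + t `^ a by rewrite ltr_pwDl ?powR_ge0.
  rewrite ler_pdivlMr ?exprn_gt0 //.
  have -> : expR (- t / 2) = (expR (- t / 4)) ^+ 2.
    by rewrite -expRM_natl; congr expR; field.
  have pC : 0 <= 1 + (4 * a) `^ a by rewrite addr_ge0 ?powR_ge0.
  have pt : 0 <= expR (- t / 4) * (1 + t `^ a) by rewrite mulr_ge0 ?expR_ge0 ?(ltW p0).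
  rewrite /C -exprMn ler_sqr ?nnegrE //.
  rewrite mulrDr mulr1 lerD //.
    by rewrite -expR0 ler_expR mulNr oppr_le0 divr_ge0 ?(ltW t0).
  have := powR_le_expR a0 t0 => /(ler_wpM2l (expR_ge0 (- t / 4))).
  move=> /le_trans; apply; rewrite mulrCA -expRD.
  by rewrite (_ : _ + _ = 0) ?expR0 ?mulr1 // mulNr addNr.
- by apply: integrableZR => //; exact: integrable_powR_rational.
Qed.

End half_line.

(** * Complex derivatives of parameter integrals *)

Section derive_under_integral.
Context d (T : measurableType d) (R : realType).
Variables (m : {measure set T -> \bar R}) (D : set T).
Hypothesis mD : measurable D.

Lemma is_derive_Rintegral (f f' : R -> T -> R) (g : T -> R) (a e : R) :
  0 < e ->
  (forall x, `|x - a| < e -> m.-integrable D (EFin \o f x)) ->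
  (forall x t, `|x - a| < e -> D t -> is_derive x 1 (f ^~ t) (f' x t)) ->
  m.-integrable D (EFin \o g) ->
  (forall x t, `|x - a| < e -> D t -> `|f' x t| <= g t) ->
  is_derive a 1 (fun x => \int[m]_(t in D) f x t) (\int[m]_(t in D) f' a t).
Proof.
move=> e0 fi df gi fg.
have Ie x : `](a - e), (a + e)[%classic x -> `|x - a| < e.
  by rewrite /= in_itv /= ltr_distl.
have Ia : `](a - e), (a + e)[%classic a.
  by rewrite /= in_itv /= ltrBlDr !ltrDl e0.
have pE x t : `](a - e), (a + e)[%classic x -> D t -> partial1of2 f x t = f' x t.
  by move=> /Ie xe Dt; rewrite partial1of2E; have /@derive_val := df _ _ xe Dt.
have fi' x : `](a - e), (a + e)[%classic x -> m.-integrable D (EFin \o f x) by move/Ie/fi.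
have df' x t : `](a - e), (a + e)[%classic x -> D t -> derivable (f ^~ t) x 1.
  by move=> /Ie xe Dt; have [] := df _ _ xe Dt.
have g0 t : 0 <= `|g t| by [].
have gi' : m.-integrable D (EFin \o (fun t => `|g t|)) by exact: integrable_norm.
have fg' x t : `](a - e), (a + e)[%classic x -> D t -> `|partial1of2 f x t| <= `|g t|.
  move=> Ix Dt; rewrite pE //; apply: le_trans (ler_norm _); apply: fg => //; exact: Ie.
split; first exact: (derivable_under_integral mD Ia fi' df' g0 gi' fg').
rewrite -derive1E (differentiation_under_integral mD Ia fi' df' g0 gi' fg').
by apply: eq_Rintegral => t /set_mem Dt; exact: pE.
Qed.

End derive_under_integral.

Section cauchy_riemann.
Context {R : realType}.
Local Notation C := R[i].
Local Notation Re := complex.Re.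
Local Notation Im := complex.Im.
Implicit Types f g : R -> R -> C.

(** The Cauchy-Riemann equations at x + iy, for a function of the two real
    coordinates whose complex derivative is f'. *)
Definition holo f f' (x y : R) :=
  [/\ is_derive x 1 (fun t => Re (f t y)) (Re (f' x y)),
      is_derive x 1 (fun t => Im (f t y)) (Im (f' x y)),
      is_derive y 1 (fun t => Re (f x t)) (- Im (f' x y)) &
      is_derive y 1 (fun t => Im (f x t)) (Re (f' x y))].

Lemma ReM (z w : C) : Re (z * w) = Re z * Re w - Im z * Im w.
Proof. by case: z w => [a b] [c e]. Qed.

Lemma ImM (z w : C) : Im (z * w) = Re z * Im w + Im z * Re w.
Proof. by case: z w => [a b] [c e]. Qed.

Lemma ReD (z w : C) : Re (z + w) = Re z + Re w.
Proof. by case: z w => [a b] [c e]. Qed.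

Lemma ImD (z w : C) : Im (z + w) = Im z + Im w.
Proof. by case: z w => [a b] [c e]. Qed.

Lemma holo_cst (c : C) x y : holo (fun _ _ => c) (fun _ _ => 0) x y.
Proof. by split; der; rewrite ?oppr0. Qed.

Lemma holo_add f f' g g' x y : holo f f' x y -> holo g g' x y ->
  holo (fun x y => f x y + g x y) (fun x y => f' x y + g' x y) x y.
Proof.
move=> [f1 f2 f3 f4] [g1 g2 g3 g4]; split; rewrite ?ReD ?ImD.
- by apply: (drv_ext (fun t => ReD _ _)); exact: drv_add.
- by apply: (drv_ext (fun t => ImD _ _)); exact: drv_add.
- by rewrite opprD; apply: (drv_ext (fun t => ReD _ _)); exact: drv_add.
- by apply: (drv_ext (fun t => ImD _ _)); exact: drv_add.
Qed.

Lemma holo_mul f f' g g' x y : holo f f' x y -> holo g g' x y ->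
  holo (fun x y => f x y * g x y)
       (fun x y => f' x y * g x y + f x y * g' x y) x y.
Proof.
move=> [f1 f2 f3 f4] [g1 g2 g3 g4]; split; rewrite ?(ReM, ImM, ReD, ImD).
- notypeclasses refine (drv_ext (fun t => ReM _ _) _); der; ring.
- notypeclasses refine (drv_ext (fun t => ImM _ _) _); der; ring.
- notypeclasses refine (drv_ext (fun t => ReM _ _) _); der; ring.
- notypeclasses refine (drv_ext (fun t => ImM _ _) _); der; ring.
Qed.

Lemma holo_cexp f f' x y : holo f f' x y ->
  holo (fun x y => cexp (f x y)) (fun x y => f' x y * cexp (f x y)) x y.
Proof.
move=> [f1 f2 f3 f4]; split; rewrite /cexp ?(ReM, ImM) /=; der; ring.
Qed.

Lemma holo_shift f f' c x y : holo f f' x (y + c) ->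
  holo (fun x y => f x (y + c)) (fun x y => f' x (y + c)) x y.
Proof.
move=> [f1 f2 f3 f4]; split => //.
- have d := drv_add (drv_id y) (drv_cst y c).
  apply: (drv_eq (@drv_comp _ (fun t => Re (f x t)) (fun t => t + c) _ _ _ f3 d)).
  by rewrite addr0 mulr1.
- have d := drv_add (drv_id y) (drv_cst y c).
  apply: (drv_eq (@drv_comp _ (fun t => Im (f x t)) (fun t => t + c) _ _ _ f4 d)).
  by rewrite addr0 mulr1.
Qed.

Lemma holo_Cintegral d (T : measurableType d) (m : {measure set T -> \bar R})
    (D : set T) (k k' : R -> R -> T -> C) (g : T -> R) (x y e : R) :
  measurable D -> 0 < e -> measurable_fun D (fun t => Im (k' x y t)) ->
  (forall x' y', `|x' - x| < e -> `|y' - y| < e ->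
     m.-integrable D (fun t => (Re (k x' y' t))%:E) /\
     m.-integrable D (fun t => (Im (k x' y' t))%:E)) ->
  (forall x' y' t, `|x' - x| < e -> `|y' - y| < e -> D t ->
     holo (fun u v => k u v t) (fun u v => k' u v t) x' y') ->
  m.-integrable D (EFin \o g) ->
  (forall x' y' t, `|x' - x| < e -> `|y' - y| < e -> D t ->
     `|Re (k' x' y' t)| <= g t /\ `|Im (k' x' y' t)| <= g t) ->
  holo (fun x y => Cintegral m D (k x y)) (fun x y => Cintegral m D (k' x y)) x y.
Proof.
move=> mD e0 mk ki dk gi kg; have z0 : forall u : R, `|u - u| < e by move=> u; rewrite subrr normr0.
split; rewrite /=.
- apply: (is_derive_Rintegral mD e0 (f := fun x t => Re (k x y t))
    (f' := fun x t => Re (k' x y t)) _ _ gi) => [u ue|u t ue Dt|u t ue Dt].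
  + by have [] := ki u y ue (z0 _).
  + by have [] := dk u y t ue (z0 _) Dt.
  + by have [] := kg u y t ue (z0 _) Dt.
- apply: (is_derive_Rintegral mD e0 (f := fun x t => Im (k x y t))
    (f' := fun x t => Im (k' x y t)) _ _ gi) => [u ue|u t ue Dt|u t ue Dt].
  + by have [] := ki u y ue (z0 _).
  + by have [] := dk u y t ue (z0 _) Dt.
  + by have [] := kg u y t ue (z0 _) Dt.
- have -> : - (\int[m]_(t in D) Im (k' x y t)) = \int[m]_(t in D) (- Im (k' x y t)).
    under [RHS]eq_Rintegral do rewrite -mulN1r.
    rewrite RintegralZl ?mulN1r //; apply: (le_integrableR mD mk _ gi) => t Dt.
    by have [] := kg x y t (z0 _) (z0 _) Dt.
  apply: (is_derive_Rintegral mD e0 (f := fun y t => Re (k x y t))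
    (f' := fun y t => - Im (k' x y t)) _ _ gi) => [u ue|u t ue Dt|u t ue Dt].
  + by have [] := ki x u (z0 _) ue.
  + by have [] := dk x u t (z0 _) ue Dt.
  + by rewrite normrN; have [] := kg x u t (z0 _) ue Dt.
- apply: (is_derive_Rintegral mD e0 (f := fun y t => Im (k x y t))
    (f' := fun y t => Re (k' x y t)) _ _ gi) => [u ue|u t ue Dt|u t ue Dt].
  + by have [] := ki x u (z0 _) ue.
  + by have [] := dk x u t (z0 _) ue Dt.
  + by have [] := kg x u t (z0 _) ue Dt.
Qed.

End cauchy_riemann.

(** * The transform F_a and its recursion *)

(** The integrand of F_a at z = x + iy, where |exp(izt)| = exp(-yt). *)
Definition kern {R : realType} (a x y t : R) : R[i] :=
  Complex (t `^ (a - 1) * (expR (- t ^+ 2 / 2 - y * t) * cos (x * t)))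
          (t `^ (a - 1) * (expR (- t ^+ 2 / 2 - y * t) * sin (x * t))).

(** Locked, since the evaluation of products of complex numbers would otherwise
    expand it. *)
HB.lock Definition FT {R : realType} (a x y : R) : R[i] :=
  Cintegral (@lebesgue_measure R) `]0%R, +oo[%classic (kern a x y).

Section transform.
Context {R : realType}.
Local Notation C := R[i].
Local Notation Re := complex.Re.
Local Notation Im := complex.Im.
Local Notation mu := (@lebesgue_measure R).
Local Notation D := (`]0%R, +oo[%classic : set R).

(** Dominates the integrand for all y >= -M, by
    -t^2/2 + Mt <= (M + 1/2)^2/2 - t/2. *)
Definition kbound (M a t : R) : R :=
  expR ((M + 2^-1) ^+ 2 / 2) * (t `^ (a - 1) * expR (- t / 2)).

Lemma oppr_le_norm (y : R) : - y <= `|y|.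
Proof. by rewrite -normrN ler_norm. Qed.

Lemma gauss_le_expR (M y t : R) : - y <= M -> 0 < t ->
  expR (- t ^+ 2 / 2 - y * t) <= expR ((M + 2^-1) ^+ 2 / 2) * expR (- t / 2).
Proof.
move=> yM t0; rewrite -expRD ler_expR.
have : - y * t <= M * t.
  by rewrite ler_wpM2r ?(ltW t0).
have := sqr_ge0 (t - (M + 2^-1)).
nra.
Qed.

Lemma kern_le_kbound (M a x y t : R) : - y <= M -> 0 < t ->
  `|Re (kern a x y t)| <= kbound M a t /\ `|Im (kern a x y t)| <= kbound M a t.
Proof.
move=> yM t0; rewrite /kern /kbound /= !normrM.
rewrite (ger0_norm (powR_ge0 _ _)) (ger0_norm (expR_ge0 _)).
have key (c : R) : `|c| <= 1 -> t `^ (a - 1) * (expR (- t ^+ 2 / 2 - y * t) * `|c|)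
  <= expR ((M + 2^-1) ^+ 2 / 2) * (t `^ (a - 1) * expR (- t / 2)).
  move=> c1; rewrite [leRHS]mulrCA ler_wpM2l ?powR_ge0 //.
  apply: le_trans (gauss_le_expR yM t0).
  by rewrite ler_piMr ?expR_ge0.
by split; apply: key; rewrite ler_norml ?cos_geN1 ?cos_le1 ?sin_geN1 ?sin_le1.
Qed.

Lemma kbound_ge0 (M a t : R) : 0 <= kbound M a t.
Proof. by rewrite /kbound !mulr_ge0 ?expR_ge0 ?powR_ge0. Qed.

Lemma integrable_kbound (M a : R) : 0 < a -> mu.-integrable D (EFin \o kbound M a).
Proof. by move=> a0; apply: integrableZR => //; exact: integrable_powR_expR. Qed.

Lemma measurable_halfline (f f' : R -> R) :
  (forall t : R, 0 < t -> is_derive t 1 f (f' t)) -> measurable_fun D f.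
Proof.
move=> df; apply: open_continuous_measurable_fun; first exact: interval_open.
by move=> t; rewrite inE /= in_itv /= andbT => /df /drv_continuous.
Qed.

Lemma le_integrable_halfline (f g : R -> R) : measurable_fun D f ->
  (forall t : R, 0 < t -> `|f t| <= g t) -> mu.-integrable D (EFin \o g) ->
  mu.-integrable D (EFin \o f).
Proof.
move=> mf fg; apply: (@le_integrableR _ (measurableTypeR R) _ mu D _ g) => //.
by move=> t; rewrite /= in_itv /= andbT; exact: fg.
Qed.

Lemma cvg_Rintegral_halfline (f_ : nat -> R -> R) (f g : R -> R) :
  (forall n, measurable_fun D (f_ n)) -> measurable_fun D f ->
  (forall t : R, 0 < t -> f_ n t @[n --> \oo] --> f t) ->
  mu.-integrable D (EFin \o g) ->
  (forall n (t : R), 0 < t -> `|f_ n t| <= g t) ->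
  \int[mu]_(t in D) f_ n t @[n --> \oo] --> \int[mu]_(t in D) f t.
Proof.
move=> mf_ mf ff gi fg.
have [|||_ //] := @cvg_Rintegral_dominated _ (measurableTypeR R) _ mu D f_ f g _ mf_ mf _ gi _.
- exact: measurable_itv.
- by apply: aeW => t; rewrite /= in_itv /= andbT; exact: ff.
- by apply: aeW => t n; rewrite /= in_itv /= andbT; exact: fg.
Qed.

Lemma measurable_kern (a x y : R) :
  measurable_fun D (fun t => Re (kern a x y t)) /\
  measurable_fun D (fun t => Im (kern a x y t)).
Proof.
split; rewrite /kern /=.
  apply: (@measurable_halfline _ (fun t => _)) => t t0; der => //; reflexivity.
apply: (@measurable_halfline _ (fun t => _)) => t t0; der => //; reflexivity.
Qed.

Lemma integrable_kern (a x y : R) : 0 < a ->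
  mu.-integrable D (EFin \o (fun t => Re (kern a x y t))) /\
  mu.-integrable D (EFin \o (fun t => Im (kern a x y t))).
Proof.
move=> a0; have [m1 m2] := measurable_kern a x y.
by split; apply: le_integrable_halfline (integrable_kbound `|y| a0) => // t t0;
  have [] := kern_le_kbound a x (oppr_le_norm y) t0.
Qed.

Lemma powR_subr1 (a t : R) : 0 < t -> t `^ a = t * t `^ (a - 1).
Proof.
move=> t0; have h : t `^ (1 + (a - 1)) = t `^ 1 * t `^ (a - 1).
  by apply: powRD; rewrite (gt_eqF t0) implybT.
by rewrite powRr1 ?(ltW t0) // in h; rewrite -h; congr (_ `^ _); ring.
Qed.

Lemma kern_shift (a x y t : R) : 0 < t -> kern (a + 1) x y t =
  Complex (t * Re (kern a x y t)) (t * Im (kern a x y t)).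
Proof.
move=> t0; rewrite /kern /= addrK.
by rewrite powR_subr1 // !mulrA.
Qed.

Lemma holo_kern (a x y t : R) : 0 < t ->
  holo (fun x y => kern a x y t) (fun x y => Complex 0 1 * kern (a + 1) x y t) x y.
Proof.
move=> t0; rewrite /holo !(ReM, ImM) kern_shift //=; split; der; rewrite /=; ring.
Qed.

Lemma ReFT (a x y : R) : Re (FT a x y) = \int[mu]_(t in D) Re (kern a x y t).
Proof. by rewrite FT.unlock. Qed.

Lemma ImFT (a x y : R) : Im (FT a x y) = \int[mu]_(t in D) Im (kern a x y t).
Proof. by rewrite FT.unlock. Qed.

(** F_a' = i F_(a+1): differentiation brings down a factor it. *)
Lemma holo_FT (a x y : R) : 0 < a ->
  holo (FT a) (fun x y => Complex 0 1 * FT (a + 1) x y) x y.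
Proof.
move=> a0; have a10 : 0 < a + 1 by rewrite addr_gt0.
rewrite FT.unlock.
have -> : (fun x y => Complex 0 1 * Cintegral mu D (kern (a + 1) x y)) =
    (fun x y => Cintegral mu D (fun t => Complex 0 1 * kern (a + 1) x y t)).
  apply/funext => u; apply/funext => v; rewrite /Cintegral.
  have [i1 i2] := integrable_kern u v a10.
  apply/eqP; rewrite eq_complex !(ReM, ImM) !mul0r !mul1r sub0r add0r /=; apply/andP; split; apply/eqP.
    have h := @RintegralZl _ _ _ mu D (fun t => Im (kern (a + 1) u v t)) (- 1) (measurable_itv _) i2.
    by rewrite mulN1r in h; rewrite -[LHS]h; apply: eq_Rintegral => t _ /=; ring.
  by apply: eq_Rintegral => t _; ring.
apply: (@holo_Cintegral _ _ (measurableTypeR R) mu D (kern a)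
  (fun x y t => Complex 0 1 * kern (a + 1) x y t) (kbound (`|y| + 1) (a + 1)) x y 1 _ ltr01).
- exact: measurable_itv.
- rewrite (_ : (fun t => _) = (fun t => Re (kern (a + 1) x y t))); first by have [] := measurable_kern (a + 1) x y.
  by apply/funext => t; rewrite ImM /= mul0r mul1r add0r.
- by move=> u v _ _; exact: integrable_kern.
- by move=> u v t _ _; rewrite /= in_itv /= andbT; exact: holo_kern.
- exact: integrable_kbound.
- move=> u v t _ vy; rewrite /= in_itv /= andbT => t0.
  have vM : - v <= `|y| + 1.
    apply: le_trans (oppr_le_norm v) _; rewrite -(subrK y v) addrC (le_trans (ler_normD _ _)) // lerD2l; exact: ltW.
  rewrite /= !mul0r !mul1r sub0r add0r normrN.
  by have [] := kern_le_kbound (a + 1) u vM t0.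
Qed.

End transform.

Section transform_recursion.
Context {R : realType}.
Local Notation C := R[i].
Local Notation Re := complex.Re.
Local Notation Im := complex.Im.
Local Notation mu := (@lebesgue_measure R).
Local Notation D := (`]0%R, +oo[%classic : set R).

Lemma is_derive_kern (a x y t : R) : 0 < t ->
  is_derive t 1 (fun t => Re (kern (a + 1) x y t))
    (a * Re (kern a x y t) - Re (kern (a + 1 + 1) x y t)
     - y * Re (kern (a + 1) x y t) - x * Im (kern (a + 1) x y t)) /\
  is_derive t 1 (fun t => Im (kern (a + 1) x y t))
    (a * Im (kern a x y t) - Im (kern (a + 1 + 1) x y t)
     - y * Im (kern (a + 1) x y t) + x * Re (kern (a + 1) x y t)).
Proof.
move=> t0; have e1 : t `^ a = t * t `^ (a - 1) by exact: powR_subr1.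
split; rewrite !kern_shift // /kern /= !addrK; der => //; rewrite /= e1; by field.
Qed.

Lemma kbound_cvg_pinfty (M a : R) : 0 <= a ->
  kbound M (a + 1) t @[t --> +oo] --> (0 : R).
Proof.
move=> a0.
pose K := expR ((M + 2^-1) ^+ 2 / 2) * (1 + (4 * a) `^ a).
have K0 : 0 <= K by rewrite mulr_ge0 ?expR_ge0 // addr_ge0 ?powR_ge0.
have lim0 : K * expR (- (t / 4)) @[t --> +oo] --> (0 : R).
  rewrite -[X in _ --> X](mulr0 K); apply: cvgMr.
  apply: (@cvg_comp _ _ _ (fun t => t / 4) (fun t : R => expR (- t)) _ +oo); last exact: cvgr_expR.
  by apply: gt0_cvgMly => //; apply: cvg_id.
apply: (squeeze_cvgr _ (cvg_cst 0) lim0).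
near=> t.
have t0 : 0 < t by near: t; exact: nbhs_pinfty_gt.
rewrite kbound_ge0 /= /kbound addrK /K -mulrA ler_wpM2l ?expR_ge0 //.
have ha : t `^ a <= (1 + (4 * a) `^ a) * expR (t / 4).
  have [->|an0] := eqVneq a 0.
    rewrite powRr0 -[leLHS]mul1r ler_pM // ?lerDl ?powR_ge0 //.
    by rewrite -expR0 ler_expR divr_ge0 ?(ltW t0).
  apply: le_trans (powR_le_expR _ t0) _; first by rewrite lt_neqAle eq_sym an0.
  by rewrite ler_wpM2r ?expR_ge0 // lerDr.
apply: le_trans (ler_wpM2r (expR_ge0 _) ha) _.
rewrite -mulrA -expRD ler_wpM2l //; first by rewrite addr_ge0 ?powR_ge0.
by rewrite ler_expR; lra.
Unshelve. all: by end_near. Qed.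

Lemma kern_cvg_pinfty (a x y : R) : 0 <= a ->
  Re (kern (a + 1) x y t) @[t --> +oo] --> (0 : R) /\
  Im (kern (a + 1) x y t) @[t --> +oo] --> (0 : R).
Proof.
move=> a0; have h := @kbound_cvg_pinfty `|y| a a0.
have k (t : R) (t0 : 0 < t) := kern_le_kbound (a + 1) x (oppr_le_norm y) t0.
split; apply: norm_cvg0; apply: (squeeze_cvgr _ (cvg_cst 0) h).
  near=> t; rewrite normr_ge0 /=; apply: (k t _).1.
  by near: t; exact: nbhs_pinfty_gt.
near=> t; rewrite normr_ge0 /=; apply: (k t _).2.
by near: t; exact: nbhs_pinfty_gt.
Unshelve. all: by end_near. Qed.

(** The boundary value at t = 0 of t^a exp(-t^2/2 + izt): for a = 0 it is 1
    instead of 0, whence the inhomogeneous recursion FT_rec0. *)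
Lemma kern_cvg0 (a x y : R) : 0 <= a ->
  Re (kern (a + 1) x y t) @[t --> 0^'+] --> ((a == 0)%:R : R) /\
  Im (kern (a + 1) x y t) @[t --> 0^'+] --> (0 : R).
Proof.
move=> a0.
have lp : t `^ a @[t --> 0^'+] --> ((a == 0)%:R : R).
  have [->|an0] := eqVneq a 0.
    by under eq_fun do rewrite powRr0; exact: cvg_cst.
  by apply: powR_cvg0; rewrite lt_neqAle eq_sym an0.
have lc : expR (- t ^+ 2 / 2 - y * t) * cos (x * t) @[t --> 0^'+] --> (1 : R).
  apply: cvg_at_right_filter.
  have [df d] : exists df : R, is_derive (0 : R) 1 (fun t => expR (- t ^+ 2 / 2 - y * t) * cos (x * t)) df by eexists; der1.
  have := drv_continuous d; rewrite /prop_for /continuous_at.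
  by rewrite !mulr0 cos0 mulr1 subr0 expr0n /= mulr0n oppr0 mul0r expR0.
have ls : expR (- t ^+ 2 / 2 - y * t) * sin (x * t) @[t --> 0^'+] --> (0 : R).
  apply: cvg_at_right_filter.
  have [df d] : exists df : R, is_derive (0 : R) 1 (fun t => expR (- t ^+ 2 / 2 - y * t) * sin (x * t)) df by eexists; der1.
  have := drv_continuous d; rewrite /prop_for /continuous_at.
  by rewrite !mulr0 sin0 mulr0.
rewrite /kern /= addrK; split.
  by rewrite -[X in _ --> X]mulr1; apply: cvgM.
by rewrite -[X in _ --> X](mulr0 (a == 0)%:R); apply: cvgM.
Qed.

Let Rintegral4 (f1 f2 f3 f4 : R -> R) (c3 c4 : R) :
  mu.-integrable D (EFin \o f1) -> mu.-integrable D (EFin \o f2) ->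
  mu.-integrable D (EFin \o f3) -> mu.-integrable D (EFin \o f4) ->
  mu.-integrable D (EFin \o (fun t => f1 t - f2 t - c3 * f3 t + c4 * f4 t)) /\
  \int[mu]_(t in D) (f1 t - f2 t - c3 * f3 t + c4 * f4 t) =
    \int[mu]_(t in D) f1 t - \int[mu]_(t in D) f2 t
    - c3 * \int[mu]_(t in D) f3 t + c4 * \int[mu]_(t in D) f4 t.
Proof.
move=> h1 h2 h3 h4; have mD : measurable (D : set (measurableTypeR R)) by exact: measurable_itv.
have h12 := integrableBR mD h1 h2.
have h3' := integrableZR mD c3 h3.
have h4' := integrableZR mD c4 h4.
have h123 := integrableBR mD h12 h3'.
split; first exact: (integrableDR mD h123 h4').
by rewrite (RintegralD mD h123 h4') (RintegralB mD h12 h3') (RintegralB mD h1 h2)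
  (RintegralZl c3 mD h3) (RintegralZl c4 mD h4).
Qed.

(** i z F_(a+1) = F_(a+2) - a F_a, by integrating the derivative of
    t^a exp(-t^2/2 + izt); the boundary term at 0 is present for a = 0 only, in
    which case a F_a is read as 0. *)
Let Rintegral_kern (a x y : R) : 0 <= a ->
  mu.-integrable D (EFin \o (fun t => a * Re (kern a x y t))) ->
  mu.-integrable D (EFin \o (fun t => a * Im (kern a x y t))) ->
  \int[mu]_(t in D) (a * Re (kern a x y t)) - Re (FT (a + 1 + 1) x y)
    - y * Re (FT (a + 1) x y) - x * Im (FT (a + 1) x y) = - (a == 0)%:R /\
  \int[mu]_(t in D) (a * Im (kern a x y t)) - Im (FT (a + 1 + 1) x y)
    - y * Im (FT (a + 1) x y) + x * Re (FT (a + 1) x y) = 0.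
Proof.
move=> a0 ia1 ia2.
have a10 : 0 < a + 1 by rewrite ltr_wpDl.
have [i1 i2] := integrable_kern x y a10.
have a20 : 0 < a + 1 + 1 by rewrite addr_gt0.
have [j1 j2] := integrable_kern x y a20.
have [l0 l0'] := kern_cvg0 x y a0.
have [ly ly'] := kern_cvg_pinfty x y a0.
have cont (f : R -> R) : (forall t : R, 0 < t -> exists df : R, is_derive t 1 f df) ->
    {in D, continuous f}.
  move=> h t; rewrite inE /= in_itv /= andbT => /h [df]; exact: drv_continuous.
have [k1 e1] := Rintegral4 y (- x) ia1 j1 i1 i2.
have [k2 e2] := Rintegral4 y x ia2 j2 i2 i1.
rewrite !(ReFT, ImFT).
split.
  rewrite -(mulNr x) -[LHS]e1 -(sub0r (a == 0)%:R).
  apply: (@Rintegral_primitive _ _ (fun t => Re (kern (a + 1) x y t)) _ _ _ k1 _ l0 ly).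
    by apply: cont => t t0; rewrite /kern /=; eexists; der1.
  by move=> t t0; rewrite mulNr; exact: (is_derive_kern a x y t0).1.
rewrite -[LHS]e2 -[RHS](subr0 (0 : R)).
apply: (@Rintegral_primitive _ _ (fun t => Im (kern (a + 1) x y t)) _ _ _ k2 _ l0' ly').
  by apply: cont => t t0; rewrite /kern /=; eexists; der1.
by move=> t t0; exact: (is_derive_kern a x y t0).2.
Qed.

Lemma FT_rec (a x y : R) : 0 < a ->
  Re (FT (a + 1 + 1) x y) =
    a * Re (FT a x y) - y * Re (FT (a + 1) x y) - x * Im (FT (a + 1) x y) /\
  Im (FT (a + 1 + 1) x y) =
    a * Im (FT a x y) - y * Im (FT (a + 1) x y) + x * Re (FT (a + 1) x y).
Proof.
move=> a0; have mD : measurable (D : set (measurableTypeR R)) by exact: measurable_itv.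
have [i1 i2] := integrable_kern x y a0.
have e1 : \int[mu]_(t in D) (a * Re (kern a x y t)) = a * Re (FT a x y).
  by rewrite ReFT; exact: RintegralZl.
have e2 : \int[mu]_(t in D) (a * Im (kern a x y t)) = a * Im (FT a x y).
  by rewrite ImFT; exact: RintegralZl.
have [] := @Rintegral_kern a x y (ltW a0) (integrableZR mD a i1) (integrableZR mD a i2).
rewrite e1 e2 (gt_eqF a0) oppr0 => h1 h2.
split; first by rewrite -[LHS]addr0 -h1; ring.
by rewrite -[LHS]addr0 -h2; ring.
Qed.

Lemma FT_rec0 (x y : R) :
  Re (FT (1 + 1) x y) = 1 - y * Re (FT 1 x y) - x * Im (FT 1 x y) /\
  Im (FT (1 + 1) x y) = - y * Im (FT 1 x y) + x * Re (FT 1 x y).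
Proof.
have z (f : R -> R) : mu.-integrable D (EFin \o (fun t => 0 * f t)) /\
    \int[mu]_(t in D) (0 * f t) = 0.
  have -> : (fun t => 0 * f t) = (fun=> 0) by apply/funext => t; rewrite mul0r.
  split; first exact: integrable0.
  by rewrite /Rintegral integral0.
have := @Rintegral_kern 0 x y (lexx _) (z _).1 (z _).1.
rewrite !(z _).2 eqxx !add0r mulr1n => -[h1 h2].
by split; lra.
Qed.

End transform_recursion.

(** * Affine changes of variables and the Gamma function *)

Section affine_change.
Context {R : realType}.
Local Notation mu := (@lebesgue_measure R).
Local Open Scope ereal_scope.

Let phi (c d : R) : measurableTypeR R -> measurableTypeR R := fun x => (c * x + d)%R.

Let mphi (c d : R) : measurable_fun setT (phi c d).
Proof. by apply: measurable_funD => //; exact: measurable_funM. Qed.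

(** The scaled image measure agrees with Lebesgue measure on bounded intervals,
    hence everywhere. *)
Let lebesgue_affine (c d : R) (c0 : (0 < c)%R) (A : set (measurableTypeR R)) : measurable A ->
  (c%:E * mu (phi c d @^-1` A) = mu A).
Proof.
move=> mA.
pose c1 : {nonneg R} := NngNum (ltW c0).
pose m0 : {measure set (measurableTypeR R) -> \bar R} :=
  mscale c1 (pushforward mu (phi c d)).
pose m := m0 (mphi c d).
have key : forall X, ocitv X -> mu X = m X; last by rewrite (lebesgue_measure_unique key mA).
move=> {mA} => _ [[a b]] _ <-.
rewrite (_ : m _ = c%:E * mu (phi c d @^-1` `]a, b])) //.
have -> : phi c d @^-1` `]a, b] = `]((a - d) / c)%R, ((b - d) / c)%R]%classic.
  apply/seteqP; split => x /=; rewrite /phi /= !in_itv /= ltr_pdivrMr // ler_pdivlMr //;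
  by rewrite ltrBlDr lerBrDr mulrC.
rewrite !lebesgue_measure_itv /= !lte_fin ltr_pM2r ?invr_gt0 // ltrD2r.
case: ifPn => _; last by rewrite mule0.
by rewrite -!EFinB -EFinM; congr (_%:E); field; rewrite gt_eqF.
Qed.

Lemma ge0_integral_affine (c d : R) (f : R -> \bar R) : (0 < c)%R ->
  measurable_fun setT f -> (forall x, 0 <= f x) ->
  \int[mu]_x f x = c%:E * \int[mu]_x f (c * x + d)%R.
Proof.
move=> c0 mf f0.
pose c1 : {nonneg R} := NngNum (ltW c0).
pose m0 : {measure set (measurableTypeR R) -> \bar R} :=
  mscale c1 (pushforward mu (phi c d)).
pose m := m0 (mphi c d).
transitivity (\int[m]_x f x).
  apply: eq_measure_integral => A mA _.
  exact: (esym (lebesgue_affine d c0 mA)).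
rewrite /m /m0 ge0_integral_mscale //; congr (_ * _).
rewrite (@ge0_integral_pushforward _ _ _ _ _ (phi c d)) //.
Qed.

Lemma ge0_integral_halfline_scale (c : R) (f : R -> R) : (0 < c)%R ->
  measurable_fun setT f -> (forall x, (0 <= f x)%R) ->
  \int[mu]_(x in `]0%R, +oo[) (f x)%:E =
  c%:E * \int[mu]_(x in `]0%R, +oo[) (f (c * x)%R)%:E.
Proof.
move=> c0 mf f0.
rewrite integral_mkcond [X in _ * X]integral_mkcond (@ge0_integral_affine c 0) //.
- congr (_ * _); apply: eq_integral => x _; rewrite addr0 !patchE.
  by congr (if _ then _ else _); apply/idP/idP; rewrite !inE /= !in_itv /= !andbT pmulr_rgt0.
- apply/(measurable_restrictT _ _).1 => //.
  by apply/measurable_EFinP; exact: measurable_funTS.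
- by move=> x; rewrite patchE; case: ifPn => // _; rewrite lee_fin.
Qed.

Lemma integral_translation (d : R) (f : R -> \bar R) :
  measurable_fun setT f -> \int[mu]_x f x = \int[mu]_x f (x + d)%R.
Proof.
move=> mf; rewrite integralE [RHS]integralE.
have key (g : R -> \bar R) : measurable_fun setT g -> (forall x, 0 <= g x) ->
    \int[mu]_x g x = \int[mu]_x g (x + d)%R.
  move=> mg g0; rewrite (@ge0_integral_affine 1 d) // mul1e.
  by under eq_integral do rewrite mul1r.
have kp := key _ (measurable_funepos mf) (fun x => funepos_ge0 f x).
have kn := key _ (measurable_funeneg mf) (fun x => funeneg_ge0 f x).
by congr (_ - _); [rewrite kp|rewrite kn]; apply: eq_integral => x _; rewrite ?(funeposE, funenegE).
Qed.

End affine_change.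

Section gamma_function.
Context {R : realType}.
Local Notation mu := (@lebesgue_measure R).
Local Notation D := (`]0%R, +oo[%classic : set R).

Lemma Rintegral_halfline_gt0 (f : R -> R) : mu.-integrable D (EFin \o f) ->
  (forall t : R, 0 < t -> 0 < f t) -> 0 < \int[mu]_(t in D) f t.
Proof.
move=> fi f0.
have g0 : 0 <= \int[mu]_(t in D) f t.
  by apply: Rintegral_ge0 => t; rewrite /= in_itv /= andbT => /f0 /ltW.
rewrite lt_neqAle g0 andbT eq_sym; apply/negP => /eqP z.
have mf : measurable_fun D (EFin \o f) by exact: measurable_int fi.
have z' : (\int[mu]_(t in D) `|(EFin \o f) t| = 0)%E.
  have -> : (\int[mu]_(t in D) `|(EFin \o f) t| = \int[mu]_(t in D) (EFin \o f) t)%E.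
    apply: eq_integral => t; rewrite inE /= in_itv /= andbT => /f0 t0.
    by rewrite ger0_norm ?(ltW t0).
  have fin : (\int[mu]_(t in D) (EFin \o f) t)%E \is a fin_num by exact: integrable_fin_num.
  by rewrite -(fineK fin) -/(Rintegral mu D f) z.
have mD : measurable (D : set (measurableTypeR R)) by exact: measurable_itv.
have /(ae_eq_integral_abs _ mD mf) [A [mA A0 DA]] := z'.
have DA' : D `<=` A.
  move=> t Dt; apply: DA => /= h; have := h Dt; move: Dt; rewrite /= in_itv /= andbT => /f0 t0.
  by case => e; rewrite e ltxx in t0.
have : (mu D <= mu A)%E by apply: le_measure; rewrite ?inE.
by rewrite (_ : mu A = 0%E) // lebesgue_measure_itv /= ltry.
Qed.

Definition gammaf (a t : R) : R := t `^ (a - 1) * expR (- t).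

Lemma gammaf_ge0 (a t : R) : 0 <= gammaf a t.
Proof. by rewrite mulr_ge0 ?powR_ge0 ?expR_ge0. Qed.

Lemma measurable_gammaf (a : R) : measurable_fun setT (gammaf a).
Proof.
apply: measurable_funM; first exact: measurable_powR.
by apply: measurableT_comp.
Qed.

Lemma integrable_gammaf (a : R) : 0 < a -> mu.-integrable D (EFin \o gammaf a).
Proof.
move=> a0; apply: le_integrable_halfline (integrable_powR_expR a0).
  by apply: measurable_funTS; exact: measurable_gammaf.
move=> t t0; rewrite ger0_norm ?gammaf_ge0 // ler_wpM2l ?powR_ge0 // ler_expR.
by have := t0; lra.
Qed.

Lemma Gamma_gt0 (a : R) : 0 < a -> 0 < Gamma a.
Proof.
move=> a0; apply: (Rintegral_halfline_gt0 (integrable_gammaf a0)) => t t0.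
by rewrite /gammaf mulr_gt0 ?powR_gt0 ?expR_gt0.
Qed.

Lemma Gamma_scale (a y : R) : 0 < a -> 1 <= y ->
  mu.-integrable D (EFin \o (fun t => t `^ (a - 1) * expR (- (y * t)))) /\
  \int[mu]_(t in D) (t `^ (a - 1) * expR (- (y * t))) = Gamma a / y `^ a.
Proof.
move=> a0 y1; have y0 : 0 < y by apply: lt_le_trans y1.
have mD : measurable (D : set (measurableTypeR R)) by exact: measurable_itv.
have ya0 : 0 < y `^ a by rewrite powR_gt0.
pose g (t : R) := t `^ (a - 1) * expR (- (y * t)).
have gi : mu.-integrable D (EFin \o g).
  apply: le_integrable_halfline (integrable_gammaf a0).
    apply: measurable_funTS; apply: measurable_funM; first exact: measurable_powR.
    by apply: measurableT_comp => //; apply: measurableT_comp => //; exact: measurable_funM.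
  move=> t t0; rewrite ger0_norm ?mulr_ge0 ?powR_ge0 ?expR_ge0 //.
  by rewrite ler_wpM2l ?powR_ge0 // ler_expR lerN2 ler_peMl ?(ltW t0).
split => //.
have e (t : R) : 0 < t -> gammaf a (y * t) = y `^ a / y * g t.
  move=> t0; rewrite /gammaf /g powRM ?(ltW t0) ?(ltW y0) // mulrA; congr (_ * _ * _).
  by rewrite (powR_subr1 a y0) mulrAC mulfV ?mul1r ?gt_eqF.
have ki := integrableZR mD (y `^ a / y) gi.
have h := ge0_integral_halfline_scale y0 (measurable_gammaf a) (gammaf_ge0 a).
have E : (\int[mu]_(t in D) (gammaf a (y * t))%:E =
    \int[mu]_(t in D) (y `^ a / y * g t)%:E)%E.
  by apply: eq_integral => t; rewrite inE /= in_itv /= andbT => /e ->.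
rewrite E in h.
have -> : Gamma a = y * \int[mu]_(t in D) (y `^ a / y * g t).
  rewrite /Gamma /Rintegral [X in fine X = _]h fineM //.
  exact: (integrable_fin_num mD ki).
rewrite (RintegralZl (y `^ a / y) mD gi) -/g; field.
by rewrite !gt_eqF.
Qed.

Lemma GammaD1 (a : R) : 0 < a -> Gamma (a + 1) = a * Gamma a.
Proof.
move=> a0; have a10 : 0 < a + 1 by rewrite addr_gt0.
have mD : measurable (D : set (measurableTypeR R)) by exact: measurable_itv.
have i1 := integrable_gammaf a0.
have i2 := integrable_gammaf a10.
pose F (t : R) := - (t `^ a * expR (- t)).
have dF (t : R) : 0 < t -> is_derive t 1 F (gammaf (a + 1) t - a * gammaf a t).
  by move=> t0; rewrite /F /gammaf addrK; der => //; rewrite /=; ring.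
have F0 : F t @[t --> 0^'+] --> (0 : R).
  rewrite -[X in _ --> X]oppr0 -[X in _ --> - X](mul0r (expR (- 0))); apply: cvgN; apply: cvgM; first exact: powR_cvg0.
  apply: cvg_at_right_filter; apply: continuous_comp; first exact: opp_continuous.
  exact: continuous_expR.
have Fy : F t @[t --> +oo] --> (0 : R).
  rewrite -[X in _ --> X]oppr0; apply: cvgN.
  have lim0 : (4 * a) `^ a * expR (- (t / 4)) @[t --> +oo] --> (0 : R).
    rewrite -[X in _ --> X](mulr0 ((4 * a) `^ a)); apply: cvgMr.
    apply: (@cvg_comp _ _ _ (fun t => t / 4) (fun t : R => expR (- t)) _ +oo); last exact: cvgr_expR.
    by apply: gt0_cvgMly => //; apply: cvg_id.
  apply: (squeeze_cvgr _ (cvg_cst 0) lim0).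
  near=> t.
  have t0 : 0 < t by near: t; exact: nbhs_pinfty_gt.
  rewrite mulr_ge0 ?powR_ge0 ?expR_ge0 //=.
  apply: le_trans (ler_wpM2r (expR_ge0 _) (powR_le_expR a0 t0)) _.
  rewrite -mulrA -expRD ler_wpM2l ?powR_ge0 // ler_expR.
  by have := t0; lra.
have ii := integrableBR mD i2 (integrableZR mD a i1).
have : \int[mu]_(t in D) (gammaf (a + 1) t - a * gammaf a t) = 0 - 0.
  apply: (Rintegral_primitive _ ii dF F0 Fy) => t.
  rewrite inE /= in_itv /= andbT => t0.
  have [df d] : exists df : R, is_derive t 1 (fun t => gammaf (a + 1) t - a * gammaf a t) df.
    by rewrite /gammaf; eexists; der1.
  exact: drv_continuous d.
rewrite (RintegralB mD i2 (integrableZR mD a i1)) (RintegralZl a mD i1) subrr.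
by move/eqP; rewrite subr_eq0 => /eqP.
Unshelve. all: by end_near. Qed.

End gamma_function.

(** * Growth of the transform in the upper half-plane *)

Section transform_estimates.
Context {R : realType}.
Local Notation C := R[i].
Local Notation Re := complex.Re.
Local Notation Im := complex.Im.
Local Notation mu := (@lebesgue_measure R).
Local Notation D := (`]0%R, +oo[%classic : set R).

Lemma cvgn_comp (f : R -> R) (u : nat -> R) (x : R) : {for x, continuous f} ->
  u n @[n --> \oo] --> x -> f (u n) @[n --> \oo] --> f x.
Proof. by move=> cf ux; exact: cvg_comp ux cf. Qed.

(** The squared modulus. *)
Definition nsq (z : C) : R := Re z ^+ 2 + Im z ^+ 2.

Lemma nsq_ge0 z : 0 <= nsq z.
Proof. by rewrite addr_ge0 ?sqr_ge0. Qed.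

Lemma nsqM z w : nsq (z * w) = nsq z * nsq w.
Proof. by rewrite /nsq ReM ImM; ring. Qed.

Lemma nsq_cexp z : nsq (cexp z) = expR (2 * Re z).
Proof.
rewrite /nsq /cexp /= !exprMn -mulrDr cos2Dsin2 mulr1.
by rewrite expRM_natl.
Qed.

Lemma FT_le (a : R) : 0 < a -> exists2 K : R, 0 <= K &
  forall x y : R, 0 <= y -> nsq (FT a x y) <= K.
Proof.
move=> a0; have mD : measurable (D : set (measurableTypeR R)) by exact: measurable_itv.
have ki := @integrable_kbound R 0 a a0.
pose I := \int[mu]_(t in D) kbound 0 a t.
have key (f : R -> R) : mu.-integrable D (EFin \o f) ->
    (forall t : R, 0 < t -> `|f t| <= kbound 0 a t) -> (\int[mu]_(t in D) f t) ^+ 2 <= I ^+ 2.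
  move=> fi fk; have h : `|\int[mu]_(t in D) f t| <= I.
    apply: le_trans (le_normr_Rintegral mD fi) _.
    apply: (le_Rintegral mD _ ki); first exact: (integrable_norm fi).
    by move=> t; rewrite /= in_itv /= andbT; exact: fk.
  rewrite -(real_normK (num_real (\int[mu]_(t in D) f t))) ler_sqr ?nnegrE //.
  exact: le_trans h.
exists (I ^+ 2 + I ^+ 2); first by rewrite addr_ge0 ?sqr_ge0.
move=> x y y0; have [i1 i2] := integrable_kern x y a0.
have y0' : - y <= 0 by rewrite oppr_le0.
rewrite /nsq ReFT ImFT lerD // key // => t t0;
  by have [] := kern_le_kbound a x y0' t0.
Qed.

(** The recursion expresses z F_b through F_(b+1) and F_(b-1): every unit by
    which the parameter exceeds 0 gives one more power of decay. *)
Lemma FT_decay (n : nat) (a : R) : 0 < a -> n%:R <= a -> exists2 K : R, 0 <= K &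
  forall x y : R, 0 <= y -> (x ^+ 2 + y ^+ 2) ^+ n * nsq (FT a x y) <= K.
Proof.
elim: n a => [|n IH] a a0 na.
  by have [K K0 h] := FT_le a0; exists K => // x y y0; rewrite expr0 mul1r h.
have [ae|a1] := eqVneq a 1.
  have n0 : n = 0%N.
    by move: na; rewrite ae -[1]/(1%:R) ler_nat; case: n {IH}.
  rewrite {}ae.
  have [K K0 h] := @FT_le (1 + 1) (addr_gt0 ltr01 ltr01).
  exists (2 + 2 * K) => [|x y y0]; first by rewrite addr_ge0 ?mulr_ge0.
  have [e1 e2] := FT_rec0 x y.
  have := h x y y0.
  rewrite n0 expr1 /nsq.
  move: (Re (FT 1 x y)) (Im (FT 1 x y)) (Re (FT (1 + 1) x y)) (Im (FT (1 + 1) x y)) e1 e2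
    => A B A2 B2 e1 e2 hK.
  have -> : (x ^+ 2 + y ^+ 2) * (A ^+ 2 + B ^+ 2) = (A2 - 1) ^+ 2 + B2 ^+ 2.
    by rewrite e1 e2; ring.
  have := sqr_ge0 (A2 + 1); have := sqr_ge0 B2; nra.
have b0 : 0 < a - 1.
  rewrite subr_gt0 lt_neqAle eq_sym a1 /=; apply: le_trans na; by rewrite ler1n.
have [K1 K10 h1] := IH (a - 1) b0 ltac:(by rewrite lerBrDr natr1).
have [K2 K20 h2] := IH (a + 1) ltac:(by rewrite addr_gt0) ltac:(by apply: le_trans (le_trans na _); rewrite ?ler_nat ?lerDl).
exists (2 * K2 + 2 * (a - 1) ^+ 2 * K1) => [|x y y0].
  apply: addr_ge0; first by rewrite mulr_ge0.
  by rewrite mulr_ge0 // mulr_ge0 // sqr_ge0.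
have := h1 x y y0; have := h2 x y y0.
have [] := FT_rec x y b0; rewrite subrK /nsq [_ ^+ n.+1]exprS.
have r0 : 0 <= (x ^+ 2 + y ^+ 2) ^+ n by rewrite exprn_ge0 ?addr_ge0 ?sqr_ge0.
move: (Re (FT (a - 1) x y)) (Im (FT (a - 1) x y)) (Re (FT a x y)) (Im (FT a x y))
  (Re (FT (a + 1) x y)) (Im (FT (a + 1) x y)) => A B A1 B1 A2 B2 e1 e2 k2 k1.
move: ((x ^+ 2 + y ^+ 2) ^+ n) r0 k2 k1 => r r0 k2 k1.
have -> : (x ^+ 2 + y ^+ 2) * r * (A1 ^+ 2 + B1 ^+ 2) =
    r * ((A2 - (a - 1) * A) ^+ 2 + (B2 - (a - 1) * B) ^+ 2).
  by rewrite e1 e2; ring.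
have e : (A2 - (a - 1) * A) ^+ 2 + (B2 - (a - 1) * B) ^+ 2 <=
    2 * (A2 ^+ 2 + B2 ^+ 2) + 2 * (a - 1) ^+ 2 * (A ^+ 2 + B ^+ 2).
  have := sqr_ge0 (A2 + (a - 1) * A); have := sqr_ge0 (B2 + (a - 1) * B); nra.
apply: le_trans (ler_wpM2l r0 e) _.
rewrite mulrDr lerD //; first by rewrite mulrCA ler_wpM2l.
by rewrite mulrCA ler_wpM2l // mulr_ge0 ?sqr_ge0.
Qed.

Lemma FT_cvg (a x y : R) (u w : nat -> R) : 0 < a ->
  u n @[n --> \oo] --> x -> w n @[n --> \oo] --> y ->
  Re (FT a (u n) (w n)) @[n --> \oo] --> Re (FT a x y) /\
  Im (FT a (u n) (w n)) @[n --> \oo] --> Im (FT a x y).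
Proof.
move=> a0 ux wy.
have [M hM] : exists M, forall n, `|w n| <= M.
  have /cvg_seq_bounded [M [_ hM]] : cvgn w by apply/cvg_ex; exists y.
  by exists (M + 1) => n; apply: hM => //; rewrite ltrDl.
have hM' n : - w n <= M by apply: le_trans (oppr_le_norm _) (hM n).
have ce t : expR (- t ^+ 2 / 2 - w n * t) @[n --> \oo] --> expR (- t ^+ 2 / 2 - y * t).
  apply: (@cvg_comp _ _ _ (fun n => - t ^+ 2 / 2 - w n * t) expR); last exact: continuous_expR.
  by apply: cvgB; [exact: cvg_cst|apply: cvgMl].
have cux t : u n * t @[n --> \oo] --> x * t by apply: cvgMl.
split.
  rewrite ReFT; under eq_fun do rewrite ReFT.
  apply: (@cvg_Rintegral_halfline _ _ _ (kbound M a)).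
  - by move=> n; have [] := measurable_kern a (u n) (w n).
  - by have [] := measurable_kern a x y.
  - move=> t t0; apply: cvgMr; apply: cvgM => //.
    by apply: cvgn_comp; [exact: continuous_cos|exact: cux].
  - exact: integrable_kbound.
  - by move=> n t t0; have [] := kern_le_kbound a (u n) (hM' n) t0.
rewrite ImFT; under eq_fun do rewrite ImFT.
apply: (@cvg_Rintegral_halfline _ _ _ (kbound M a)).
- by move=> n; have [] := measurable_kern a (u n) (w n).
- by have [] := measurable_kern a x y.
- move=> t t0; apply: cvgMr; apply: cvgM => //.
  by apply: cvgn_comp; [exact: continuous_sin|exact: cux].
- exact: integrable_kbound.
- by move=> n t t0; have [] := kern_le_kbound a (u n) (hM' n) t0.
Qed.

End transform_estimates.

Section transform_asymptotics.
Context {R : realType}.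
Local Notation C := R[i].
Local Notation Re := complex.Re.
Local Notation Im := complex.Im.
Local Notation mu := (@lebesgue_measure R).
Local Notation D := (`]0%R, +oo[%classic : set R).

Lemma lipschitz_halfline (f f' : R -> R) (K : R) :
  (forall t : R, is_derive t 1 f (f' t)) -> (forall t : R, `|f' t| <= K) ->
  forall t : R, 0 < t -> `|f t - f 0| <= K * t.
Proof.
move=> df fK t t0.
have cf : {within `[0, t], continuous f}.
  by apply: continuous_subspaceT => s; exact: drv_continuous (df s).
have [c _ ->] := MVT t0 (fun s _ => df s) cf.
by rewrite subr0 normrM (gtr0_norm t0) ler_wpM2r // ltW.
Qed.

(** exp(-t^2/2 + ixt) is within (1 + |x|) t of 1, in each coordinate. *)
Let gauss_trig_bound (x t : R) : 0 < t ->
  `|expR (- t ^+ 2 / 2) * cos (x * t) - 1| <= (1 + `|x|) * t /\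
  `|expR (- t ^+ 2 / 2) * sin (x * t)| <= (1 + `|x|) * t.
Proof.
move=> t0.
have hx : `|sin (x * t)| <= `|x| * t /\ `|cos (x * t) - 1| <= `|x| * t.
  split.
    have := @lipschitz_halfline (fun t => sin (x * t)) (fun t => x * cos (x * t)) `|x|.
    move=> /(_ _ _ t t0); rewrite mulr0 sin0 subr0; apply.
      by move=> s; der; ring.
    by move=> s; rewrite normrM ler_piMr // ler_norml cos_geN1 cos_le1.
  have := @lipschitz_halfline (fun t => cos (x * t)) (fun t => - x * sin (x * t)) `|x|.
  move=> /(_ _ _ t t0); rewrite mulr0 cos0; apply.
    by move=> s; der; ring.
  by move=> s; rewrite normrM normrN ler_piMr // ler_norml sin_geN1 sin_le1.
have [hs hc] := hx.
have e1 : expR (- t ^+ 2 / 2) <= 1.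
  by rewrite -expR0 ler_expR mulNr oppr_le0 divr_ge0 ?sqr_ge0.
have e0 := expR_ge0 (- t ^+ 2 / 2).
have e2 : 1 - t <= expR (- t ^+ 2 / 2).
  have [t1|t1] := leP t 1; last by apply: le_trans e0; rewrite subr_le0 ltW.
  apply: le_trans (expR_ge1Dx _); rewrite lerD2l mulNr lerN2; nra.
move: (expR _) e1 e0 e2 => e e1 e0 e2.
split.
  have -> : e * cos (x * t) - 1 = e * (cos (x * t) - 1) + (e - 1) by ring.
  apply: le_trans (ler_normD _ _) _; rewrite mulrDl mul1r addrC lerD //.
    by rewrite distrC ger0_norm ?subr_ge0 // lerBlDr addrC -lerBlDr.
  by rewrite normrM (ger0_norm e0); apply: le_trans hc; rewrite ler_piMl.
rewrite normrM (ger0_norm e0); apply: (@le_trans _ _ (`|x| * t)).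
  by apply: le_trans hs; rewrite ler_piMl.
by rewrite ler_wpM2r ?(ltW t0) // lerDr.
Qed.

(** The leading term replaces exp(-t^2/2 + ixt) by 1; the error has an extra
    factor t, hence is a Gamma integral with parameter a + 1. *)
Lemma FT_asymptotic_bound (a x y : R) : 0 < a -> 1 <= y ->
  `|Re (FT a x y) - Gamma a / y `^ a| <= (1 + `|x|) * (Gamma (a + 1) / y `^ (a + 1)) /\
  `|Im (FT a x y)| <= (1 + `|x|) * (Gamma (a + 1) / y `^ (a + 1)).
Proof.
move=> a0 y1; have a10 : 0 < a + 1 by rewrite addr_gt0.
have mD : measurable (D : set (measurableTypeR R)) by exact: measurable_itv.
have [g1 e1] := Gamma_scale a0 y1.
have [g2 e2] := Gamma_scale a10 y1.
have [i1 i2] := integrable_kern x y a0.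
have k2 := integrableZR mD (1 + `|x|) g2.
have le (f : R -> R) : mu.-integrable D (EFin \o f) ->
    (forall t : R, 0 < t -> `|f t| <= t `^ (a - 1) * expR (- (y * t)) * ((1 + `|x|) * t)) ->
    `|\int[mu]_(t in D) f t| <= (1 + `|x|) * (Gamma (a + 1) / y `^ (a + 1)).
  move=> fi fk; rewrite -e2 -(RintegralZl (1 + `|x|) mD g2).
  apply: le_trans (le_normr_Rintegral mD fi) _.
  apply: (le_Rintegral mD _ k2); first exact: (integrable_norm fi).
  move=> t; rewrite /= in_itv /= andbT => t0; apply: le_trans (fk t t0) _.
  by rewrite addrK (powR_subr1 a t0) le_eqVlt; apply/orP; left; apply/eqP; ring.
have kE (t : R) : expR (- t ^+ 2 / 2 - y * t) = expR (- t ^+ 2 / 2) * expR (- (y * t)).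
  by rewrite -expRD.
split.
  rewrite ReFT -e1 -(RintegralB mD i1 g1); apply: le; first exact: integrableBR.
  move=> t t0; rewrite /kern /= kE.
  rewrite (_ : _ - _ = t `^ (a - 1) * expR (- (y * t)) * (expR (- t ^+ 2 / 2) * cos (x * t) - 1)); last by ring.
  rewrite normrM ger0_norm ?mulr_ge0 ?powR_ge0 ?expR_ge0 // ler_wpM2l ?mulr_ge0 ?powR_ge0 ?expR_ge0 //.
  by have [] := gauss_trig_bound x t0.
rewrite ImFT; apply: le => // t t0; rewrite /kern /= kE.
rewrite (_ : _ * (_ * _) = t `^ (a - 1) * expR (- (y * t)) * (expR (- t ^+ 2 / 2) * sin (x * t))); last by ring.
rewrite normrM ger0_norm ?mulr_ge0 ?powR_ge0 ?expR_ge0 // ler_wpM2l ?mulr_ge0 ?powR_ge0 ?expR_ge0 //.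
by have [] := gauss_trig_bound x t0.
Qed.

Lemma FT_asymptotic (a x : R) : 0 < a ->
  nsq (FT a x n.+1%:R) * (n.+1%:R `^ a) ^+ 2 @[n --> \oo] --> Gamma a ^+ 2.
Proof.
move=> a0; pose K := (1 + `|x|) * Gamma (a + 1).
have y1 (n : nat) : (1 : R) <= n.+1%:R by rewrite ler1n.
have lim0 : K * n.+1%:R^-1 @[n --> \oo] --> (0 : R).
  by rewrite -[X in _ --> X](mulr0 K); apply: cvgMr; exact: cvg_harmonic.
have pS (n : nat) : n.+1%:R `^ a / n.+1%:R `^ (a + 1) = n.+1%:R^-1 :> R.
  have p0 : n.+1%:R `^ a != 0 :> R by rewrite gt_eqF // powR_gt0.
  have n0 : n.+1%:R != 0 :> R by rewrite pnatr_eq0.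
  rewrite (@powR_subr1 _ (a + 1)) ?ltr0n // addrK.
  by field; rewrite p0 addrC natr1 n0.
have cR : n.+1%:R `^ a * Re (FT a x n.+1%:R) @[n --> \oo] --> Gamma a.
  apply/subr_cvg0; apply: norm_cvg0; apply: (squeeze_cvgr _ (cvg_cst 0) lim0).
  apply: nearW => n; rewrite normr_ge0 /=.
  have [h _] := FT_asymptotic_bound x a0 (y1 n).
  have p0 : 0 < n.+1%:R `^ a :> R by rewrite powR_gt0.
  rewrite (_ : _ - _ = n.+1%:R `^ a * (Re (FT a x n.+1%:R) - Gamma a / n.+1%:R `^ a)); last first.
    by field; rewrite gt_eqF.
  rewrite normrM (gtr0_norm p0); apply: le_trans (ler_wpM2l (ltW p0) h) _.
  by rewrite -pS /K le_eqVlt; apply/orP; left; apply/eqP; ring.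
have cI : n.+1%:R `^ a * Im (FT a x n.+1%:R) @[n --> \oo] --> (0 : R).
  apply: norm_cvg0; apply: (squeeze_cvgr _ (cvg_cst 0) lim0).
  apply: nearW => n; rewrite normr_ge0 /=.
  have [_ h] := FT_asymptotic_bound x a0 (y1 n).
  have p0 : 0 < n.+1%:R `^ a :> R by rewrite powR_gt0.
  rewrite normrM (gtr0_norm p0); apply: le_trans (ler_wpM2l (ltW p0) h) _.
  by rewrite -pS /K le_eqVlt; apply/orP; left; apply/eqP; ring.
have -> : Gamma a ^+ 2 = Gamma a * Gamma a + 0 * 0 by ring.
have -> : (fun n => nsq (FT a x n.+1%:R) * (n.+1%:R `^ a) ^+ 2) =
   (fun n => (n.+1%:R `^ a * Re (FT a x n.+1%:R)) * (n.+1%:R `^ a * Re (FT a x n.+1%:R)) +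
     (n.+1%:R `^ a * Im (FT a x n.+1%:R)) * (n.+1%:R `^ a * Im (FT a x n.+1%:R))).
  by apply/funext => n; rewrite /nsq; ring.
by apply: cvgD; apply: cvgM.
Qed.

End transform_asymptotics.

(** * The value of the transform at 0 *)

Section gauss_primitive.
Context {R : realType}.
Local Notation mu := (@lebesgue_measure R).
Local Notation D := (`]0%R, +oo[%classic : set R).

Definition gauss_cumul (w : R) : R := \int[mu]_(t in `]-oo, w]) gauss_fun t.

Let gi (A : set (measurableTypeR R)) : measurable A -> mu.-integrable A (EFin \o (@gauss_fun R)).
Proof. by move=> mA; apply: integrableS integrableT_gauss. Qed.

Let RintT_gauss : \int[mu]_t gauss_fun t = Num.sqrt (pi : R).
Proof. by rewrite /Rintegral integralT_gauss. Qed.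

Lemma is_derive_gauss_cumul (w : R) : is_derive w 1 gauss_cumul (gauss_fun w).
Proof.
have w1 : w < w + 1 by rewrite ltrDl.
have [|||d e] := @continuous_FTC1 R gauss_fun -oo%O w (w + 1) w1 _.
- exact: gi.
- by rewrite ltNyr.
- exact: continuous_gauss_fun.
by apply: DeriveDef; [exact: d|rewrite -derive1E; exact: e].
Qed.

Lemma gauss_cumul_le (w : R) : `|gauss_cumul w| <= Num.sqrt pi.
Proof.
have m1 : measurable (`]-oo, w] : set (measurableTypeR R)) by exact: measurable_itv.
rewrite ger0_norm; last by apply: Rintegral_ge0 => t _; exact: gauss_fun_ge0.
rewrite -RintT_gauss /gauss_cumul /Rintegral fine_le //.
- by apply: (integrable_fin_num m1); exact: gi.
- by apply: (integrable_fin_num measurableT); exact: gi.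
apply: ge0_subset_integral => //.
- by apply/measurable_EFinP; exact: measurable_gauss_fun.
- by move=> t _; rewrite lee_fin; exact: gauss_fun_ge0.
Qed.

Let gauss_cumul_cvg (u : nat -> R) (l : R -> R) : measurable_fun setT l ->
  (forall t, (gauss_fun \_ `]-oo, u n]) t @[n --> \oo] --> l t) ->
  gauss_cumul (u n) @[n --> \oo] --> \int[mu]_t l t.
Proof.
move=> ml hl; rewrite /gauss_cumul; under eq_fun do rewrite Rintegral_mkcond.
have [||||_ //] := @cvg_Rintegral_dominated _ (measurableTypeR R) _ mu setT
  (fun n => gauss_fun \_ `]-oo, u n]) l gauss_fun measurableT _ ml.
- move=> n; apply/(measurable_restrictT _ _).1 => //.
  by apply: measurable_funTS; exact: measurable_gauss_fun.
- by apply: aeW => t _; exact: hl.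
- exact: integrableT_gauss.
- apply: aeW => t n _; rewrite patchE; case: ifP => _.
    by rewrite ger0_norm ?gauss_fun_ge0.
  by rewrite normr0 gauss_fun_ge0.
Qed.

Lemma gauss_cumul_cvg_pinfty : gauss_cumul w @[w --> +oo] --> Num.sqrt (pi : R).
Proof.
apply/cvg_pinftyP => u uy; rewrite -RintT_gauss; apply: gauss_cumul_cvg; first exact: measurable_gauss_fun.
move=> t; apply: cvg_near_cst.
move/cvgryPge : uy => /(_ t); apply: filterS => n tn.
by rewrite patchE mem_set //= in_itv.
Qed.

Lemma gauss_cumul_cvg_ninfty : gauss_cumul w @[w --> -oo] --> (0 : R).
Proof.
apply/cvg_ninftyP => u uy.
rewrite (_ : 0 = \int[mu]_(t in setT) (0 : R)); last by rewrite /Rintegral integral0.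
apply: gauss_cumul_cvg => //.
move=> t; apply: cvg_near_cst.
move/cvgrNyPlt : uy => /(_ t); apply: filterS => n tn.
by rewrite patchE memNset //= in_itv /= leNgt tn.
Qed.

(** The Cauchy-Schloemilch substitution w = s - u/s maps the half-line
    increasingly onto the real line. *)
Lemma Rintegral_Schloemilch (u : R) : 0 < u ->
  mu.-integrable D (EFin \o (fun s => (1 + u / s ^+ 2) * expR (- (s ^+ 2 + (u / s) ^+ 2) / 2))) /\
  \int[mu]_(s in D) ((1 + u / s ^+ 2) * expR (- (s ^+ 2 + (u / s) ^+ 2) / 2)) =
    Num.sqrt (2 * pi) * expR (- u).
Proof.
move=> u0.
pose r2 : R := Num.sqrt 2.
have r20 : 0 < r2 by rewrite sqrtr_gt0.
have r2E : r2 ^+ 2 = 2 by rewrite sqr_sqrtr.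
pose F (s : R) := (s - u / s) / r2.
pose f (s : R) := (1 + u / s ^+ 2) * expR (- (s ^+ 2 + (u / s) ^+ 2) / 2).
pose c := r2 * expR (- u).
have dF (s : R) : 0 < s -> is_derive s 1 (fun s => c * gauss_cumul (F s)) (f s).
  move=> s0; have s1 : s != 0 by rewrite gt_eqF.
  have dF : is_derive s 1 F ((1 + u / s ^+ 2) / r2).
    by rewrite /F; der => //; rewrite /=; field; rewrite s1 gt_eqF.
  have dPhi := drv_comp (is_derive_gauss_cumul (F s)) dF.
  apply: drv_eq (drv_mul (drv_cst s c) dPhi) _.
  rewrite mul0r addr0 /c /f /gauss_fun.
  have -> : - (s ^+ 2 + (u / s) ^+ 2) / 2 = - u - F s ^+ 2.
    rewrite /F [(_ / r2) ^+ 2]exprMn exprVn r2E; by field.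
  by rewrite expRD; field; rewrite s1 gt_eqF.
have f0 (s : R) : 0 < s -> 0 <= f s.
  by move=> s0; rewrite mulr_ge0 ?expR_ge0 // addr_ge0 // divr_ge0 ?sqr_ge0 // ltW.
have cf : {in D, continuous f}.
  move=> s; rewrite inE /= in_itv /= andbT => s0.
  have [df d] : exists df : R, is_derive s 1 f df.
    by rewrite /f; eexists; der1; rewrite ?expf_neq0 // gt_eqF.
  exact: drv_continuous d.
have c0 : 0 <= c by rewrite mulr_ge0 ?expR_ge0 // ltW.
have fi : mu.-integrable D (EFin \o f).
  apply: (integrable_bounded_primitive f0 cf dF (M := c * Num.sqrt pi)) => s s0.
  by rewrite normrM (ger0_norm c0) ler_wpM2l // gauss_cumul_le.
split => //.
have F0 : F s @[s --> 0^'+] --> -oo.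
  apply/cvgrNyPle => A.
  have q0 : 0 < 1 + r2 * `|A| by rewrite ltr_pwDl ?mulr_ge0 ?(ltW r20).
  near=> s.
  have s0 : 0 < s by near: s; exact: nbhs_right_gt.
  have s1 : s < 1 by near: s; apply: nbhs_right_lt.
  have su : s < u / (1 + r2 * `|A|).
    by near: s; apply: nbhs_right_lt; rewrite divr_gt0.
  have us : 1 + r2 * `|A| < u / s by rewrite ltr_pdivlMr // mulrC -ltr_pdivlMr.
  rewrite /F ler_pdivrMr //.
  have : r2 * (- `|A|) <= r2 * A by rewrite ler_pM2l // lerNl -normrN ler_norm.
  by move: us s1; lra.
have Fy : F s @[s --> +oo] --> +oo.
  apply/cvgryPge => A; near=> s.
  have s1 : 1 <= s by near: s; apply: nbhs_pinfty_ge; rewrite num_real.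
  have sA : r2 * A + u <= s by near: s; apply: nbhs_pinfty_ge; rewrite num_real.
  rewrite /F ler_pdivlMr // mulrC lerBrDr; apply: le_trans sA.
  by rewrite lerD2l ler_pdivrMr ?(lt_le_trans ltr01) // ler_peMr // ltW.
rewrite (Rintegral_primitive cf fi dF (l0 := c * 0) (l1 := c * Num.sqrt pi)).
- by rewrite mulr0 subr0 /c sqrtrM // -/r2; ring.
- by apply: cvgMr; apply: cvg_comp F0 gauss_cumul_cvg_ninfty.
- by apply: cvgMr; apply: cvg_comp Fy gauss_cumul_cvg_pinfty.
Unshelve. all: by end_near. Qed.

End gauss_primitive.

Section duplication.
Context {R : realType}.
Local Notation Re := complex.Re.
Local Notation mu := (@lebesgue_measure R).
Local Notation D := (`]0%R, +oo[%classic : set R).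

Lemma EFin_Rintegral (f : R -> R) : mu.-integrable D (EFin \o f) ->
  (\int[mu]_(t in D) (f t)%:E = (\int[mu]_(t in D) f t)%:E)%E.
Proof.
move=> fi; rewrite /Rintegral fineK //.
have mD : measurable (D : set (measurableTypeR R)) by exact: measurable_itv.
exact: (integrable_fin_num mD fi).
Qed.

Lemma Rintegral_halfline_scale (c : R) (f : R -> R) : 0 < c ->
  measurable_fun setT f -> (forall x, 0 <= f x) -> mu.-integrable D (EFin \o f) ->
  mu.-integrable D (EFin \o (fun t => f (c * t))) /\
  \int[mu]_(t in D) f t = c * \int[mu]_(t in D) f (c * t).
Proof.
move=> c0 mf f0 fi.
have h := ge0_integral_halfline_scale c0 mf f0.
have mg : measurable_fun setT (fun t => f (c * t)).
  by apply: measurableT_comp => //; exact: measurable_funM.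
have gi : mu.-integrable D (EFin \o (fun t => f (c * t))).
  apply/integrableP; split; first by apply/measurable_EFinP; exact: measurable_funTS.
  under eq_integral do rewrite /= ger0_norm //.
  move: h; rewrite (EFin_Rintegral fi).
  case: (\int[mu]_(t in D) (f (c * t))%:E)%E => [r||] //.
    by rewrite ltry.
  by rewrite gt0_muley ?lte_fin.
split => //.
by apply: EFin_inj; rewrite EFinM -(EFin_Rintegral fi) -(EFin_Rintegral gi).
Qed.

Lemma eq_integrable_halfline (f1 f2 : R -> R) : (forall t : R, 0 < t -> f1 t = f2 t) ->
  mu.-integrable D (EFin \o f1) -> mu.-integrable D (EFin \o f2).
Proof.
move=> e12; have mD : measurable (D : set (measurableTypeR R)) by exact: measurable_itv.
apply: (eq_integrable mD) => t; rewrite inE /= in_itv /= andbT => t0.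
by rewrite e12.
Qed.

Let g (a t : R) : R := t `^ (a - 1) * expR (- t ^+ 2 / 2).

Let g_ge0 (a t : R) : 0 <= g a t.
Proof. by rewrite mulr_ge0 ?powR_ge0 ?expR_ge0. Qed.

Let measurable_g (a : R) : measurable_fun setT (g a).
Proof.
apply: measurable_funM; first exact: measurable_powR.
apply: measurableT_comp => //; apply: measurable_funM => //.
by apply: measurableT_comp => //; exact: exprn_measurable.
Qed.

Let gE (a : R) : (fun t => Re (kern a 0 0 t)) = g a.
Proof.
by apply/funext => t; rewrite /kern /g /= !mul0r cos0 mulr1 subr0.
Qed.

Let integrable_g (a : R) : 0 < a -> mu.-integrable D (EFin \o g a).
Proof. by move=> a0; rewrite -gE; have [] := integrable_kern 0 0 a0. Qed.

(** The product of the integrands of F_a(0) and F_(a+1)(0) at t and s, in the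
    variables s and u = st and symmetrized in s and t, is u^(a-1) h(s, u). *)
Let h (s u : R) : R := (1 + u / s ^+ 2) * expR (- (s ^+ 2 + (u / s) ^+ 2) / 2).

Let h_slice (a s : R) : 0 < a -> 0 < s ->
  mu.-integrable D (EFin \o (fun u => u `^ (a - 1) * h s u)) /\
  \int[mu]_(u in D) (u `^ (a - 1) * h s u) =
    Re (FT a 0 0) * g (a + 1) s + Re (FT (a + 1) 0 0) * g a s.
Proof.
move=> a0 s0; have a10 : 0 < a + 1 by rewrite addr_gt0.
have si0 : 0 < s^-1 by rewrite invr_gt0.
have mD : measurable (D : set (measurableTypeR R)) by exact: measurable_itv.
have [i1 e1] := Rintegral_halfline_scale si0 (measurable_g a) (g_ge0 a) (integrable_g a0).
have [i2 e2] := Rintegral_halfline_scale si0 (measurable_g (a + 1)) (g_ge0 (a + 1)) (integrable_g a10).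
have j1 := integrableZR mD (g (a + 1) s / s) i1.
have j2 := integrableZR mD (g a s / s) i2.
have E (u : R) : 0 < u -> u `^ (a - 1) * h s u =
    g (a + 1) s / s * g a (s^-1 * u) + g a s / s * g (a + 1) (s^-1 * u).
  move=> u0; have su0 : 0 < s^-1 * u by rewrite mulr_gt0.
  rewrite /g !addrK (powR_subr1 a s0) (powR_subr1 a su0).
  rewrite (powRM (a - 1) (ltW si0) (ltW u0)).
  have -> : s^-1 `^ (a - 1) = (s `^ (a - 1))^-1.
    by rewrite -powR_inv1 ?(ltW s0) // -powRrM mulN1r powRN.
  have p0 : s `^ (a - 1) != 0 by rewrite gt_eqF // powR_gt0.
  have -> : h s u = (1 + u / s ^+ 2) * (expR (- s ^+ 2 / 2) * expR (- (s^-1 * u) ^+ 2 / 2)).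
    rewrite /h -expRD; congr (_ * expR _); field; exact: lt0r_neq0.
  by field; rewrite p0 gt_eqF.
split.
  apply: (@eq_integrable_halfline (fun u => g (a + 1) s / s * g a (s^-1 * u) + g a s / s * g (a + 1) (s^-1 * u))).
    by move=> u /E ->.
  exact: integrableDR.
transitivity (\int[mu]_(u in D) (g (a + 1) s / s * g a (s^-1 * u) + g a s / s * g (a + 1) (s^-1 * u))).
  apply: eq_Rintegral => u; rewrite inE /= in_itv /= andbT; exact: E.
rewrite (RintegralD mD j1 j2) (RintegralZl _ mD i1) (RintegralZl _ mD i2).
rewrite !ReFT !gE e1 e2; ring.
Qed.

(** The double integral of u^(a-1) h(s, u), computed in both orders: integrating
    over u first gives the products of transforms, and over s first the
    Cauchy-Schloemilch integral, which leaves Gamma(a). *)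
Lemma FT_duplication (a : R) : 0 < a ->
  2 * (Re (FT a 0 0) * Re (FT (a + 1) 0 0)) = Num.sqrt (2 * pi) * Gamma a.
Proof.
move=> a0; have a10 : 0 < a + 1 by rewrite addr_gt0.
have mD : measurable (D : set (measurableTypeR R)) by exact: measurable_itv.
pose T : measurableType _ := measurableTypeR R.
(* A power with exponent -1 in place of the inverse, for measurability. *)
pose k (s u : R) : R := (1 + u * s `^ (- 1) ^+ 2) *
  expR (- (s ^+ 2 + (u * s `^ (- 1)) ^+ 2) / 2).
have kE (s u : R) : 0 < s -> k s u = h s u.
  by move=> s0; rewrite /k /h powR_inv1 ?(ltW s0) // exprVn.
pose f2 (z : T * T) : R := \1_D z.1 * (\1_D z.2 * (z.2 `^ (a - 1) * k z.1 z.2)).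
have h0 (s u : R) : 0 < s -> 0 < u -> 0 <= h s u.
  by move=> s0 u0; rewrite mulr_ge0 ?expR_ge0 // addr_ge0 // divr_ge0 ?sqr_ge0 // ltW.
have f2E s u : f2 (s, u) = ((fun s => ((fun u => u `^ (a - 1) * h s u) \_ D) u) \_ D) s.
  rewrite /f2 /indic !patchE /=; case: (boolP (s \in D)) => s1; last by rewrite mul0r.
  case: (boolP (u \in D)) => u1; last by rewrite mul0r mulr0.
  by rewrite !mul1r kE //; move: s1; rewrite inE /= in_itv /= andbT.
have f20 z : 0 <= f2 z.
  case: z => s u; rewrite f2E !patchE; case: ifPn => // s1; case: ifPn => // u1.
  move: s1 u1; rewrite !inE /= !in_itv /= !andbT => s1 u1.
  by rewrite mulr_ge0 ?powR_ge0 ?h0.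
have mf2 : measurable_fun setT (EFin \o f2).
  apply/measurable_EFinP.
  have m1 : measurable_fun setT (fun z : T * T => z.1 : R) by exact: measurable_fst.
  have m2 : measurable_fun setT (fun z : T * T => z.2 : R) by exact: measurable_snd.
  have mi : measurable_fun setT (fun z : T * T => (z.1 : R) `^ (- 1)).
    exact: (measurableT_comp (measurable_powR (- 1)) m1).
  have mi2 : measurable_fun setT (fun z : T * T => (z.2 : R) * (z.1 : R) `^ (- 1)).
    exact: measurable_funM.
  apply: measurable_funM.
    exact: (measurableT_comp (measurable_indic mD) m1).
  apply: measurable_funM.
    exact: (measurableT_comp (measurable_indic mD) m2).
  apply: measurable_funM.
    exact: (measurableT_comp (measurable_powR (a - 1)) m2).
  apply: measurable_funM.
    by apply: measurable_funD => //; apply: measurable_funM => //; exact: measurable_funX.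
  apply: measurableT_comp => //; apply: measurable_funM => //.
  apply: measurableT_comp => //.
  by apply: measurable_funD; exact: measurable_funX.
have ft := @fubini_tonelli _ _ T T R mu mu (EFin \o f2) mf2 (fun z => f20 z).
pose K := Re (FT a 0 0); pose L := Re (FT (a + 1) 0 0).
apply: EFin_inj; apply: (etrans (esym _) (etrans ft _)).
- transitivity (\int[mu]_(s in D) (K * g (a + 1) s + L * g a s)%:E)%E.
    rewrite [RHS]integral_mkcond; apply: eq_integral => s _; rewrite patchE.
    case: ifPn => [|sD].
      rewrite inE /= in_itv /= andbT => s0.
      have [si se] := h_slice a0 s0.
      rewrite -se -(EFin_Rintegral si) [RHS]integral_mkcond; apply: eq_integral => u _.
      rewrite /= f2E !patchE ifT; first by case: ifP.
      by rewrite inE /= in_itv /= andbT.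
    transitivity (0%E : \bar R); last by [].
    by apply: integral0_eq => u _; rewrite /= f2E patchE (negbTE sD).
  have i1 := integrableZR mD K (integrable_g a10).
  have i2 := integrableZR mD L (integrable_g a0).
  rewrite (EFin_Rintegral (integrableDR mD i1 i2)); congr EFin.
  rewrite (RintegralD mD i1 i2) (RintegralZl _ mD (integrable_g a10))
    (RintegralZl _ mD (integrable_g a0)) /K /L !ReFT !gE; ring.
- have gi := integrable_gammaf a0.
  rewrite -(RintegralZl _ mD gi) -(EFin_Rintegral (integrableZR mD _ gi)).
  rewrite [RHS]integral_mkcond; apply: eq_integral => u _; rewrite patchE.
  case: ifPn => [|uD].
    rewrite inE /= in_itv /= andbT => u0.
    have [si se] := Rintegral_Schloemilch u0.
    rewrite /gammaf mulrCA -se -(RintegralZl _ mD si) -(EFin_Rintegral (integrableZR mD _ si)).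
    rewrite [RHS]integral_mkcond; apply: eq_integral => s _.
    have uD : u \in (D : set R) by rewrite inE /= in_itv /= andbT.
    rewrite /= f2E !patchE uD; case: ifP => _; last by [].
    by rewrite /h.
  transitivity (0%E : \bar R); last by [].
  apply: integral0_eq => s _; by rewrite /= f2E !patchE (negbTE uD); case: ifP.
Qed.

End duplication.

(** * The density on the real line *)

Section convexity.
Context {R : realType}.

Lemma derive_ge0_le (f f' : R -> R) (x1 x : R) :
  (forall s : R, is_derive s 1 f (f' s)) -> (forall s, x1 <= s -> 0 <= f' s) ->
  x1 <= x -> f x1 <= f x.
Proof.
move=> df f0; rewrite le_eqVlt => /predU1P[->//|x1x].
have cf : {within `[x1, x], continuous f}.
  by apply: continuous_subspaceT => s; exact: drv_continuous (df s).
have [s + e] := MVT x1x (fun s _ => df s) cf.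
rewrite in_itv /= => /andP[/ltW /f0 s1 _].
by rewrite -subr_ge0 e mulr_ge0 // subr_ge0 ltW.
Qed.

Lemma derive_le0_ge (f f' : R -> R) (x1 x : R) :
  (forall s : R, is_derive s 1 f (f' s)) -> (forall s, x1 <= s -> f' s <= 0) ->
  x1 <= x -> f x <= f x1.
Proof.
move=> df f0 x1x; rewrite -lerN2.
apply: (@derive_ge0_le (fun x => - f x) (fun x => - f' x)) => // s.
by move=> /f0; rewrite oppr_ge0.
Qed.

(** N does not decrease after x1, so N'' >= N(x1) there, and this integrates
    twice to a parabola. *)
Lemma quadratic_growth (N N1 N2 : R -> R) (x1 : R) :
  (forall s : R, is_derive s 1 N (N1 s)) -> (forall s : R, is_derive s 1 N1 (N2 s)) ->
  (forall s, 0 < N s) -> 0 <= N1 x1 -> (forall s, x1 <= s -> N s <= N2 s) ->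
  forall x, x1 <= x -> N x1 * (1 + (x - x1) ^+ 2 / 2) <= N x.
Proof.
move=> dN dN1 N0 N10 NN2.
have N1_ge0 x : x1 <= x -> 0 <= N1 x.
  move=> xx; apply: le_trans N10 _; apply: (derive_ge0_le dN1) => // s x1s.
  exact: le_trans (ltW (N0 s)) (NN2 s x1s).
have N_ge x : x1 <= x -> N x1 <= N x by exact: derive_ge0_le.
pose n := N x1.
have d1 (s : R) : is_derive s 1 (fun x => N1 x - n * (x - x1)) (N2 s - n).
  by have d := dN1 s; der; ring.
have N1_ge x : x1 <= x -> n * (x - x1) <= N1 x.
  move=> xx; rewrite -subr_ge0.
  have := derive_ge0_le d1 (x1 := x1) (x := x).
  rewrite subrr mulr0 subr0 => h; apply: le_trans N10 (h _ xx) => s x1s.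
  by rewrite subr_ge0; apply: le_trans (NN2 s x1s); exact: N_ge.
have d2 (s : R) : is_derive s 1 (fun x => N x - n * (1 + (x - x1) ^+ 2 / 2)) (N1 s - n * (s - x1)).
  by have d := dN s; der; rewrite /=; field.
move=> x xx; rewrite -subr_ge0.
have := derive_ge0_le d2 (x1 := x1) (x := x).
rewrite subrr expr0n /= mul0r addr0 mulr1 subrr; apply => // s x1s.
by rewrite subr_ge0; exact: N1_ge.
Qed.

End convexity.

Section real_line.
Context {R : realType}.
Variable a : R.
Hypothesis a0 : 0 < a.
Local Notation C := R[i].
Local Notation Re := complex.Re.
Local Notation Im := complex.Im.
Local Notation mu := (@lebesgue_measure R).
Local Notation D := (`]0%R, +oo[%classic : set R).
Local Notation A x := (Re (FT a x 0)).
Local Notation B x := (Im (FT a x 0)).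
Local Notation A1 x := (Re (FT (a + 1) x 0)).
Local Notation B1 x := (Im (FT (a + 1) x 0)).

Let a10 : 0 < a + 1. Proof. by rewrite addr_gt0. Qed.

Let dFT (b x : R) : 0 < b ->
  is_derive x 1 (fun x => Re (FT b x 0)) (- Im (FT (b + 1) x 0)) /\
  is_derive x 1 (fun x => Im (FT b x 0)) (Re (FT (b + 1) x 0)).
Proof.
move=> b0; have [h1 h2 _ _] := holo_FT x 0 b0.
by move: h1 h2; rewrite ReM ImM /= !mul0r !mul1r sub0r add0r.
Qed.

Let dA1 (x : R) : is_derive x 1 (fun x => A1 x) (- (a * B x + x * A1 x)).
Proof.
have [h _] := dFT x a10; have [_ e] := FT_rec x 0 a0.
by apply: drv_eq h _; rewrite e mul0r subr0.
Qed.

Let dB1 (x : R) : is_derive x 1 (fun x => B1 x) (a * A x - x * B1 x).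
Proof.
have [_ h] := dFT x a10; have [e _] := FT_rec x 0 a0.
by apply: drv_eq h _; rewrite e mul0r subr0.
Qed.

(** F_a and its conjugate solve y'' + x y' + a y = 0, whose Wronskians are
    multiples of exp(-x^2/2). *)
Lemma FT_wronskian (x : R) :
  2 * (A x * A1 x + B x * B1 x) = Num.sqrt (2 * pi) * Gamma a * expR (- x ^+ 2 / 2).
Proof.
pose W (x : R) := (A x * A1 x + B x * B1 x) * expR (x ^+ 2 / 2).
have dW (s : R) : is_derive s 1 W 0.
  have [hA hB] := dFT s a0; have hA1 := dA1 s; have hB1 := dB1 s.
  by rewrite /W; der; rewrite /=; field.
have Wc : W x = W 0 by exact: is_derive_0_is_cst.
have B0 : B 0 = 0.
  rewrite ImFT (_ : Rintegral _ _ _ = \int[mu]_(t in D) (0 : R)).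
    by rewrite /Rintegral integral0.
  by apply: eq_Rintegral => t _; rewrite /kern /= mul0r sin0 !mulr0.
have W0 : 2 * W 0 = Num.sqrt (2 * pi) * Gamma a.
  by rewrite /W B0 expr0n /= !mul0r expR0 addr0 mulr1 FT_duplication.
have e : expR (x ^+ 2 / 2) * expR (- x ^+ 2 / 2) = 1.
  by rewrite -expRD mulNr subrr expR0.
by rewrite -W0 -Wc /W -[LHS]mulr1 -[X in _ * X = _]e; ring.
Qed.

Lemma FT_neq0 (x : R) : 0 < nsq (FT a x 0).
Proof.
rewrite lt_neqAle nsq_ge0 andbT eq_sym; apply/negP.
rewrite /nsq paddr_eq0 ?sqr_ge0 // !sqrf_eq0 => /andP[/eqP eA /eqP eB].
have := FT_wronskian x; rewrite eA eB !mul0r addr0 mulr0 => /eqP.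
rewrite eq_sym gt_eqF // !mulr_gt0 ?expR_gt0 ?Gamma_gt0 //.
by rewrite sqrtr_gt0 mulr_gt0 // pi_gt0.
Qed.

Lemma mu_densityE (x : R) : mu_density a x =
  expR (- x ^+ 2 / 2) / Num.sqrt (2 * pi) * (Gamma a / (a * nsq (FT a x 0))).
Proof.
rewrite /mu_density; congr (_ * _).
have G0 := Gamma_gt0 a0.
have -> : f_hat a x = real_complex R (Num.sqrt (a / Gamma a)) * FT a x 0.
  rewrite /f_hat FT.unlock; congr (_ * Cintegral _ _ _); apply/funext => t.
  apply/eqP; rewrite eq_complex !(ReM, ImM) /= !mul0r subr0 addr0 subr0.
  by rewrite !eqxx.
have aG : 0 <= a / Gamma a by rewrite divr_ge0 // ltW.
have -> : ComplexField.Normc.normc (real_complex R (Num.sqrt (a / Gamma a)) * FT a x 0) ^+ 2 =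
    a / Gamma a * nsq (FT a x 0).
  have nE (z : C) : ComplexField.Normc.normc z ^+ 2 = nsq z.
    by case: z => u v; rewrite /= sqr_sqrtr // addr_ge0 ?sqr_ge0.
  by rewrite nE nsqM /nsq /= expr0n /= addr0 sqr_sqrtr.
have := FT_neq0 x => S0.
by field; rewrite !gt_eqF.
Qed.

(** The right-hand side is |F_a|^2 times the derivative of the argument of F_a,
    because F_a' = i F_(a+1). *)
Lemma mu_density_wronskian (x : R) :
  pi * a * mu_density a x * nsq (FT a x 0) = A x * A1 x + B x * B1 x.
Proof.
have S0 := FT_neq0 x; have := FT_wronskian x; rewrite mu_densityE.
have s0 : 0 < Num.sqrt (2 * pi) :> R by rewrite sqrtr_gt0 mulr_gt0 // pi_gt0.
have s2 : Num.sqrt (2 * pi) ^+ 2 = 2 * pi :> R by rewrite sqr_sqrtr // mulr_ge0 // ltW // pi_gt0.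
move: (nsq _) S0 (Num.sqrt _) s0 s2 => S S0 r r0 r2 e.
apply: (@mulfI _ 2) => //; rewrite e.
have -> : pi = r ^+ 2 / 2 :> R by rewrite r2; field.
by field; rewrite !gt_eqF.
Qed.

Lemma mu_density_gt0 (x : R) : 0 < mu_density a x.
Proof.
rewrite mu_densityE mulr_gt0 // divr_gt0 ?expR_gt0 ?mulr_gt0 ?FT_neq0 ?Gamma_gt0 //.
by rewrite sqrtr_gt0 mulr_gt0 // pi_gt0.
Qed.

Lemma continuous_mu_density : continuous (mu_density a).
Proof.
move=> x; have [hA hB] := dFT x a0.
have n0 : a * nsq (FT a x 0) != 0 by rewrite mulf_neq0 // gt_eqF // FT_neq0.
have [d dE] : exists d : R, is_derive x 1 (mu_density a) d.
  eexists; notypeclasses refine (drv_ext mu_densityE _).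
  by rewrite /nsq in n0 *; der1.
exact: drv_continuous dE.
Qed.

Lemma measurable_mu_density : measurable_fun setT (mu_density a).
Proof. exact: continuous_measurable_fun continuous_mu_density. Qed.

Lemma mu_densityN (x : R) : mu_density a (- x) = mu_density a x.
Proof.
have mD : measurable (D : set (measurableTypeR R)) by exact: measurable_itv.
have [i1 i2] := integrable_kern x 0 a0.
suff key : nsq (FT a (- x) 0) = nsq (FT a x 0) by rewrite !mu_densityE sqrrN key.
rewrite /nsq !ReFT !ImFT.
have -> : \int[mu]_(t in D) Re (kern a (- x) 0 t) = \int[mu]_(t in D) Re (kern a x 0 t).
  by apply: eq_Rintegral => t _; rewrite /kern /= (mulNr x) cosN.
have -> : \int[mu]_(t in D) Im (kern a (- x) 0 t) = - \int[mu]_(t in D) Im (kern a x 0 t).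
  have h := @RintegralZl _ _ _ mu D (fun t => Im (kern a x 0 t)) (- 1) mD i2.
  rewrite mulN1r in h; rewrite -h.
  by apply: eq_Rintegral => t _; rewrite /kern /= (mulNr x) sinN !mulrN mulN1r.
by rewrite sqrrN.
Qed.

Variable m : probability (measurableTypeR R) R.
Hypothesis mp : has_density m (mu_density a).

Let N (x : R) := (mu_density a x)^-1.
Let c : R := a * Num.sqrt (2 * pi) / Gamma a.

Let c0 : 0 < c.
Proof.
by rewrite divr_gt0 ?Gamma_gt0 // mulr_gt0 // sqrtr_gt0 mulr_gt0 // pi_gt0.
Qed.

Let NE (x : R) : N x = c * (expR (x ^+ 2 / 2) * (A x ^+ 2 + B x ^+ 2)).
Proof.
have e : expR (- x ^+ 2 / 2) = (expR (x ^+ 2 / 2))^-1 by rewrite mulNr expRN.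
have := FT_neq0 x; rewrite /N /c mu_densityE e /nsq => S0.
have s0 : 0 < Num.sqrt (2 * pi) :> R by rewrite sqrtr_gt0 mulr_gt0 // pi_gt0.
have G0 := Gamma_gt0 a0; have e0 := expR_gt0 (x ^+ 2 / 2).
by field; rewrite !gt_eqF.
Qed.

Let T (x : R) := B x * A1 x - A x * B1 x.

Let N1 (x : R) := c * (expR (x ^+ 2 / 2) * (x * (A x ^+ 2 + B x ^+ 2) + 2 * T x)).

(** N'' with the squares completed, which makes N'' >= N visible for large x. *)
Let N2 (x : R) := c * (expR (x ^+ 2 / 2) * ((x ^+ 2 / 2 + 1 - 2 * a) * (A x ^+ 2 + B x ^+ 2)
  + 2 * (B1 x - x / 2 * A x) ^+ 2 + 2 * (A1 x + x / 2 * B x) ^+ 2)).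

Let dN (x : R) : is_derive x 1 N (N1 x).
Proof.
have [hA hB] := dFT x a0.
notypeclasses refine (drv_ext NE _); rewrite /N1 /T; der; rewrite /=; by field.
Qed.

Let dN1 (x : R) : is_derive x 1 N1 (N2 x).
Proof.
have [hA hB] := dFT x a0; have hA1 := dA1 x; have hB1 := dB1 x.
rewrite /N1 /N2 /T; der; rewrite /=; by field.
Qed.

Let NN2 (x : R) : 4 * a + 1 <= x -> N x <= N2 x.
Proof.
move=> ax; rewrite NE /N2 !ler_wpM2l ?(ltW c0) ?expR_ge0 // -addrA ler_wpDr //.
  by rewrite addr_ge0 // mulr_ge0 // sqr_ge0.
rewrite ler_peMl ?addr_ge0 ?sqr_ge0 //.
have := a0; nra.
Qed.

Let N0 (x : R) : 0 < N x. Proof. by rewrite invr_gt0 mu_density_gt0. Qed.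

Let NI (x : R) : mu_density a x = (N x)^-1. Proof. by rewrite /N invrK. Qed.

(** Total mass 1 forbids the reciprocal of the density to decrease for ever. *)
Let N1_ge0 : exists2 x1 : R, 4 * a + 1 <= x1 & 0 <= N1 x1.
Proof.
apply: contrapT => h; pose x0 : R := 4 * a + 1.
have N1_le0 x : x0 <= x -> N1 x <= 0.
  by move=> xx; rewrite leNgt; apply/negP => /ltW n1; apply: h; exists x.
pose k := (N x0)^-1.
have k0 : 0 < k by rewrite invr_gt0.
have pk x : x0 <= x -> k <= mu_density a x.
  move=> xx; rewrite NI /k lef_pV2 ?posrE ?N0 //.
  exact: derive_le0_ge dN N1_le0 xx.
(* Of mass at least 2, as the density is at least k on it. *)
pose I : set (measurableTypeR R) := `[x0, x0 + 2 / k]%classic.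
have mI : measurable I by exact: measurable_itv.
have : (2%:E <= m I)%E.
  rewrite mp //; apply: (@le_trans _ _ (\int[mu]_(x in I) k%:E)%E).
    have muI : mu I = (2 / k)%:E.
      rewrite /I lebesgue_measure_itv /= lte_fin ltrDl divr_gt0 //.
      by rewrite -EFinB addrC addKr.
    rewrite integral_cst // [X in (_ <= _ * X)%E]muI -EFinM lee_fin mulrC divfK //.
    by rewrite gt_eqF.
  apply: ge0_le_integral => //.
  - by move=> x _; rewrite lee_fin ltW.
  - by apply/measurable_EFinP; apply: measurable_funTS; exact: measurable_mu_density.
  - by move=> x; rewrite /I /= in_itv /= => /andP[xx _]; rewrite lee_fin pk.
move/le_trans => /(_ _ (probability_le1 m mI)); rewrite lee_fin.
by rewrite leNgt ltr1n.
Qed.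

(** Beyond a point where it does not decrease, the reciprocal of the density
    lies above a parabola; on the bounded interval before this point the density
    is bounded, and it is even. *)
Lemma mu_density_le : exists2 K : R, 0 < K &
  forall x, mu_density a x <= K / (1 + x ^+ 2).
Proof.
have [x1 ax1 n1] := N1_ge0.
have x10 : 0 < x1 by apply: lt_le_trans ax1; rewrite addr_gt0 // mulr_gt0.
have g x : x1 <= x -> N x1 * (1 + (x - x1) ^+ 2 / 2) <= N x.
  by apply: (quadratic_growth dN dN1 N0 n1) => s s1; apply: NN2; exact: le_trans s1.
have cN : {within `[(0 : R), x1], continuous (mu_density a)}.
  by apply: continuous_subspaceT; exact: continuous_mu_density.
have [xm _ hm] := EVT_max (ltW x10) cN.
pose M := mu_density a xm.
have M0 : 0 < M by exact: mu_density_gt0.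
have n0 : 0 < (N x1)^-1 by rewrite invr_gt0.
pose K := M * (1 + x1 ^+ 2) + (N x1)^-1 * (4 + 2 * x1 ^+ 2).
have q1 : 0 < 1 + x1 ^+ 2 by have := sqr_ge0 x1; lra.
have q2 : 0 < 4 + 2 * x1 ^+ 2 by have := sqr_ge0 x1; lra.
(* The first term of K serves for x < x1, the second one beyond. *)
exists K => [|x]; first by rewrite addr_gt0 // mulr_gt0.
wlog x0 : x / 0 <= x.
  move=> h; have [|/ltW xn] := leP 0 x; first exact: h.
  by rewrite -mu_densityN -sqrrN; apply: h; rewrite oppr_ge0.
have p0 : 0 < 1 + x ^+ 2 by rewrite ltr_pwDl ?sqr_ge0.
rewrite ler_pdivlMr //.
have [xx|xx] := leP x1 x.
  have hN := g x xx.
  have q0 : 0 < 1 + (x - x1) ^+ 2 / 2 by rewrite ltr_pwDl ?divr_ge0 ?sqr_ge0.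
  have hp : mu_density a x <= (N x1)^-1 / (1 + (x - x1) ^+ 2 / 2).
    by rewrite NI -invfM lef_pV2 ?posrE ?N0 ?mulr_gt0 ?N0.
  apply: le_trans (ler_wpM2r (ltW p0) hp) _.
  rewrite -mulrA; apply: (@le_trans _ _ ((N x1)^-1 * (4 + 2 * x1 ^+ 2))).
    rewrite ler_wpM2l ?(ltW n0) // mulrC ler_pdivrMr //.
    have := sqr_ge0 (x - 2 * x1); have := sqr_ge0 (x1 * (x - x1)); nra.
  by rewrite lerDr mulr_ge0 ?(ltW M0) ?(ltW q1).
have hM : mu_density a x <= M by apply: hm; rewrite in_itv /= x0 ltW.
apply: (@le_trans _ _ (M * (1 + x1 ^+ 2))).
  rewrite ler_pM ?(ltW p0) ?(ltW (mu_density_gt0 _)) // lerD2l.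
  by rewrite ler_sqr ?nnegrE ?(ltW xx) // ltW.
by rewrite lerDl mulr_ge0 ?(ltW n0) ?(ltW q2).
Qed.

End real_line.

(** * Integration against a measure with a density *)

Section density.
Context {R : realType}.
Local Notation mu := (@lebesgue_measure R).
Local Notation T := (measurableTypeR R).
Variables (m : probability T R) (p : R -> R).
Hypothesis mp : has_density m p.
Hypothesis p_ge0 : forall x, 0 <= p x.
Hypothesis mp' : measurable_fun setT p.

Let dom : m `<< mu.
Proof.
apply/null_content_dominatesP => A mA A0; rewrite mp //.
apply: null_set_integral => //.
by apply/measurable_EFinP; exact: measurable_funTS.
Qed.

Let RN := Radon_Nikodym_SigmaFinite.f m mu.

(** The density agrees almost everywhere with the Radon-Nikodym derivative, for
    which the change of variables is known. *)
Let RNp (E : set T) : measurable E -> ae_eq mu E RN (EFin \o p).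
Proof.
move=> mE; apply: integral_ae_eq => //.
- by apply: (integrableS measurableT) => //; exact: Radon_Nikodym_SigmaFinite.f_integrable.
- by apply/measurable_EFinP; exact: measurable_funTS.
- move=> A AE mA; rewrite -Radon_Nikodym_SigmaFinite.f_integral //.
  by rewrite mp.
Qed.

Lemma ge0_integral_density (f : R -> R) : measurable_fun setT f -> (forall x, 0 <= f x) ->
  (\int[m]_x (f x)%:E = \int[mu]_x (f x * p x)%:E)%E.
Proof.
move=> mf f0.
have mf' : measurable_fun (setT : set T) (EFin \o f) by exact/measurable_EFinP.
rewrite -(Radon_Nikodym_SigmaFinite.change_of_variables dom (f := EFin \o f)) //.
apply: ae_eq_integral => //.
- apply: emeasurable_funM => //.
  by apply: (measurable_int mu); exact: Radon_Nikodym_SigmaFinite.f_integrable.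
- by apply/measurable_EFinP; exact: measurable_funM.
- have := RNp measurableT; apply: filterS => x /(_ I) h _ /=.
  by rewrite EFinM -/RN h.
Qed.

Lemma integrable_density (f : R -> R) : measurable_fun setT f ->
  mu.-integrable setT (EFin \o (fun x => f x * p x)) -> m.-integrable setT (EFin \o f).
Proof.
move=> mf /integrableP [_ h]; apply/integrableP; split; first exact/measurable_EFinP.
have := @ge0_integral_density (fun x => `|f x|) _ (fun x => normr_ge0 _).
rewrite /comp /= => ->; last exact: measurableT_comp.
by under eq_integral do rewrite -[p _](ger0_norm (p_ge0 _)) -normrM.
Qed.

Lemma Rintegral_density (f : R -> R) :
  m.-integrable setT (EFin \o f) ->
  \int[m]_x f x = \int[mu]_x (f x * p x).
Proof.
move=> fi; congr fine.
have mf : measurable_fun setT f by apply/measurable_EFinP; exact: measurable_int fi.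
rewrite -(Radon_Nikodym_change_of_variables dom measurableT fi).
apply: ae_eq_integral => //.
- apply: emeasurable_funM => //; first exact: measurable_int fi.
- by apply/measurable_EFinP; exact: measurable_funM.
- have h1 := RNp measurableT.
  have h2 := ae_eq_Radon_Nikodym_SigmaFinite dom (E := setT) measurableT.
  by apply: filterS2 h1 h2 => x /(_ I) e1 /(_ I) e2 _ /=; rewrite -e2 -/RN e1 EFinM.
Qed.

End density.

(** * The complex logarithmic kernel *)

Section log_kernel.
Context {R : realType}.
Local Notation C := R[i].
Local Notation Re := complex.Re.
Local Notation Im := complex.Im.
Local Notation mu := (@lebesgue_measure R).
Local Notation D := (`]0%R, +oo[%classic : set R).

(** The branch of log(-iz), z = x + iy, which is real on the positive imaginary
    axis; this form of the argument of y - ix is valid up to the real line. *)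
Definition lk (x y : R) : C :=
  Complex (ln (x ^+ 2 + y ^+ 2) / 2) (- 2 * atan (x / (Num.sqrt (x ^+ 2 + y ^+ 2) + y))).

(** 1/z, the derivative of log(-iz). *)
Definition zinv (x y : R) : C :=
  Complex (x / (x ^+ 2 + y ^+ 2)) (- y / (x ^+ 2 + y ^+ 2)).

Lemma sqD_gt0 (x y : R) : 0 < y -> 0 < x ^+ 2 + y ^+ 2.
Proof. by move=> y0; rewrite ltr_wpDl ?sqr_ge0 // exprn_gt0. Qed.

Lemma norm2_gt0 (x y : R) : x != 0 -> 0 < x ^+ 2 + y ^+ 2.
Proof. by move=> x0; rewrite ltr_pwDl ?sqr_ge0 // lt_neqAle sqr_ge0 eq_sym sqrf_eq0 x0. Qed.

Lemma holo_lk (x y : R) : 0 < y -> holo lk zinv x y.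
Proof.
move=> y0; have v0 := sqD_gt0 x y0.
have vn := lt0r_neq0 v0.
have r0 : 0 < Num.sqrt (x ^+ 2 + y ^+ 2) by rewrite sqrtr_gt0.
have rn := lt0r_neq0 r0.
have r2 : Num.sqrt (x ^+ 2 + y ^+ 2) ^+ 2 = x ^+ 2 + y ^+ 2 by rewrite sqr_sqrtr ?ltW.
have ry0 : 0 < Num.sqrt (x ^+ 2 + y ^+ 2) + y by rewrite addr_gt0.
have ryn := lt0r_neq0 ry0.
split; rewrite /lk /zinv /=.
- der => //; rewrite /=; by field.
- der => //; rewrite /=.
  move: (Num.sqrt _) r0 rn r2 ry0 ryn => r r0 rn r2 ry0 ryn.
  have y2 : y ^+ 2 = r ^+ 2 - x ^+ 2 by rewrite r2; ring.
  have xr : x ^+ 2 = (r - y) * (r + y) by rewrite -subr_sqr r2; ring.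
  rewrite -r2; have -> : 1 + (x / (r + y)) ^+ 2 = 2 * r / (r + y).
    by rewrite exprMn xr; field.
  rewrite (_ : - 2 * _ + _ = - (r + y) / r * ((r + y)^-1 - x ^+ 2 / r / (r + y) ^+ 2)).
    by rewrite xr; field; rewrite rn ryn.
  by field; rewrite rn ryn.
- der => //; rewrite /=; by field.
- der => //; rewrite /=.
  move: (Num.sqrt _) r0 rn r2 ry0 ryn => r r0 rn r2 ry0 ryn.
  have xr : x ^+ 2 = (r - y) * (r + y) by rewrite -subr_sqr r2; ring.
  rewrite -r2; have -> : 1 + (x / (r + y)) ^+ 2 = 2 * r / (r + y).
    by rewrite exprMn xr; field.
  by field; rewrite rn ryn.
Qed.

Lemma holo_zinv (x y : R) : 0 < y ->
  holo zinv (fun x y => - (zinv x y * zinv x y)) x y.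
Proof.
move=> y0; have v0 := sqD_gt0 x y0; have vn := lt0r_neq0 v0.
split; rewrite /zinv /=; der => //; rewrite /=; by field.
Qed.

(** Up to a constant, dominates log(-iz) in strips 0 <= y <= M: a square root
    absorbs the logarithm, at infinity as well as at 0. *)
Definition lbound (u : R) : R := Num.sqrt `|u| + 1 + (Num.sqrt `|u|)^-1.

Lemma lbound_ge1 (u : R) : 1 <= lbound u.
Proof.
by rewrite /lbound -addrA addrCA lerDl addr_ge0 ?invr_ge0 ?sqrtr_ge0.
Qed.

Lemma abs_ln_le (r : R) : 0 < r -> ln r <= 2 * Num.sqrt r /\ - ln r <= 2 * (Num.sqrt r)^-1.
Proof.
move=> r0; have s0 : 0 < Num.sqrt r by rewrite sqrtr_gt0.
have e : ln r = 2 * ln (Num.sqrt r).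
  by rewrite -{1}(sqr_sqrtr (ltW r0)) lnXn // mulr_natl.
have si0 : 0 < (Num.sqrt r)^-1 by rewrite invr_gt0.
split; first by rewrite e ler_pM2l // ltW // ln_sublinear.
by rewrite e -mulrN -lnV ?posrE // ler_pM2l // ltW // ln_sublinear.
Qed.

Lemma lk_le (M x y : R) : 0 <= M -> 0 <= y -> y <= M -> x != 0 ->
  `|Re (lk x y)| <= (2 * (M + 2)) * lbound x /\ `|Im (lk x y)| <= (2 * (M + 2) + 2 * pi) * lbound x.
Proof.
move=> M0 y0 yM x0; have ax0 : 0 < `|x| by rewrite normr_gt0.
have pi0 := pi_gt0 R.
have lb := lbound_ge1 x.
split; rewrite /lk /=.
  pose r := Num.sqrt (x ^+ 2 + y ^+ 2).
  have v0 := norm2_gt0 y x0.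
  have r0 : 0 < r by rewrite sqrtr_gt0.
  have r2 : r ^+ 2 = x ^+ 2 + y ^+ 2 by rewrite sqr_sqrtr // ltW.
  have -> : ln (x ^+ 2 + y ^+ 2) / 2 = ln r.
    by rewrite -r2 lnXn // mulr2n; field.
  have [h1 h2] := abs_ln_le r0.
  have xr : `|x| <= r.
    by rewrite -sqrtr_sqr ler_sqrt ?(ltW v0) // lerDl sqr_ge0.
  have rx : r <= `|x| + M.
    rewrite -(ler_sqr (x := r)) ?nnegrE ?(ltW r0) ?addr_ge0 // r2.
    rewrite sqrrD real_normK ?num_real // -addrA lerD2l.
    have : y ^+ 2 <= M ^+ 2 by rewrite ler_sqr ?nnegrE.
    by move=> /le_trans; apply; rewrite lerDr mulrn_wge0 // mulr_ge0.
  pose w := Num.sqrt `|x|.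
  have w0 : 0 < w by rewrite sqrtr_gt0.
  have w2 : w ^+ 2 = `|x| by rewrite sqr_sqrtr.
  have sr : Num.sqrt r <= w + M + 1.
    have q0 : 0 <= w + M + 1 by rewrite !addr_ge0 // ltW.
    rewrite -(ler_sqr (x := Num.sqrt r)) ?nnegrE ?sqrtr_ge0 // sqr_sqrtr ?(ltW r0) //.
    apply: le_trans rx _; rewrite -w2; move: w w0 {q0 w2} => w w0; nra.
  have sri : (Num.sqrt r)^-1 <= w^-1.
    by rewrite lef_pV2 ?posrE ?sqrtr_gt0 // ler_sqrt // ltW.
  have wi : 0 < w^-1 by rewrite invr_gt0.
  rewrite ler_norml /lbound -/w; apply/andP; split; last first.
    apply: le_trans h1 _; move: w w0 wi sr {w2 sri} => w w0 wi sr; nra.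
  rewrite lerNl; apply: le_trans h2 _; move: w w0 wi sri {w2 sr} => w w0 wi sri; nra.
have h : `|- 2 * atan (x / (Num.sqrt (x ^+ 2 + y ^+ 2) + y))| <= 2 * pi.
  rewrite ler_norml; have h1 := atan_ltpi2 (x / (Num.sqrt (x ^+ 2 + y ^+ 2) + y)).
  have h2 := atan_gtNpi2 (x / (Num.sqrt (x ^+ 2 + y ^+ 2) + y)).
  by apply/andP; split; lra.
apply: le_trans h _; rewrite -[leLHS]mulr1 ler_pM ?mulr_ge0 ?(ltW pi0) //.
by rewrite lerDr mulr_ge0 // addr_ge0.
Qed.

Lemma measurable_lk (y : R) : 0 <= y ->
  measurable_fun setT (fun x => Re (lk x y)) /\ measurable_fun setT (fun x => Im (lk x y)).
Proof.
move=> y0; have m2 : measurable_fun setT (fun x : R => x ^+ 2 + y ^+ 2).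
  by apply: measurable_funD => //; exact: exprn_measurable.
split; rewrite /lk /=.
  by apply: measurable_funM => //; apply: measurableT_comp m2; exact: measurable_ln.
apply: measurable_funM => //; apply: (@measurableT_comp _ _ _ _ _ _ atan).
  by apply: continuous_measurable_fun; exact: continuous_atan.
(* A power with exponent -1 in place of the inverse, for measurability. *)
rewrite (_ : (fun x => _) = (fun x => x * (Num.sqrt (x ^+ 2 + y ^+ 2) + y) `^ (- 1))).
  apply: measurable_funM => //; apply: (measurableT_comp (measurable_powR (- 1))).
  apply: measurable_funD => //; apply: (measurableT_comp _ m2).
  by apply: continuous_measurable_fun; exact: sqrt_continuous.
by apply/funext => x; rewrite powR_inv1 // addr_ge0 // sqrtr_ge0.
Qed.

Lemma lk_cvg (x y : R) (u w : nat -> R) : 0 < x ^+ 2 + y ^+ 2 -> 0 <= y ->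
  u n @[n --> \oo] --> x -> w n @[n --> \oo] --> y ->
  Re (lk (u n) (w n)) @[n --> \oo] --> Re (lk x y) /\
  Im (lk (u n) (w n)) @[n --> \oo] --> Im (lk x y).
Proof.
move=> v0 y0 ux wy.
have c1 : u n ^+ 2 + w n ^+ 2 @[n --> \oo] --> x ^+ 2 + y ^+ 2.
  by apply: cvgD; [exact: (cvgn_comp (f := fun z => z ^+ 2) (@exprn_continuous _ 2 x) ux)|
    exact: (cvgn_comp (f := fun z => z ^+ 2) (@exprn_continuous _ 2 y) wy)].
split; rewrite /lk /=.
  by apply: cvgMl; exact: (cvgn_comp (f := @ln R) (continuous_ln v0) c1).
apply: cvgMr; apply: (cvgn_comp (f := atan)); first exact: continuous_atan.
apply: cvgM => //; apply: cvgV.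
  by rewrite gt_eqF // ltr_pwDl // sqrtr_gt0.
by apply: cvgD => //; exact: (cvgn_comp (f := Num.sqrt) (@sqrt_continuous _ _) c1).
Qed.

(** The kernel bound times the decay 1/(1 + u^2) of the density. *)
Definition dominator (u : R) : R := lbound u / (1 + u ^+ 2).

Lemma dominator_ge0 (u : R) : 0 <= dominator u.
Proof.
have h := lbound_ge1 u; rewrite divr_ge0 //; first by apply: le_trans h.
by rewrite addr_ge0 // sqr_ge0.
Qed.

Lemma measurable_dominator : measurable_fun setT dominator.
Proof.
have ms : measurable_fun setT (fun u : R => Num.sqrt `|u|).
  apply: (@measurableT_comp _ _ _ _ _ _ (@Num.sqrt R)); last first.
    by apply: continuous_measurable_fun; exact: norm_continuous.
  by apply: continuous_measurable_fun; exact: sqrt_continuous.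
have iE (f : R -> R) : measurable_fun setT f -> (forall u, 0 <= f u) ->
    measurable_fun setT (fun u => (f u)^-1).
  move=> mf f0; rewrite (_ : (fun u => _) = (fun u => f u `^ (- 1))).
    exact: (measurableT_comp (measurable_powR (- 1))).
  by apply/funext => u; rewrite powR_inv1.
apply: measurable_funM.
  apply: measurable_funD; first exact: measurable_funD.
  by apply: iE => // u; exact: sqrtr_ge0.
apply: iE; last by move=> u; rewrite addr_ge0 // sqr_ge0.
by apply: measurable_funD => //; exact: exprn_measurable.
Qed.

(** On the positive half-line, by comparison with t^(a-1)/(1 + t^a)^2 for
    a = 1/2. *)
Lemma integrable_dominator : mu.-integrable setT (EFin \o dominator).
Proof.
have iD : mu.-integrable D (EFin \o dominator).
  have h2 : (0 : R) < 2^-1 by rewrite invr_gt0.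
  have mD : measurable (D : set (measurableTypeR R)) by exact: measurable_itv.
  apply: (@le_integrable_halfline _ _ _ _ _ (integrableZR mD 6 (integrable_powR_rational h2))).
    by apply: measurable_funTS; exact: measurable_dominator.
  move=> t t0; rewrite ger0_norm ?dominator_ge0 //.
  pose w := Num.sqrt t.
  have w0 : 0 < w by rewrite sqrtr_gt0.
  have w2 : t = w ^+ 2 by rewrite sqr_sqrtr // ltW.
  have -> : t `^ 2^-1 = w by rewrite powR12_sqrt // ltW.
  have -> : t `^ (2^-1 - 1) = w^-1.
    rewrite (_ : 2^-1 - 1 = - 2^-1); last by field.
    by rewrite powRN powR12_sqrt // ltW.
  rewrite /dominator /lbound (gtr0_norm t0) -/w w2.
  have q : 0 < 1 + (w ^+ 2) ^+ 2 by rewrite ltr_pwDl // sqr_ge0.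
  have q1 : 0 < 1 + w by rewrite addr_gt0.
  have -> : w + 1 + w^-1 = w^-1 * (w ^+ 2 + w + 1) by field; exact: lt0r_neq0.
  rewrite -mulrA [leRHS]mulrCA ler_wpM2l ?invr_ge0 ?(ltW w0) //.
  rewrite ler_pdivrMr // mulrAC ler_pdivlMr ?exprn_gt0 //.
  have w4 : 0 <= (w ^+ 2 - 1) ^+ 2 by exact: sqr_ge0.
  have p1 : w ^+ 2 + w + 1 <= 3 / 2 * (1 + w ^+ 2) by have := sqr_ge0 (w - 1); nra.
  have p2 : (1 + w) ^+ 2 <= 2 * (1 + w ^+ 2) by have := sqr_ge0 (w - 1); nra.
  have p3 : (1 + w ^+ 2) ^+ 2 <= 2 * (1 + (w ^+ 2) ^+ 2) by nra.
  have s0 : 0 <= 1 + w ^+ 2 by rewrite addr_ge0 // sqr_ge0.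
  apply: (@le_trans _ _ (3 / 2 * (1 + w ^+ 2) * (2 * (1 + w ^+ 2)))).
    by rewrite ler_pM // ?sqr_ge0 // addr_ge0 // addr_ge0 ?sqr_ge0 // ltW.
  by move: p3; rewrite expr2; lra.
have m0 : measurable_fun setT (EFin \o dominator).
  by apply/measurable_EFinP; exact: measurable_dominator.
have d0 x : (0 <= (EFin \o dominator) x)%E by rewrite lee_fin dominator_ge0.
apply/integrableP; split => //.
have aE (E : set (measurableTypeR R)) : (\int[mu]_(x in E) `|(EFin \o dominator) x| =
    \int[mu]_(x in E) (EFin \o dominator) x)%E.
  by apply: eq_integral => x _; rewrite gee0_abs.
have lt : (\int[mu]_(x in D) (EFin \o dominator) x < +oo)%E.
  by move/integrableP : iD => [_]; rewrite aE.
rewrite aE -(set_itvNyy R).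
rewrite (@itv_bndbnd_setU _ _ -oo%O (BRight 0) +oo%O) //.
rewrite ge0_integral_setU //=.
- rewrite lte_add_pinfty //.
  rewrite (_ : (\int[mu]_(x in `]-oo, 0%R]) _ = \int[mu]_(x in `[0%R, +oo[) (EFin \o dominator) x)%E).
    by rewrite -integral_itv_obnd_cbnd //; exact: measurable_funTS.
  rewrite ge0_integration_by_substitution0 //; apply: eq_integral => x _ /=.
  by rewrite /dominator /lbound normrN sqrrN.
- exact: measurable_funTS.
- by move=> x _; rewrite lee_fin dominator_ge0.
- rewrite disj_set2E; apply/eqP; rewrite -subset0 => x []/= /[!in_itv]/=.
  by rewrite leNgt andbT => /negP.
Qed.

End log_kernel.

(** * Potentials with a logarithmic singularity *)

Section potentials.
Context {R : realType}.
Local Notation C := R[i].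
Local Notation Re := complex.Re.
Local Notation Im := complex.Im.
Local Notation mu := (@lebesgue_measure R).
Local Notation T := (measurableTypeR R).
Variables (m : probability T R) (p : R -> R) (K : R).
Hypothesis mp : has_density m p.
Hypothesis p_ge0 : forall x, 0 <= p x.
Hypothesis cp : continuous p.
Hypothesis pK : forall x, p x <= K / (1 + x ^+ 2).

Let mp' : measurable_fun setT p. Proof. exact: continuous_measurable_fun. Qed.

Let K0 : 0 <= K.
Proof. by have := le_trans (p_ge0 0) (pK 0); rewrite expr0n /= addr0 divr1. Qed.

Let p_translate (M x t : R) : `|x| <= M -> p (t + x) <= 2 * K * (1 + M ^+ 2) / (1 + t ^+ 2).
Proof.
move=> xM; apply: le_trans (pK _) _.
have q1 : 0 < 1 + (t + x) ^+ 2 by rewrite ltr_pwDl ?sqr_ge0.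
have q2 : 0 < 1 + t ^+ 2 by rewrite ltr_pwDl ?sqr_ge0.
rewrite ler_pdivrMr // mulrAC ler_pdivlMr // [2 * K]mulrC -!mulrA ler_wpM2l //.
have x2 : x ^+ 2 <= M ^+ 2.
  by rewrite -(real_normK (num_real x)) ler_sqr ?nnegrE // (le_trans _ xM).
have s1 := sqr_ge0 (t + x + x); have s2 := sqr_ge0 x.
have s3 : 0 <= (M ^+ 2 - x ^+ 2) * (t + x) ^+ 2 by rewrite mulr_ge0 ?sqr_ge0 ?subr_ge0.
have s4 : 0 <= x ^+ 2 * (t + x) ^+ 2 by rewrite mulr_ge0 ?sqr_ge0.
nra.
Qed.

Let ae_neq0 (P : T -> Prop) : (forall t : R, t != 0 -> P t) -> \forall t \ae mu, P t.
Proof.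
move=> hP; exists [set 0]; split => //; first exact: lebesgue_measure_set1.
move=> t /= nPt; apply/eqP; apply: contraPT nPt => t0; apply; exact: hP.
Qed.

Section kernel.
Variable f : R -> R -> R.
Hypothesis mf : forall y : R, 0 <= y -> measurable_fun setT (f ^~ y).
Hypothesis bf : forall M : R, 0 <= M -> exists c : R, forall x y : R, 0 <= y -> y <= M -> x != 0 ->
  `|f x y| <= c * lbound x.
Hypothesis cf : forall (x y : R) (w : nat -> R), x != 0 -> 0 <= y -> (forall n, 0 <= w n) ->
  w n @[n --> \oo] --> y -> f x (w n) @[n --> \oo] --> f x y.

(** The integrand translated by x, which keeps the singularity at 0 and moves
    the parameter x into the continuous density. *)
Let g (x y t : R) : R := f (- t) y * p (t + x).

Let mg (x y : R) : 0 <= y -> measurable_fun setT (g x y).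
Proof.
move=> y0; apply: measurable_funM.
  apply: (measurableT_comp (mf y0)); by apply: continuous_measurable_fun; exact: opp_continuous.
by apply: (measurableT_comp mp'); exact: measurable_funD.
Qed.

Let g_cvg (x y : R) (u w : nat -> R) : 0 <= y -> (forall n, 0 <= w n) ->
  u n @[n --> \oo] --> x -> w n @[n --> \oo] --> y ->
  mu.-integrable setT (EFin \o g x y) /\
  \int[mu]_t g (u n) (w n) t @[n --> \oo] --> \int[mu]_t g x y t.
Proof.
move=> y0 w0 ux wy.
have bnd (v : nat -> R) (l : R) : v n @[n --> \oo] --> l -> exists2 M : R, 0 <= M & forall n, `|v n| <= M.
  move=> vl; have /cvg_seq_bounded [M [_ hM]] : cvgn v by apply/cvg_ex; exists l.
  exists (`|M| + 1) => [|n]; first by rewrite addr_ge0.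
  by apply: hM => //; rewrite (le_lt_trans (ler_norm M)) // ltrDl.
have [M1 M10 h1] := bnd _ _ ux.
have [M2 M20 h2] := bnd _ _ wy.
have [c hc] := bf M20.
pose B := 2 * K * (1 + M1 ^+ 2).
have B0 : 0 <= B by rewrite mulr_ge0 ?mulr_ge0 // addr_ge0 // sqr_ge0.
have di := integrableZR measurableT (c * B) integrable_dominator.
apply: (@cvg_Rintegral_dominated _ T _ mu setT (fun n => g (u n) (w n)) (g x y)
  (fun t => c * B * dominator t)) => //.
- by move=> n; apply: mg.
- exact: mg.
- apply: ae_neq0 => t t0 _; apply: cvgM.
    by apply: cf => //; rewrite oppr_eq0.
  have h : t + u n @[n --> \oo] --> t + x by apply: cvgD => //; exact: cvg_cst.
  exact: (cvgn_comp (@cp (t + x)) h).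
- apply: ae_neq0 => t t0 n _.
  rewrite /g normrM (ger0_norm (p_ge0 _)).
  have e1 : `|f (- t) (w n)| <= c * lbound t.
    have := hc (- t) (w n) (w0 n) (le_trans (ler_norm _) (h2 n)).
    by rewrite oppr_eq0 /lbound normrN; apply.
  apply: le_trans (ler_pM (normr_ge0 _) (p_ge0 _) e1 (p_translate t (h1 n))) _.
  by rewrite /dominator -/B le_eqVlt; apply/orP; left; apply/eqP; ring.
Qed.

Let mfx (x y : R) : 0 <= y -> measurable_fun setT (fun s : R => f (x - s) y).
Proof.
move=> y0; apply: (measurableT_comp (mf y0)).
by apply: measurable_funB.
Qed.

Let translate (x y : R) : 0 <= y -> (\int[mu]_s (f (x - s) y * p s)%:E = \int[mu]_t (g x y t)%:E)%E.
Proof.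
move=> y0; rewrite (@integral_translation _ x).
  by apply: eq_integral => t _; rewrite /g opprD addrCA subrr addr0.
by apply/measurable_EFinP; apply: measurable_funM => //; exact: mfx.
Qed.

Lemma potential_integrable (x y : R) : 0 <= y ->
  m.-integrable setT (EFin \o (fun s : R => f (x - s) y)).
Proof.
move=> y0.
have [gi _] := @g_cvg x y (fun=> x) (fun=> y) y0 (fun=> y0) (cvg_cst _) (cvg_cst _).
apply: (integrable_density mp p_ge0 mp'); first exact: mfx.
have mfp : measurable_fun setT (fun s : R => f (x - s) y * p s).
  by apply: measurable_funM => //; exact: mfx.
apply/integrableP; split; first exact/measurable_EFinP.
rewrite (@integral_translation _ x) /=.
  move/integrableP : gi => [_]; under eq_integral do rewrite /g /=.
  by under [in X in _ -> X]eq_integral do rewrite opprD addrCA subrr addr0.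
by apply/measurable_EFinP; exact: (@measurableT_comp _ _ _ _ _ _ (@Num.norm R R)).
Qed.

Lemma potential_cvg (x y : R) (u w : nat -> R) : 0 <= y -> (forall n, 0 <= w n) ->
  u n @[n --> \oo] --> x -> w n @[n --> \oo] --> y ->
  \int[m]_s f (u n - s) (w n) @[n --> \oo] --> \int[m]_s f (x - s) y.
Proof.
move=> y0 w0 ux wy.
have e (v z : R) : 0 <= z -> \int[m]_s f (v - s) z = \int[mu]_t g v z t.
  move=> z0; rewrite (Rintegral_density mp mp' (potential_integrable v z0)).
  by congr fine; exact: translate.
rewrite e //; under eq_fun do rewrite e //.
by have [_] := g_cvg y0 w0 ux wy.
Qed.

End kernel.

End potentials.

(** * The complex potential of the measure *)

(** Holomorphic in the upper half-plane; the real part is the logarithmic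
    potential. *)
HB.lock Definition Lam {R : realType} (m : probability (measurableTypeR R) R) (x y : R) : R[i] :=
  Cintegral m setT (fun s : R => lk (x - s) y).

Section log_potential.
Context {R : realType}.
Local Notation C := R[i].
Local Notation Re := complex.Re.
Local Notation Im := complex.Im.
Local Notation mu := (@lebesgue_measure R).
Local Notation T := (measurableTypeR R).
Variables (m : probability (measurableTypeR R) R) (p : R -> R) (K : R).
Hypothesis mp : has_density m p.
Hypothesis p_ge0 : forall x, 0 <= p x.
Hypothesis cp : continuous p.
Hypothesis pK : forall x, p x <= K / (1 + x ^+ 2).

Let mp' : measurable_fun setT p. Proof. exact: continuous_measurable_fun. Qed.

Let mfR (y : R) : 0 <= y -> measurable_fun setT (fun x : R => Re (lk x y)).
Proof. by move=> /measurable_lk []. Qed.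

Let mfI (y : R) : 0 <= y -> measurable_fun setT (fun x : R => Im (lk x y)).
Proof. by move=> /measurable_lk []. Qed.

Let bfR (M : R) : 0 <= M -> exists c : R, forall x y : R, 0 <= y -> y <= M -> x != 0 ->
  `|Re (lk x y)| <= c * lbound x.
Proof. by move=> M0; eexists => x y y0 yM x0; have [h _] := lk_le M0 y0 yM x0; exact: h. Qed.

Let bfI (M : R) : 0 <= M -> exists c : R, forall x y : R, 0 <= y -> y <= M -> x != 0 ->
  `|Im (lk x y)| <= c * lbound x.
Proof. by move=> M0; eexists => x y y0 yM x0; have [_ h] := lk_le M0 y0 yM x0; exact: h. Qed.

Let cfR (x y : R) (w : nat -> R) : x != 0 -> 0 <= y -> (forall n, 0 <= w n) ->
  w n @[n --> \oo] --> y -> Re (lk x (w n)) @[n --> \oo] --> Re (lk x y).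
Proof.
by move=> x0 y0 _ wy; have [] := lk_cvg (norm2_gt0 y x0) y0 (cvg_cst x) wy.
Qed.

Let cfI (x y : R) (w : nat -> R) : x != 0 -> 0 <= y -> (forall n, 0 <= w n) ->
  w n @[n --> \oo] --> y -> Im (lk x (w n)) @[n --> \oo] --> Im (lk x y).
Proof.
by move=> x0 y0 _ wy; have [] := lk_cvg (norm2_gt0 y x0) y0 (cvg_cst x) wy.
Qed.

Lemma integrable_lk (x y : R) : 0 <= y ->
  m.-integrable setT (EFin \o (fun s : R => Re (lk (x - s) y))) /\
  m.-integrable setT (EFin \o (fun s : R => Im (lk (x - s) y))).
Proof.
move=> y0; split.
  exact: (potential_integrable mp p_ge0 cp pK mfR bfR cfR x y0).
exact: (potential_integrable mp p_ge0 cp pK mfI bfI cfI x y0).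
Qed.

Local Notation Lam := (Lam m).

Lemma ReLam (x y : R) : Re (Lam x y) = \int[m]_s Re (lk (x - s) y).
Proof. by rewrite Lam.unlock. Qed.

Lemma ImLam (x y : R) : Im (Lam x y) = \int[m]_s Im (lk (x - s) y).
Proof. by rewrite Lam.unlock. Qed.

Lemma Lam_cvg (x y : R) (u w : nat -> R) : 0 <= y -> (forall n, 0 <= w n) ->
  u n @[n --> \oo] --> x -> w n @[n --> \oo] --> y ->
  Re (Lam (u n) (w n)) @[n --> \oo] --> Re (Lam x y) /\
  Im (Lam (u n) (w n)) @[n --> \oo] --> Im (Lam x y).
Proof.
move=> y0 w0 ux wy; rewrite Lam.unlock; split.
  exact: (potential_cvg mp p_ge0 cp pK mfR bfR cfR y0 w0 ux wy).
exact: (potential_cvg mp p_ge0 cp pK mfI bfI cfI y0 w0 ux wy).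
Qed.

Let holo_translate (f f' : R -> R -> C) (s x y : R) : holo f f' (x - s) y ->
  holo (fun x y => f (x - s) y) (fun x y => f' (x - s) y) x y.
Proof.
move=> [f1 f2 f3 f4].
have d := drv_add (drv_id x) (drv_cst x (- s)); rewrite addr0 in d.
split => //.
- apply: drv_eq (@drv_comp _ (fun t => Re (f t y)) (fun t => t - s) _ _ _ f1 d) _.
  by rewrite mulr1.
- apply: drv_eq (@drv_comp _ (fun t => Im (f t y)) (fun t => t - s) _ _ _ f2 d) _.
  by rewrite mulr1.
Qed.

Definition Lam' (x y : R) : C := Cintegral m setT (fun s : R => zinv (x - s) y).

Definition Lam'' (x y : R) : C :=
  Cintegral m setT (fun s : R => - (zinv (x - s) y * zinv (x - s) y)).

Let near_gt0 (y y' : R) : 0 < y -> `|y' - y| < y / 2 -> 0 < y / 2 /\ y / 2 < y'.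
Proof.
move=> y0; rewrite ltr_distl => /andP[h _]; split; first by rewrite divr_gt0.
by apply: le_lt_trans h; lra.
Qed.

(** |1/z| <= 1/y. *)
Let zinv_le (c x y : R) : 0 < c -> c <= y -> `|Re (zinv x y)| <= c^-1 /\ `|Im (zinv x y)| <= c^-1.
Proof.
move=> c0 cy; have y0 : 0 < y by exact: lt_le_trans cy.
have v0 := sqD_gt0 x y0.
rewrite /zinv /= !normrM normrN normfV (gtr0_norm v0).
rewrite !ler_pdivrMr // ![c^-1 * _]mulrC !ler_pdivlMr //.
have xx : `|x| ^+ 2 = x ^+ 2 by rewrite real_normK ?num_real.
have ax : 0 <= `|x| by [].
rewrite (gtr0_norm y0) -xx; have := sqr_ge0 (`|x| - y); split; nra.
Qed.

Let measurable_zinv (y : R) : 0 < y -> measurable_fun setT (fun x : R => Re (zinv x y)) /\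
  measurable_fun setT (fun x : R => Im (zinv x y)).
Proof.
move=> y0; split; apply: continuous_measurable_fun => x;
  have [h1 h2 _ _] := holo_zinv x y0; exact: drv_continuous.
Qed.

Let measurable_shift (f : R -> R) (x : R) : measurable_fun setT f ->
  measurable_fun setT (fun s : R => f (x - s)).
Proof. by move=> mf; apply: (measurableT_comp mf); exact: measurable_funB. Qed.

Lemma holo_Lam (x y : R) : 0 < y -> holo Lam Lam' x y.
Proof.
rewrite Lam.unlock => y0; have y20 : 0 < y / 2 by rewrite divr_gt0.
apply: (@holo_Cintegral _ _ T m setT (fun x y (s : R) => lk (x - s) y)
  (fun x y (s : R) => zinv (x - s) y) (fun=> (y / 2)^-1) _ _ _ measurableT y20).
- by apply: (measurable_shift (f := fun x => Im (zinv x y))); have [] := measurable_zinv y0.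
- by move=> u v _ /(near_gt0 y0) [h1 h2]; apply: integrable_lk; rewrite ltW // (lt_trans h1).
- move=> u v s _ /(near_gt0 y0) [h1 h2] _; apply: holo_translate.
  by apply: holo_lk; exact: lt_trans h2.
- exact: finite_measure_integrable_cst.
- by move=> u v s _ /(near_gt0 y0) [h1 /ltW h2] _; exact: zinv_le.
Qed.

Lemma holo_Lam' (x y : R) : 0 < y -> holo Lam' Lam'' x y.
Proof.
move=> y0; have y20 : 0 < y / 2 by rewrite divr_gt0.
apply: (@holo_Cintegral _ _ T m setT (fun x y (s : R) => zinv (x - s) y)
  (fun x y (s : R) => - (zinv (x - s) y * zinv (x - s) y))
  (fun=> 2 * ((y / 2)^-1 * (y / 2)^-1)) _ _ _ measurableT y20).
- have [m1 m2] := measurable_zinv y0.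
  apply: (measurable_shift (f := fun x => Im (- (zinv x y * zinv x y)))).
  rewrite (_ : (fun x => _) = (fun x => - (2 * (Re (zinv x y) * Im (zinv x y))))).
    by apply: measurableT_comp => //; apply: measurable_funM => //; exact: measurable_funM.
  by apply/funext => t; rewrite /=; ring.
- move=> u v _ /(near_gt0 y0) [h1 h2].
  have [m1 m2] := measurable_zinv (lt_trans h1 h2).
  have ci : m.-integrable setT (EFin \o (fun=> (y / 2)^-1)) by exact: finite_measure_integrable_cst.
  split.
    apply: (@le_integrableR _ T _ m setT _ _ measurableT (measurable_shift u m1) _ ci) => s _.
    by have [] := zinv_le (u - s) h1 (ltW h2).
  apply: (@le_integrableR _ T _ m setT _ _ measurableT (measurable_shift u m2) _ ci) => s _.
  by have [] := zinv_le (u - s) h1 (ltW h2).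
- move=> u v s _ /(near_gt0 y0) [h1 h2] _.
  apply: (holo_translate (f := zinv) (f' := fun x y => - (zinv x y * zinv x y))).
  by apply: holo_zinv; exact: lt_trans h2.
- exact: finite_measure_integrable_cst.
- move=> u v s _ /(near_gt0 y0) [h1 /ltW h2] _.
  have [] := zinv_le (u - s) h1 h2; case: (zinv (u - s) v) => A B /= hA hB.
  have hAA : `|A| * `|A| <= (y / 2)^-1 * (y / 2)^-1 by exact: ler_pM.
  have hAB : `|A| * `|B| <= (y / 2)^-1 * (y / 2)^-1 by exact: ler_pM.
  have hBB : `|B| * `|B| <= (y / 2)^-1 * (y / 2)^-1 by exact: ler_pM.
  rewrite !normrN; split.
    by apply: le_trans (ler_normB _ _) _; rewrite !normrM; lra.
  by apply: le_trans (ler_normD _ _) _; rewrite !normrM [`|B| * _]mulrC; lra.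
Qed.

Let RintT (c : R) : \int[m]_s c = c.
Proof. by rewrite /Rintegral integral_cst // [X in fine (_ * X)](@probability_setT _ T R m) mule1. Qed.

(** By (x - s)^2 + y^2 <= 2 (1 + x^2 + y^2) (1 + s^2). *)
Lemma Lam_le (x y : R) : 0 <= y ->
  Re (Lam x y) <= ln (1 + x ^+ 2 + y ^+ 2) / 2 + (ln 2 / 2 + Re (Lam 0 1)).
Proof.
move=> y0; have [i1 _] := integrable_lk x y0; have [i2 _] := integrable_lk 0 ler01.
have ic (c : R) : m.-integrable setT (EFin \o (fun=> c)) by exact: finite_measure_integrable_cst.
have q0 : 0 < 1 + x ^+ 2 + y ^+ 2 by rewrite -addrA ltr_pwDl // addr_ge0 ?sqr_ge0.
rewrite addrA -[X in X + _]RintT !ReLam -RintegralD //.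
apply: le_Rintegral => //; first exact: integrableDR.
move=> s _; rewrite /lk /= sub0r sqrrN expr1n.
have s0 : 0 < s ^+ 2 + 1 by rewrite ltr_wpDl ?sqr_ge0.
rewrite -!mulrDl ler_pM2r ?invr_gt0 // -!lnM ?posrE ?mulr_gt0 //.
have [v0|v0] := ltP 0 ((x - s) ^+ 2 + y ^+ 2).
  rewrite ler_ln ?posrE ?mulr_gt0 //.
  have := sqr_ge0 (x + s); have := sqr_ge0 (x * s); have := sqr_ge0 (y * s); have := sqr_ge0 y.
  nra.
rewrite ln0 // ln_ge0 //.
have := sqr_ge0 x; have := sqr_ge0 (x * s); have := sqr_ge0 (y * s); have := sqr_ge0 y.
have := sqr_ge0 s; nra.
Qed.

(** The integrand minus log y is log(1 + (x - s)^2/y^2)/2, which tends to 0 and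
    decreases with y, so that its value at y = 1 dominates. *)
Lemma Lam_asymptotic (x : R) : Re (Lam x n.+1%:R) - ln n.+1%:R @[n --> \oo] --> (0 : R).
Proof.
have n1 (n : nat) : 1 <= n.+1%:R :> R by rewrite ler1n.
have n0 (n : nat) : 0 < n.+1%:R :> R by rewrite ltr0n.
have ic (c : R) : m.-integrable setT (EFin \o (fun=> c)) by exact: finite_measure_integrable_cst.
have [i1 _] := integrable_lk x ler01.
pose f (n : nat) (s : R) := Re (lk (x - s) n.+1%:R) - ln n.+1%:R.
have fi n : m.-integrable setT (EFin \o f n).
  have [i _] := integrable_lk x (ltW (n0 n)); exact: (integrableBR measurableT i (ic _)).
have e n : Re (Lam x n.+1%:R) - ln n.+1%:R = \int[m]_s f n s.
  have [i _] := integrable_lk x (ltW (n0 n)).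
  by rewrite RintegralB // RintT ReLam.
have fE n s : f n s = ln (1 + ((x - s) * n.+1%:R^-1) ^+ 2) / 2.
  have q : 0 < 1 + ((x - s) * n.+1%:R^-1) ^+ 2 by rewrite ltr_pwDl ?sqr_ge0.
  rewrite /f /lk /= (_ : _ + _ = (1 + ((x - s) * n.+1%:R^-1) ^+ 2) * n.+1%:R ^+ 2).
    by rewrite lnM ?posrE ?exprn_gt0 // lnXn // mulr2n; field.
  by field; exact: lt0r_neq0.
under eq_fun do rewrite e.
suff : \int[m]_s f n s @[n --> \oo] --> \int[m]_s (0 : R) by rewrite RintT.
have [||||_ //] := @cvg_Rintegral_dominated _ T _ m setT f (fun=> 0) _ measurableT _ _ _ i1 _.
- by move=> n; apply/measurable_EFinP; exact: measurable_int (fi n).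
- exact: measurable_cst.
- apply: aeW => s _; under eq_fun do rewrite fE.
  have h : 1 + ((x - s) * n.+1%:R^-1) ^+ 2 @[n --> \oo] --> (1 : R).
    have c0 : (x - s) * n.+1%:R^-1 @[n --> \oo] --> (x - s) * (0 : R).
      by apply: cvgMr; exact: cvg_harmonic.
    have := cvgn_comp (f := fun z => 1 + z ^+ 2) _ c0.
    rewrite mulr0 expr0n /= addr0; apply.
    by apply: cvgD; [exact: cvg_cst|exact: exprn_continuous].
  rewrite -(mul0r (2^-1 : R)) -(ln1 R); apply: cvgMl.
  exact: (cvgn_comp (f := @ln R) (continuous_ln ltr01) h).
- apply: aeW => s n _; rewrite fE /lk /= expr1n [1 + _]addrC.
  have q : 1 <= ((x - s) * n.+1%:R^-1) ^+ 2 + 1 by rewrite lerDr sqr_ge0.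
  rewrite ger0_norm ?divr_ge0 ?ln_ge0 // ler_pM2r ?invr_gt0 //.
  rewrite ler_ln ?posrE ?(lt_le_trans ltr01 q) ?ltr_wpDl ?sqr_ge0 // lerD2r.
  rewrite exprMn ler_piMr ?sqr_ge0 // exprn_ile1 ?invr_ge0 ?(ltW (n0 n)) //.
  by rewrite invf_le1.
Qed.

(** On the real line the phase is pi/2 - pi times the distribution function. *)
Lemma is_derive_ImLam (x : R) : is_derive x 1 (fun x => Im (Lam x 0)) (- pi * p x).
Proof.
have pi_int : mu.-integrable setT (EFin \o p).
  apply/integrableP; split; first exact/measurable_EFinP.
  under eq_integral do rewrite /= ger0_norm //.
  rewrite -(mp measurableT); apply: le_lt_trans (probability_le1 m measurableT) _.
  exact: ltry.
pose P (x : R) := \int[mu]_(t in `]-oo, x]) p t.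
have dP : is_derive x 1 P (p x).
  have x1 : x < x + 1 by rewrite ltrDl.
  have [|||d e] := @continuous_FTC1 R p -oo%O x (x + 1) x1 _.
  - by apply: integrableS pi_int => //; exact: measurable_itv.
  - by rewrite ltNyr.
  - exact: cp.
  by apply: DeriveDef; [exact: d|rewrite -derive1E; exact: e].
have E (z : R) : Im (Lam z 0) = pi / 2 - pi * P z.
  have mI : measurable (`]-oo, z] : set T) by exact: measurable_itv.
  have ii : m.-integrable setT (EFin \o (\1_(`]-oo, z] : set T) : R -> R)).
    apply: integrable_indic => //.
  have ic : m.-integrable setT (EFin \o (fun=> pi / 2 : R)) by exact: finite_measure_integrable_cst.
  rewrite ImLam; transitivity (\int[m]_s (pi / 2 - pi * \1_(`]-oo, z] : set T) s)).
    congr fine; apply: ae_eq_integral => //.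
    - exact: measurable_int (integrable_lk z (lexx 0)).2.
    - exact: measurable_int (integrableBR measurableT ic (integrableZR measurableT pi ii)).
    exists [set z]; split => //.
      rewrite mp //; apply: null_set_integral => //.
        by apply/measurable_EFinP; exact: measurable_funTS.
      exact: lebesgue_measure_set1.
    move=> s /= ns; apply: contra_notP ns => sz _; congr EFin.
    rewrite /lk /= expr0n /= !addr0 sqrtr_sqr indicE.
    have [zs|zs] := ltP z s.
      rewrite memNset /=; last by rewrite in_itv /= leNgt zs.
      rewrite ltr0_norm ?subr_lt0 // invrN mulrN divff; last by rewrite subr_eq0 lt_eqF.
      by rewrite atanN atan1; field.
    have {}zs : s < z by rewrite lt_neqAle zs andbT; apply/eqP.
    rewrite mem_set /=; last by rewrite in_itv /= ltW.
    rewrite gtr0_norm ?subr_gt0 // divff; last by rewrite subr_eq0 gt_eqF.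
    by rewrite atan1; field.
  rewrite (RintegralB measurableT ic (integrableZR measurableT pi ii)) RintT; congr (_ - _).
  rewrite (RintegralZl _ measurableT ii) ; congr (_ * fine _).
  by rewrite integral_indic // setIT mp.
notypeclasses refine (drv_ext E _); der; ring.
Qed.

End log_potential.

(** * The maximum principle and the Phragmen-Lindelof principle *)

Section maximum_principle.
Context {R : realType}.
Local Notation C := R[i].
Local Notation Re := complex.Re.
Local Notation Im := complex.Im.

(** Otherwise f1, which vanishes at x, would be positive on the right of x, and f
    would increase there. *)
Lemma second_derivative_le0 (f f1 : R -> R) (f2 x e : R) : 0 < e ->
  (forall t : R, `|t - x| < e -> is_derive t 1 f (f1 t)) -> is_derive x 1 f1 f2 ->
  (forall t : R, `|t - x| < e -> f t <= f x) -> f2 <= 0.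
Proof.
move=> e0 df df1 fx; rewrite leNgt; apply/negP => f20.
have f1x : f1 x = 0.
  have h : is_derive x 1 f 0.
    apply: (@derive1_at_max _ f (x - e) (x + e)).
    - by rewrite lerD2l (le_trans _ (ltW e0)) // oppr_le0 ltW.
    - by move=> t; rewrite in_itv /= -ltr_distl => /df [].
    - by rewrite in_itv /= -ltr_distl subrr normr0.
    - by move=> t; rewrite in_itv /= -ltr_distl => /fx.
  have := df x; rewrite subrr normr0 => /(_ e0) h'.
  by rewrite -(@derive_val _ _ _ _ _ _ _ h') (@derive_val _ _ _ _ _ _ _ h).
have [d1 e1] := df1.
have cv : h^-1 *: (f1 (h + x) - f1 x) @[h --> 0^'] --> f2.
  rewrite -e1 /derive; have := d1; rewrite /derivable; under eq_fun do rewrite /= [_%:A]mulr1.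
  by [].
have hnear : nbhs (0 : R) (fun h : R => h != 0 -> 0 < h^-1 *: (f1 (h + x) - f1 x)).
  exact: cvgr_gt _ cv _ f20.
have [d /= d0 hd] := (nbhs_ballP _ _).1 hnear.
pose r := Num.min d e / 2.
have m0 : 0 < Num.min d e by rewrite lt_min d0.
have r0 : 0 < r by rewrite divr_gt0.
have [rd re] : r < d /\ r < e.
  have h : r < Num.min d e by rewrite /r; lra.
  by move: h; rewrite lt_min => /andP.
have df' t : `]x, (x + r)[%classic t -> is_derive t 1 f (f1 t).
  rewrite /= in_itv /= => /andP[xt tr]; apply: df.
  by rewrite ger0_norm ?subr_ge0 ?(ltW xt) // ltrBlDl (lt_trans tr) // ltrD2l.
have xr : x < x + r by rewrite ltrDl.
have cf : {within `[x, (x + r)], continuous f}.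
  apply: continuous_in_subspaceT => t; rewrite inE /= in_itv /= => /andP[xt tr].
  apply: (drv_continuous (df t _)).
  by rewrite ger0_norm ?subr_ge0 // ltrBlDl (le_lt_trans tr) // ltrD2l.
have [c + e2] := MVT xr df' cf; rewrite in_itv /= => /andP[xc cr].
have c0 : 0 < c - x by rewrite subr_gt0.
have := hd (c - x); rewrite /ball /= sub0r normrN (gtr0_norm c0) gt_eqF // subrK f1x subr0.
have cd : c - x < d by rewrite ltrBlDl (lt_trans cr) // ltrD2l.
move=> /(_ cd isT); rewrite /GRing.scale /= pmulr_rgt0 ?invr_gt0 // => f1c.
have := fx (x + r); rewrite [x + r - x]addrC addKr (gtr0_norm r0) => /(_ re).
rewrite -subr_le0 e2 [x + r - x]addrC addKr; apply/negP; rewrite -ltNge.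
exact: mulr_gt0.
Qed.

Lemma continuous_pair_seq (f : R -> R -> R) (x y : R) :
  (forall u w : nat -> R, u n @[n --> \oo] --> x -> w n @[n --> \oo] --> y ->
     f (u n) (w n) @[n --> \oo] --> f x y) ->
  {for (x, y), continuous (fun z : R * R => f z.1 z.2)}.
Proof.
move=> hf; apply/cvgrPdist_lt => /= e e0; apply: contrapT => h.
have /boolp.choice [z hz] : forall n : nat, exists z : R * R,
    ball ((x, y) : R * R) n.+1%:R^-1 z /\ e <= `|f x y - f z.1 z.2|.
  move=> n; apply: contrapT => hn; apply: h.
  apply: (nbhs_ballP ((x, y) : R * R) _).2; exists n.+1%:R^-1; first by rewrite /= invr_gt0 ltr0n.
  move=> z bz /=; rewrite ltNge; apply/negP => ez; apply: hn; by exists z.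
have cv (v : nat -> R) (l : R) : (forall n : nat, `|l - v n| < n.+1%:R^-1) -> v n @[n --> \oo] --> l.
  move=> hv; apply/cvgrPdist_lt => r r0.
  have [N _ hN] := cvgr_lt (0 : R) (@cvg_harmonic R) r r0.
  by exists N => // n Nn /=; apply: lt_trans (hv n) _; exact: hN.
have c1 : (z n).1 @[n --> \oo] --> x by apply: cv => n; have [[b1 _] _] := hz n.
have c2 : (z n).2 @[n --> \oo] --> y by apply: cv => n; have [[_ b2] _] := hz n.
have /cvgrPdist_lt /(_ e e0) [N _ hN] := hf _ _ c1 c2.
have [_] := hz N; rewrite leNgt => /negP; apply; exact: (hN N (leqnn N)).
Qed.

(** Twice complex differentiable in the open upper half-plane, which is what the
    harmonicity of the real part requires. *)
Definition holo2 (V : R -> R -> C) := exists V' V'', forall x y : R, 0 < y ->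
  holo V V' x y /\ holo V' V'' x y.

Lemma holo2_cst (c : C) : holo2 (fun _ _ => c).
Proof. by exists (fun _ _ => 0), (fun _ _ => 0) => x y _; split; exact: holo_cst. Qed.

Lemma holo2_add V W : holo2 V -> holo2 W -> holo2 (fun x y => V x y + W x y).
Proof.
move=> [V1 [V2 hV]] [W1 [W2 hW]]; eexists; eexists => x y y0.
have [h1 h2] := hV x y y0; have [h3 h4] := hW x y y0.
by split; [exact: (holo_add h1 h3)|exact: (holo_add h2 h4)].
Qed.

Lemma holo2_mul V W : holo2 V -> holo2 W -> holo2 (fun x y => V x y * W x y).
Proof.
move=> [V1 [V2 hV]] [W1 [W2 hW]]; eexists; eexists => x y y0.
have [h1 h2] := hV x y y0; have [h3 h4] := hW x y y0; split; first exact: (holo_mul h1 h3).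
exact: (holo_add (holo_mul h2 h3) (holo_mul h1 h4)).
Qed.

Lemma holo2_cexp V : holo2 V -> holo2 (fun x y => cexp (V x y)).
Proof.
move=> [V1 [V2 hV]]; eexists; eexists => x y y0.
have [h1 h2] := hV x y y0; split; first exact: (holo_cexp h1).
exact: (holo_mul h2 (holo_cexp h1)).
Qed.

Definition closed_continuous (V : R -> R -> C) := forall (x y : R) (u w : nat -> R),
  0 <= y -> (forall n, 0 <= w n) -> u n @[n --> \oo] --> x -> w n @[n --> \oo] --> y ->
  Re (V (u n) (w n)) @[n --> \oo] --> Re (V x y).

(** If the real part were positive somewhere, its sum with a small multiple
    d x^2 would have an interior maximum, where the sum of the second
    derivatives, which is 2d > 0, cannot be positive. *)
Lemma maximum_principle (V : R -> R -> C) (r : R) : 0 < r -> holo2 V -> closed_continuous V ->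
  (forall x y, - r <= x <= r -> 0 <= y <= r -> [|| y == 0, y == r, x == r | x == - r] ->
     Re (V x y) <= 0) ->
  forall x y, - r <= x <= r -> 0 <= y <= r -> Re (V x y) <= 0.
Proof.
move=> r0 [V1 [V2 hV]] cV bV x0 y0 x0r y0r; rewrite leNgt; apply/negP => v0.
pose v := Re (V x0 y0); pose d := v / (2 * r ^+ 2).
(* With this d, the term d x^2 stays below v on the rectangle. *)
have rr0 : 0 < r ^+ 2 by rewrite exprn_gt0.
have d0 : 0 < d by rewrite divr_gt0 // mulr_gt0.
have dr : d * r ^+ 2 < v.
  by rewrite /d -mulrA invfM mulrAC -mulrA divff ?gt_eqF // mulr1 ltr_pdivrMr // ltr_pMr // ltr1n.
pose f (x y : R) := Re (V x (Num.max y 0)) + d * x ^+ 2.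
have cf : continuous (fun z : R * R => f z.1 z.2).
  move=> [x y]; apply: continuous_pair_seq => u w ux wy; apply: cvgD.
    apply: cV => //; first by rewrite le_max lexx orbT.
      by move=> n; rewrite le_max lexx orbT.
    apply: (cvgn_comp (f := fun z => Num.max z 0) _ wy).
    by apply: continuous_max; [exact: cvg_id|exact: cvg_cst].
  by apply: cvgMr; exact: (cvgn_comp (f := fun z => z ^+ 2) (@exprn_continuous _ 2 x) ux).
pose A : set (R * R) := `[- r, r]%classic `*` `[0, r]%classic.
have A0 : A (x0, y0) by rewrite /A /= !in_itv.
have kA : compact A by apply: compact_setX; exact: segment_compact.
have [[x y]] := compact_EVT_max (ex_intro _ _ A0) kA (continuous_subspaceT cf).
rewrite inE /A /= !in_itv /= => -[xr yr] hm.
have fE (s t : R) : 0 <= t -> f s t = Re (V s t) + d * s ^+ 2 by move=> t0; rewrite /f max_l.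
have hmax (s t : R) : - r <= s <= r -> 0 <= t <= r ->
    Re (V s t) + d * s ^+ 2 <= Re (V x y) + d * x ^+ 2.
  move=> sr tr; have /andP[t0 _] := tr; have /andP[yy0 _] := yr.
  rewrite -(fE s t t0) -(fE x y yy0); apply: (hm (s, t)).
  by rewrite inE /A /= !in_itv.
have hin : ~~ [|| y == 0, y == r, x == r | x == - r].
  apply/negP => /(bV x y xr yr) hb.
  have := hmax x0 y0 x0r y0r; apply/negP; rewrite -ltNge.
  apply: (@lt_le_trans _ _ v); last by rewrite lerDl mulr_ge0 ?(ltW d0) ?sqr_ge0.
  apply: le_lt_trans dr; rewrite -[leRHS]add0r lerD // ler_pM2l //.
  by rewrite -(real_normK (num_real x)) ler_sqr ?nnegrE ?(ltW r0) // ler_norml.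
move: hin; rewrite !negb_or => /and4P[y1 y2 x1 x2].
have {}x1 : x < r by rewrite lt_neqAle x1; case/andP: xr.
have {}x2 : - r < x by rewrite lt_neqAle eq_sym x2; case/andP: xr.
have {}y1 : 0 < y by rewrite lt_neqAle eq_sym y1; case/andP: yr.
have {}y2 : y < r by rewrite lt_neqAle y2; case/andP: yr.
have hx : Re (V2 x y) + 2 * d <= 0.
  have e0 : 0 < Num.min (r - x) (x + r) by rewrite lt_min subr_gt0 x1 -ltrBlDr sub0r x2.
  apply: (second_derivative_le0 (f := fun s => Re (V s y) + d * s ^+ 2)
    (f1 := fun s => Re (V1 s y) + 2 * d * s) (x := x) e0).
  - by move=> t _; have [[h _ _ _] _] := hV t y y1; der; rewrite /=; ring.
  - by have [_ [h _ _ _]] := hV x y y1; der; ring.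
  - move=> t; rewrite lt_min !ltr_distl => /andP[/andP[_ h1] /andP[h2 _]].
    by apply: hmax => //; rewrite ?(ltW y1) ?(ltW y2) //; apply/andP; split; lra.
have hy : - Re (V2 x y) <= 0.
  have e0 : 0 < Num.min (r - y) y by rewrite lt_min subr_gt0 y1 y2.
  apply: (second_derivative_le0 (f := fun s => Re (V x s))
    (f1 := fun s => - Im (V1 x s)) (x := y) e0).
  - move=> t; rewrite lt_min !ltr_distl => /andP[_ /andP[h2 _]].
    have t0 : 0 < t by lra.
    by have [[_ _ h _] _] := hV x t t0.
  - by have [_ [_ _ _ h]] := hV x y y1; der.
  - move=> t; rewrite lt_min !ltr_distl => /andP[/andP[_ h1] /andP[h2 _]].
    have := hmax x t xr; rewrite lerD2r; apply; apply/andP; split; lra.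
by move: hx hy d0; lra.
Qed.

End maximum_principle.

Section phragmen_lindelof.
Context {R : realType}.
Local Notation C := R[i].
Local Notation Re := complex.Re.
Local Notation Im := complex.Im.

(** The function (-i(z + i))^g; the shift by i moves the branch point away from
    the closed upper half-plane. *)
Definition barrier (g x y : R) : C := cexp (Complex g 0 * lk x (y + 1)).

Lemma holo2_barrier (g : R) : holo2 (barrier g).
Proof.
apply: holo2_cexp; apply: holo2_mul; first exact: holo2_cst.
eexists; eexists => x y y0; have y10 : 0 < y + 1 by rewrite addr_gt0.
by split; [exact: (holo_shift (holo_lk x y10))|exact: (holo_shift (holo_zinv x y10))].
Qed.

Lemma ReM_real (g : R) (z : C) : Re (Complex g 0 * z) = g * Re z.
Proof. by rewrite ReM /= mul0r subr0. Qed.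

Lemma ImM_real (g : R) (z : C) : Im (Complex g 0 * z) = g * Im z.
Proof. by rewrite ImM /= mul0r addr0. Qed.

Lemma Re_barrier (g x y : R) :
  Re (barrier g x y) = expR (g * Re (lk x (y + 1))) * cos (g * Im (lk x (y + 1))).
Proof. by rewrite -ReM_real -ImM_real. Qed.

Lemma barrier_continuous (g : R) : closed_continuous (barrier g).
Proof.
move=> x y u w y0 w0 ux wy.
have y10 : 0 < y + 1 by rewrite ltr_wpDl.
have wy1 : w n + 1 @[n --> \oo] --> y + 1 by apply: cvgD => //; exact: cvg_cst.
have [c1 c2] := lk_cvg (sqD_gt0 x y10) (ltW y10) ux wy1.
rewrite Re_barrier; under eq_fun do rewrite Re_barrier.
apply: cvgM.
  by apply: (cvgn_comp (f := expR)); [exact: continuous_expR|exact: cvgMr].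
by apply: (cvgn_comp (f := cos)); [exact: continuous_cos|exact: cvgMr].
Qed.

(** The argument of -i(z + i) is at most pi/2 in absolute value. *)
Lemma barrier_ge (g x y : R) : 0 < g -> g < 1 -> 0 <= y ->
  cos (g * (pi / 2)) * (1 + x ^+ 2 + y ^+ 2) `^ (g / 2) <= Re (barrier g x y).
Proof.
move=> g0 g1 y0; have y10 : 0 < y + 1 by rewrite ltr_wpDl.
have pi0 := pi_gt0 R.
have v0 := sqD_gt0 x y10.
have q0 : 0 < 1 + x ^+ 2 + y ^+ 2 by rewrite -addrA ltr_pwDl // addr_ge0 ?sqr_ge0.
have k0 : 0 < cos (g * (pi / 2)).
  by apply: cos_gt0_pihalf; apply/andP; split; nra.
rewrite Re_barrier mulrC.
apply: ler_pM; rewrite ?powR_ge0 ?(ltW k0) //.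
  rewrite /powR gt_eqF // ler_expR /lk /= -mulrA ler_pM2l // mulrC ler_pM2r ?invr_gt0 //.
  by rewrite ler_ln ?posrE //; nra.
pose t := x / (Num.sqrt (x ^+ 2 + (y + 1) ^+ 2) + (y + 1)).
have rt : `|t| <= 1.
  have s0 : 0 < Num.sqrt (x ^+ 2 + (y + 1) ^+ 2) + (y + 1) by rewrite ltr_wpDl ?sqrtr_ge0.
  rewrite normrM normfV (gtr0_norm s0) ler_pdivrMr // mul1r.
  by rewrite ler_wpDr ?(ltW y10) // -sqrtr_sqr ler_sqrt ?(ltW v0) // lerDl sqr_ge0.
have ht : `|g * Im (lk x (y + 1))| <= g * (pi / 2).
  rewrite normrM (gtr0_norm g0) ler_pM2l // /lk /= -/t normrM normrN [`|2|]gtr0_norm //.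
  move: rt; rewrite ler_norml => /andP[t1 t2].
  have := le_atan t1; have := le_atan t2; rewrite atanN atan1 => h1 h2.
  have : `|atan t| <= pi / 4 by rewrite ler_norml h1 h2.
  lra.
rewrite -[leRHS]cos_norm; move: ht; rewrite le_eqVlt => /predU1P[->//|ht].
by rewrite ltW // ltr_cos // in_itv /=; apply/andP; split => //; try nra; apply: ltW; nra.
Qed.

(** A harmonic function of growth exponent less than 1 in the half-plane is
    dominated by small multiples of the barrier on large rectangles. *)
Lemma phragmen_lindelof (V : R -> R -> C) (b K : R) : 0 <= b -> b < 1 -> 0 <= K ->
  holo2 V -> closed_continuous V -> (forall x, Re (V x 0) <= 0) ->
  (forall x y, 0 <= y -> Re (V x y) ^+ 2 <= K * (1 + x ^+ 2 + y ^+ 2) `^ b) ->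
  forall x y, 0 <= y -> Re (V x y) <= 0.
Proof.
move=> b0 b1 K0 hV cV V0 VK x0 y0 y00; rewrite leNgt; apply/negP => v0.
(* Any exponent strictly between b and 1 would do. *)
pose g := (b + 1) / 2.
have g0 : 0 < g by rewrite /g; lra.
have g1 : g < 1 by rewrite /g; lra.
have bg : 0 < g - b by rewrite /g; lra.
have pi0 := pi_gt0 R.
have q0 (x y : R) : 0 < 1 + x ^+ 2 + y ^+ 2 by rewrite -addrA ltr_pwDl // addr_ge0 ?sqr_ge0.
pose k := cos (g * (pi / 2)).
have k0 : 0 < k by apply: cos_gt0_pihalf; apply/andP; split; nra.
have H0 (x y : R) : 0 <= y -> 0 < Re (barrier g x y).
  by move=> yy; apply: lt_le_trans (barrier_ge x g0 g1 yy); rewrite mulr_gt0 // powR_gt0.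
(* With this e, the difference W below is half of V at the given point. *)
pose e := Re (V x0 y0) / (2 * Re (barrier g x0 y0)).
have e0 : 0 < e by rewrite divr_gt0 // mulr_gt0 ?H0.
pose W x y : C := V x y + Complex (- e) 0 * barrier g x y.
have WE x y : Re (W x y) = Re (V x y) - e * Re (barrier g x y) by rewrite /W ReD ReM_real mulNr.
have hW : holo2 W.
  by apply: holo2_add => //; apply: holo2_mul; [exact: holo2_cst|exact: holo2_barrier].
have cW : closed_continuous W.
  move=> x y u w yy w0 ux wy; rewrite WE; under eq_fun do rewrite WE.
  by apply: cvgB; [exact: cV|apply: cvgMr; exact: barrier_continuous].
pose B := K / (e * k) ^+ 2.
have B0 : 0 <= B by rewrite divr_ge0 // sqr_ge0.
(* The rectangle contains the given point, and q^(g - b) exceeds B on its far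
   sides. *)
pose r := `|x0| + y0 + B `^ (g - b)^-1 + 1.
have r1 : 1 <= r by rewrite /r lerDr !addr_ge0 ?powR_ge0.
have r0 : 0 < r by exact: lt_le_trans r1.
have rB : B `^ (g - b)^-1 <= r by rewrite /r; have := normr_ge0 x0; lra.
have far (x y : R) : 0 <= y -> r ^+ 2 <= x ^+ 2 + y ^+ 2 -> Re (W x y) <= 0.
  move=> yy rxy; rewrite WE subr_le0; pose q := 1 + x ^+ 2 + y ^+ 2.
  have qq : 0 < q by exact: q0.
  have rq : r <= q.
    by apply: (@le_trans _ _ (r ^+ 2)); rewrite ?ler_eXnr // /q -addrA ler_wpDl.
  have Bq : B <= q `^ (g - b).
    have := @ge0_ler_powR _ (g - b) (ltW bg) (B `^ (g - b)^-1) q.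
    rewrite !nnegrE powR_ge0 (ltW qq) (le_trans rB rq) => /(_ isT isT isT).
    by rewrite -powRrM mulVf ?gt_eqF // powRr1.
  have ek0 : 0 < e * k by rewrite mulr_gt0.
  apply: (@le_trans _ _ (e * k * q `^ (g / 2))); last first.
    by rewrite -mulrA ler_pM2l // barrier_ge.
  have rhs0 : 0 <= e * k * q `^ (g / 2) by rewrite mulr_ge0 ?powR_ge0 // ltW.
  have [vn|/ltW vp] := leP (Re (V x y)) 0; first exact: le_trans rhs0.
  have sq : (q `^ (g / 2)) ^+ 2 = q `^ g by rewrite -powR_mulrn ?powR_ge0 // -powRrM divfK.
  rewrite -ler_sqr ?nnegrE // exprMn sq.
  apply: le_trans (VK x y yy) _; rewrite -/q.
  have -> : q `^ g = q `^ b * q `^ (g - b).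
    by rewrite -powRD ?(gt_eqF qq) ?implybT //; congr (_ `^ _); ring.
  rewrite mulrCA mulrC ler_wpM2l ?powR_ge0 //.
  by rewrite mulrC -ler_pdivrMr // exprn_gt0.
have bW (x y : R) : - r <= x <= r -> 0 <= y <= r -> [|| y == 0, y == r, x == r | x == - r] ->
    Re (W x y) <= 0.
  move=> xr /andP[yy yr] /or4P[] /eqP h.
  - by rewrite WE h subr_le0 (le_trans (V0 x)) // mulr_ge0 ?(ltW e0) // ltW // H0.
  - by apply: far => //; rewrite h lerDr sqr_ge0.
  - by apply: far => //; rewrite h lerDl sqr_ge0.
  - by apply: far => //; rewrite h sqrrN lerDl sqr_ge0.
have h := maximum_principle r0 hW cW bW (x := x0) (y := y0).
have x0r : - r <= x0 <= r.
  by rewrite -ler_norml /r; have := powR_ge0 B (g - b)^-1; lra.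
have y0r : 0 <= y0 <= r.
  by rewrite y00 /r; have := powR_ge0 B (g - b)^-1; have := normr_ge0 x0; lra.
have := h x0r y0r; rewrite WE /e.
have Hn := H0 x0 y0 y00.
rewrite (_ : _ - _ = Re (V x0 y0) / 2); last by field; exact: lt0r_neq0.
by apply/negP; rewrite -ltNge divr_gt0.
Qed.

End phragmen_lindelof.

(** * Constancy of F_a exp(a Lam) *)

(** The logarithmic derivative of (A + iB) exp (it) is half
    that of its squared modulus A^2 + B^2, hence real. *)
Lemma phase_constant {R : realType} (A B A1 B1 t : R -> R) :
  (forall s, 0 < A s ^+ 2 + B s ^+ 2) ->
  (forall s : R, is_derive s 1 A (- B1 s)) -> (forall s : R, is_derive s 1 B (A1 s)) ->
  (forall s : R, is_derive s 1 t (- (A s * A1 s + B s * B1 s) / (A s ^+ 2 + B s ^+ 2))) ->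
  forall x, (A 0 * cos (t 0) - B 0 * sin (t 0)) * (A x * sin (t x) + B x * cos (t x)) -
    (A 0 * sin (t 0) + B 0 * cos (t 0)) * (A x * cos (t x) - B x * sin (t x)) = 0.
Proof.
move=> S0 dA dB dt x.
pose q (c1 c2 s : R) : R := c1 * (A s * sin (t s) + B s * cos (t s)) - c2 * (A s * cos (t s) - B s * sin (t s)).
have dQ (c1 c2 s : R) : is_derive s 1 (fun s => q c1 c2 s ^+ 2 / (A s ^+ 2 + B s ^+ 2)) 0.
  have n0 := lt0r_neq0 (S0 s); have hA := dA s; have hB := dB s; have ht := dt s.
  by rewrite /q; der => //; rewrite /=; field.
have Qc (c1 c2 : R) : q c1 c2 x ^+ 2 / (A x ^+ 2 + B x ^+ 2) = q c1 c2 0 ^+ 2 / (A 0 ^+ 2 + B 0 ^+ 2).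
  exact: (@is_derive_0_is_cst _ (fun s => q c1 c2 s ^+ 2 / (A s ^+ 2 + B s ^+ 2))).
pose c1 := A 0 * cos (t 0) - B 0 * sin (t 0); pose c2 := A 0 * sin (t 0) + B 0 * cos (t 0).
have q0 : q c1 c2 0 = 0 by rewrite /q mulrC subrr.
have /eqP := Qc c1 c2; rewrite q0 expr0n /= mul0r mulf_eq0 invr_eq0.
by rewrite (gt_eqF (S0 x)) orbF sqrf_eq0 => /eqP.
Qed.

Section extremal_identity.
Context {R : realType}.
Local Notation C := R[i].
Local Notation Re := complex.Re.
Local Notation Im := complex.Im.
Local Notation mu := (@lebesgue_measure R).
Variable a : R.
Hypothesis a0 : 0 < a.
Variable m : probability (measurableTypeR R) R.
Hypothesis mp : has_density m (mu_density a).
Variable K : R.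
Hypothesis pK : forall x : R, mu_density a x <= K / (1 + x ^+ 2).

Let p0 (x : R) : 0 <= mu_density a x. Proof. by rewrite ltW // mu_density_gt0. Qed.
Let cp := continuous_mu_density a0.
Let L := Lam m.

(** F_a exp(a Lam); the theorem amounts to its modulus being Gamma(a) on the
    real line. *)
Definition GG (x y : R) : C := FT a x y * cexp (Complex a 0 * L x y).

Let Re_exp (x y : R) : Re (cexp (Complex a 0 * L x y)) = expR (a * Re (L x y)) * cos (a * Im (L x y)).
Proof. by rewrite -ReM_real -ImM_real. Qed.

Let Im_exp (x y : R) : Im (cexp (Complex a 0 * L x y)) = expR (a * Re (L x y)) * sin (a * Im (L x y)).
Proof. by rewrite -ReM_real -ImM_real. Qed.

Let Re_GG (x y : R) : Re (GG x y) = expR (a * Re (L x y)) *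
  (Re (FT a x y) * cos (a * Im (L x y)) - Im (FT a x y) * sin (a * Im (L x y))).
Proof. by rewrite ReM Re_exp Im_exp; ring. Qed.

Let Im_GG (x y : R) : Im (GG x y) = expR (a * Re (L x y)) *
  (Re (FT a x y) * sin (a * Im (L x y)) + Im (FT a x y) * cos (a * Im (L x y))).
Proof. by rewrite ImM Re_exp Im_exp; ring. Qed.

Let nsqG (x y : R) : nsq (GG x y) = nsq (FT a x y) * expR (2 * (a * Re (L x y))).
Proof. by rewrite nsqM nsq_cexp ReM_real. Qed.

Let holo2_GG : holo2 GG.
Proof.
apply: holo2_mul.
  eexists; eexists => x y y0; have a10 : 0 < a + 1 by rewrite addr_gt0.
  by split; [exact: holo_FT|exact: (holo_mul (holo_cst _ x y) (holo_FT x y a10))].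
apply: holo2_cexp; apply: holo2_mul; first exact: holo2_cst.
exists (Lam' m), (Lam'' m) => x y y0.
by split; [exact: (holo_Lam mp p0 cp pK)|exact: holo_Lam'].
Qed.

Let GG_cvg (x y : R) (u w : nat -> R) : 0 <= y -> (forall n, 0 <= w n) ->
  u n @[n --> \oo] --> x -> w n @[n --> \oo] --> y ->
  Re (GG (u n) (w n)) @[n --> \oo] --> Re (GG x y) /\
  Im (GG (u n) (w n)) @[n --> \oo] --> Im (GG x y).
Proof.
move=> y0 w0 ux wy.
have [f1 f2] := FT_cvg a0 ux wy.
have [l1 l2] := Lam_cvg mp p0 cp pK y0 w0 ux wy.
have e1 : expR (a * Re (L (u n) (w n))) @[n --> \oo] --> expR (a * Re (L x y)).
  by apply: (cvgn_comp (f := expR)); [exact: continuous_expR|exact: cvgMr].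
have e2 : cos (a * Im (L (u n) (w n))) @[n --> \oo] --> cos (a * Im (L x y)).
  by apply: (cvgn_comp (f := cos)); [exact: continuous_cos|exact: cvgMr].
have e3 : sin (a * Im (L (u n) (w n))) @[n --> \oo] --> sin (a * Im (L x y)).
  by apply: (cvgn_comp (f := sin)); [exact: continuous_sin|exact: cvgMr].
split.
  rewrite Re_GG; under eq_fun do rewrite Re_GG.
  by apply: cvgM => //; apply: cvgB; exact: cvgM.
rewrite Im_GG; under eq_fun do rewrite Im_GG.
by apply: cvgM => //; apply: cvgD; exact: cvgM.
Qed.

(** With n the integer part of a, F_a is O(|z|^(-n)) and exp(a Lam) is
    O(|z|^a). *)
Let GG_growth : exists b B : R, [/\ 0 <= b, b < 1, 0 <= B &
  forall x y : R, 0 <= y -> nsq (GG x y) <= B * (1 + x ^+ 2 + y ^+ 2) `^ b].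
Proof.
pose n := Num.truncn a.
have /andP[na an] : n%:R <= a < n.+1%:R by rewrite truncn_itv // ltW.
have [K1 K10 h1] := FT_decay a0 na.
have n00 : 0%:R <= a by rewrite ltW.
have [K2 K20 h2] := FT_decay a0 n00.
pose k := ln 2 / 2 + Re (L 0 1).
exists (a - n%:R), (2 ^+ n * (K1 + K2) * expR (2 * a * k)); split.
- by rewrite subr_ge0.
- by rewrite ltrBlDl natr1.
- by rewrite !mulr_ge0 ?expR_ge0 ?exprn_ge0 ?addr_ge0.
move=> x y y0; pose q := 1 + x ^+ 2 + y ^+ 2.
have s0 : 0 <= x ^+ 2 + y ^+ 2 by rewrite addr_ge0 ?sqr_ge0.
have qE : q = 1 + (x ^+ 2 + y ^+ 2) by rewrite addrA.
have q0 : 0 < q by rewrite qE ltr_pwDl.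
have hF : q ^+ n * nsq (FT a x y) <= 2 ^+ n * (K1 + K2).
  have := h2 x y y0; have := h1 x y y0; rewrite expr0 mul1r => hn hb.
  have F0 := nsq_ge0 (FT a x y).
  have [s1|/ltW s1] := leP (x ^+ 2 + y ^+ 2) 1.
    apply: ler_pM => //; first by rewrite exprn_ge0 // ltW.
      by rewrite lerXn2r ?nnegrE ?(ltW q0) // qE; lra.
    by apply: le_trans hb _; rewrite lerDr.
  apply: (@le_trans _ _ (2 ^+ n * ((x ^+ 2 + y ^+ 2) ^+ n * nsq (FT a x y)))).
    rewrite mulrA -exprMn ler_wpM2r // lerXn2r ?nnegrE ?(ltW q0) ?mulr_ge0 // qE; lra.
  by rewrite ler_wpM2l ?exprn_ge0 // (le_trans hn) // lerDl.
have hE : expR (2 * (a * Re (L x y))) <= q `^ (a - n%:R) * q ^+ n * expR (2 * a * k).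
  rewrite -powR_mulrn ?(ltW q0) // -powRD; last by rewrite (gt_eqF q0) implybT.
  rewrite subrK /powR gt_eqF // -expRD ler_expR.
  have := Lam_le mp p0 cp pK x y0; rewrite -/L -/k -/q => h.
  have := ler_wpM2l (ltW a0) h; lra.
rewrite nsqG; apply: le_trans (ler_wpM2l (nsq_ge0 _) hE) _.
rewrite [leLHS](_ : _ = q ^+ n * nsq (FT a x y) * (q `^ (a - n%:R) * expR (2 * a * k))); last by ring.
rewrite [leRHS](_ : _ = 2 ^+ n * (K1 + K2) * (q `^ (a - n%:R) * expR (2 * a * k))); last by rewrite /q; ring.
by rewrite ler_wpM2r // mulr_ge0 ?powR_ge0 ?expR_ge0.
Qed.

(** The arguments of F_a and of exp(a Lam) have opposite derivatives. *)
Let GG_phase (x : R) : Re (GG 0 0) * Im (GG x 0) - Im (GG 0 0) * Re (GG x 0) = 0.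
Proof.
have h := @phase_constant R (fun x => Re (FT a x 0)) (fun x => Im (FT a x 0))
  (fun x => Re (FT (a + 1) x 0)) (fun x => Im (FT (a + 1) x 0)) (fun x => a * Im (L x 0)).
rewrite !Re_GG !Im_GG.
apply: (etrans _ (etrans (congr1 (fun z => expR (a * Re (L 0 0)) * expR (a * Re (L x 0)) * z)
  (h _ _ _ _ x)) (mulr0 _))); first by ring.
- move=> s; exact: FT_neq0.
- move=> s; have [d _ _ _] := holo_FT s 0 a0.
  by apply: drv_eq d _; rewrite ReM /= mul0r mul1r sub0r.
- move=> s; have [_ d _ _] := holo_FT s 0 a0.
  by apply: drv_eq d _; rewrite ImM /= mul0r mul1r add0r.
- move=> s; have d := is_derive_ImLam mp p0 cp pK s.
  apply: drv_eq (drv_mul (drv_cst s a) d) _; rewrite -mu_density_wronskian //.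
  have := FT_neq0 a0 s; rewrite /nsq => n0; field; exact: lt0r_neq0.
Qed.

Let half_plane_le0 (c : C) : (forall x, Re (c * GG x 0) = 0) ->
  forall x y, 0 <= y -> Re (c * GG x y) <= 0.
Proof.
move=> c0; have [b [B [b0 b1 B0 hB]]] := GG_growth.
apply: (@phragmen_lindelof _ (fun x y => c * GG x y) b (nsq c * B)) => //.
- by rewrite mulr_ge0 ?nsq_ge0.
- by apply: holo2_mul holo2_GG; exact: holo2_cst.
- move=> x y u w y0 w0 ux wy; have [c1 c2] := GG_cvg y0 w0 ux wy.
  rewrite ReM; under eq_fun do rewrite ReM.
  by apply: cvgB; exact: cvgMr.
- by move=> x; rewrite c0.
- move=> x y y0; apply: (@le_trans _ _ (nsq (c * GG x y))).
    by rewrite /nsq lerDl sqr_ge0.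
  by rewrite nsqM -mulrA ler_wpM2l ?nsq_ge0 // hB.
Qed.

(** -i times the conjugate of G(0), so that the real part of c0 G is the
    imaginary part of conj(G(0)) G. *)
Let c0 : C := Complex (- Im (GG 0 0)) (- Re (GG 0 0)).

Let half_plane (x y : R) : 0 <= y -> Re (c0 * GG x y) = 0.
Proof.
move=> y0; have e (z : R) : Re (c0 * GG z 0) = 0.
  by rewrite -[RHS](GG_phase z) ReM /c0 /=; ring.
have h1 := half_plane_le0 e x y0.
have h2 : Re (- c0 * GG x y) <= 0.
  by apply: half_plane_le0 y0 => z; rewrite mulNr raddfN /= e oppr0.
by apply/eqP; rewrite eq_le h1 /= -oppr_le0 -raddfN -mulNr.
Qed.

Let nsq_c0 : 0 < nsq c0.
Proof.
have -> : nsq c0 = nsq (GG 0 0) by rewrite /nsq /c0 /= !sqrrN addrC.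
by rewrite nsqG mulr_gt0 ?expR_gt0 ?FT_neq0.
Qed.

(** Re(c0 G) = 0 in the half-plane, so that the vertical derivative of Im(c0 G)
    is 0 by the Cauchy-Riemann equations. *)
Let nsqG_cst (x y : R) : 0 < y -> nsq (GG x y) = nsq (GG x 1).
Proof.
have [V1 [V2 hV]] : holo2 (fun x y => c0 * GG x y) by apply: holo2_mul holo2_GG; exact: holo2_cst.
have dV (s t : R) : 0 < t -> is_derive t 1 (fun t => Im (c0 * GG s t)) 0.
  move=> t0; have [[h1 _ _ h4] _] := hV s t t0.
  apply: drv_eq h4 _.
  have h := drv_ext (fun z => half_plane z (ltW t0)) (drv_cst s 0).
  by rewrite -(@derive_val _ _ _ _ _ _ _ h1) (@derive_val _ _ _ _ _ _ _ h).
have eI (t1 t2 : R) : 0 < t1 -> t1 < t2 -> Im (c0 * GG x t1) = Im (c0 * GG x t2).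
  move=> t10 t12.
  have [||c _] := @MVT _ (fun t => Im (c0 * GG x t)) (fun=> 0) t1 t2 t12.
  - by move=> t; rewrite in_itv /= => /andP[h _]; apply: dV; exact: lt_trans h.
  - apply: continuous_in_subspaceT => t; rewrite inE /= in_itv /= => /andP[h _].
    by apply: drv_continuous (dV x t _); exact: lt_le_trans h.
  by rewrite mul0r => /eqP; rewrite subr_eq0 => /eqP ->.
move=> y0; have e : nsq (c0 * GG x y) = nsq (c0 * GG x 1).
  rewrite {1 2}/nsq !half_plane ?(ltW y0) //.
  by have [h|h|->//] := ltgtP y 1; [rewrite (eI y 1)|rewrite (eI 1 y)].
by move: e; rewrite !nsqM; apply: mulfI; exact: (lt0r_neq0 nsq_c0).
Qed.

(** |G| is constant on the vertical line through x and tends to Gamma(a) along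
    it. *)
Lemma FT_potential (x : R) : nsq (FT a x 0) * expR (2 * (a * Re (L x 0))) = Gamma a ^+ 2.
Proof.
have e1 : nsq (GG x 0) = nsq (GG x 1).
  have n0 (n : nat) : 0 < n.+1%:R^-1 :> R by rewrite invr_gt0 ltr0n.
  have [c1 c2] := GG_cvg (x := x) (u := fun=> x) (lexx 0) (fun n => ltW (n0 n)) (cvg_cst x) (@cvg_harmonic R).
  have c : nsq (GG x n.+1%:R^-1) @[n --> \oo] --> nsq (GG x 0).
    by apply: cvgD; apply: (cvgn_comp (f := fun z => z ^+ 2)) => //; exact: exprn_continuous.
  apply: cvgn_unique c _; under eq_fun do rewrite nsqG_cst //.
  exact: cvg_cst.
rewrite -nsqG e1.
have lim : nsq (FT a x n.+1%:R) * n.+1%:R `^ a ^+ 2 * expR (2 * a * (Re (L x n.+1%:R) - ln n.+1%:R))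
    @[n --> \oo] --> Gamma a ^+ 2 * expR (2 * a * 0).
  apply: cvgM; first exact: FT_asymptotic.
  apply: (cvgn_comp (f := expR)); first exact: continuous_expR.
  by apply: cvgMr; exact: (Lam_asymptotic mp p0 cp pK).
rewrite mulr0 expR0 mulr1 in lim.
apply: cvgn_unique lim; apply: cvg_near_cst; apply: nearW => n.
have n0 : 0 < n.+1%:R :> R by rewrite ltr0n.
rewrite -(nsqG_cst x n0) nsqG -mulrA; congr (_ * _).
rewrite /powR gt_eqF // expr2 -!expRD; congr expR; ring.
Qed.

Lemma integrable_log_kernel (x : R) :
  m.-integrable setT (EFin \o (fun s : R => log_kernel x s)) /\
  \int[m]_s log_kernel x s = Re (L x 0).
Proof.
have e s : Re (lk (x - s) 0) = log_kernel x s.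
  rewrite /lk /log_kernel /= expr0n /= addr0 -real_normK ?num_real //.
  have [->|h] := eqVneq (x - s) 0; first by rewrite normr0 expr0n /= ln0 // mul0r.
  by rewrite lnXn ?normr_gt0 // mulr2n; field.
have [h _] := integrable_lk mp p0 cp pK x (lexx 0).
split; last by rewrite ReLam; apply: eq_Rintegral => s _; rewrite e.
by move: h; under eq_fun do rewrite e.
Qed.

End extremal_identity.

Theorem mainTheorem3 (R : realType) (alpha : R)
    (mu : probability (measurableTypeR R) R) :
  0 < alpha ->
  has_density mu (mu_density alpha) ->
  forall E : R,
    mu.-integrable [set: measurableTypeR R] (fun y => (log_kernel E y)%:E) /\
    mu_density alpha E =
      1 / (Num.sqrt (2 * pi) * Gamma (alpha + 1)) *
      expR (- E ^+ 2 / 2 +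
            2 * alpha * \int[mu]_(y in [set: measurableTypeR R]) log_kernel E y).
Proof.
move=> a0 mp E; have [K K0 pK] := mu_density_le a0 mp.
have [li le] := integrable_log_kernel a0 mp pK E.
split; first exact: li.
rewrite le mu_densityE // GammaD1 // expRD.
have := FT_potential a0 mp pK E; rewrite mulrA.
have S0 := FT_neq0 a0 E; have G0 := Gamma_gt0 a0.
have X0 := expR_gt0 (2 * alpha * complex.Re (Lam mu E 0)).
have s0 : 0 < Num.sqrt (2 * pi) :> R by rewrite sqrtr_gt0 mulr_gt0 // pi_gt0.
move: (nsq _) S0 (expR (2 * _ * _)) X0 => S S0 X X0 e.
have -> : X = Gamma alpha ^+ 2 / S by rewrite -e; field; exact: lt0r_neq0.
by field; rewrite !gt_eqF.
Qed.
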